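(* Let $p,q\ge1$. To every nonempty open $\mathcal{R}$-proper set $\Omega\subset\mathrm{Gr}_p(\mathbb{R}^{p+q})$ which is a convex subset of some affine chart one can associate a complete length metric $K_\Omega$ on $\Omega$ such that: (1) (Invariance) $\mathrm{Aut}(\Omega)$ acts by isometries on $(\Omega,K_\Omega)$. (2) (Equivariance) If $\Phi\in\mathrm{PGL}_{p+q}(\mathbb{R})$ then $K_\Omega(x,y)=K_{\Phi\Omega}(\Phi x,\Phi y)$ for all $x,y\in\Omega$. (3) (Continuity in the local Hausdorff topology) If $\mathbb{M}$ is an affine chart and $\Omega_n\subset\mathbb{M}$ is a sequence of $\mathcal{R}$-proper convex open sets converging in the local Hausdorff topology to an $\mathcal{R}$-proper convex open set $\Omega\subset\mathbb{M}$, then $K_{\Omega_n}$ converges to $K_\Omega$, uniformly on compact subsets of $\Omega\times\Omega$. (4) If $p=1$ then $K_\Omega$ coincides with the classical Hilbert metric on $\Omega$.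
   Context: $\mathrm{Gr}_p(\mathbb{R}^{p+q})$ is the Grassmannian of $p$-dimensional subspaces of $\mathbb{R}^{p+q}$, with its natural $\mathrm{PGL}_{p+q}(\mathbb{R})$-action. It is regarded as a closed subset of $\mathbb{P}(\wedge^p\mathbb{R}^{p+q})$ via $\mathrm{Span}(v_1,\dots,v_p)\mapsto[v_1\wedge\dots\wedge v_p]$. An affine chart is a set $\mathbb{M}=\{U: U\cap W_0=(0)\}$ for some $q$-dimensional subspace $W_0$. Fixing $U_0\in\mathbb{M}$ one identifies $\mathbb{M}$ with $\mathrm{Hom}(U_0,W_0)$ by $T\mapsto\{u+Tu:u\in U_0\}$, hence (choosing bases) with the space $M_{q,p}(\mathbb{R})\cong\mathbb{R}^{pq}$ of $q\times p$ matrices; different choices change this by $X\mapsto AXB+C$ with $A\in \mathrm{GL}_q(\mathbb R)$, $B\in\mathrm{GL}_p(\mathbb R)$, so convexity in $\mathbb{M}$ is well defined. If $\Omega$ is convex in $\mathbb{M}$ then $\Phi\Omega$ is convex in the affine chart $\Phi\mathbb{M}$. $\mathrm{Aut}(\Omega)=\{\varphi\in\mathrm{PGL}_{p+q}(\mathbb{R}):\varphi\Omega=\Omega\}$. Let $\mathcal{L}$ be the set of projective lines of $\mathbb{P}(\wedge^p\mathbb{R}^{p+q})$ contained in $\mathrm{Gr}_p(\mathbb{R}^{p+q})$; an open connected set $\Omega$ is $\mathcal{R}$-proper if $|\ell\setminus(\ell\cap\Omega)|>1$ for all $\ell\in\mathcal{L}$. Local Hausdorff convergence: identify $\mathbb{M}$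 with $\mathbb{R}^{pq}$. For $A\subset\mathbb{R}^{pq}$ and $R>0$ let $A^{(R)}=A\cap B_R(0)$, with $B_R(0)$ the closed Euclidean ball. $d_H(A,B)=\inf\{\epsilon>0: A\subset\mathcal{N}_\epsilon(B),\ B\subset\mathcal{N}_\epsilon(A)\}$, where $\mathcal{N}_\epsilon$ is the Euclidean $\epsilon$-neighborhood. Open convex sets $A_n$ converge to an open convex set $A$ in the local Hausdorff topology if $d_H(\overline{A_n}^{(R)},\overline{A}^{(R)})\to0$ for all $R>0$. A length metric is one in which the distance between two points is the infimum of the lengths of curves joining them. Classical Hilbert metric (case $p=1$): for distinct $x,y\in\Omega\subset\mathbb{P}(\mathbb{R}^{q+1})$, let $a,b$ be the endpoints of the open interval in which the projective line through $x,y$ meets $\Omega$; then the distance is $\left|\log\frac{|x-b||y-a|}{|x-a||y-b|}\right|$ (the fraction being the cross ratio of the collinear points $a,x,y,b$, interpreted projectively), and the distance from $x$ to $x$ is $0$. *)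

(* Defs.v *)
From HB Require Import structures.
From mathcomp Require Import all_boot all_order all_algebra.
From mathcomp Require Import generic_quotient.
From mathcomp Require Import all_classical all_reals all_analysis.

Set Implicit Arguments.
Unset Strict Implicit.
Unset Printing Implicit Defensive.

Import Order.TTheory GRing.Theory Num.Theory.
Import numFieldNormedType.Exports.

Local Open Scope classical_set_scope.
Local Open Scope ring_scope.

(* Projective space P(R^N): lines of R^N, with the quotient topology of
   R^N \ {0} (an open subset of R^N). *)

Definition proj_space (R : realType) (N : nat) : Type :=
  {l : {vspace 'rV[R]_N} | \dim l == 1%N}.

HB.instance Definition _ (R : realType) N := Choice.on (proj_space R N).

Section ProjTopology.
Variables (R : realType) (N : nat).

Definition proj_cone (A : set (proj_space R N)) : set 'rV[R]_N :=
  [set v | v != 0 /\ exists2 l, A l & v \in val l].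

Definition proj_space_open (A : set (proj_space R N)) : Prop := open (proj_cone A).

Lemma proj_memE (l : proj_space R N) (v : 'rV[R]_N) :
  v != 0 -> v \in val l -> val l = <[v]>%VS.
Proof.
move=> v0 vl; apply/esym/eqP; rewrite eqEdim -memvE vl /= dim_vline v0.
by rewrite (eqP (valP l)).
Qed.

Lemma proj_dim_line (v : 'rV[R]_N) : v != 0 -> \dim <[v]> == 1%N.
Proof. by move=> v0; rewrite dim_vline v0. Qed.

Let proj_space_openT : proj_space_open setT.
Proof.
rewrite /proj_space_open (_ : proj_cone setT = ~` [set 0]).
  by apply: closed_openC; exact: accessible_closed_set1 (hausdorff_accessible (@norm_hausdorff _ _)) _.
apply/seteqP; split=> v /=; first by case=> /eqP.
move=> /eqP v0; split=> //.
by exists (exist _ <[v]>%VS (proj_dim_line v0)) => //; exact: memv_line.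
Qed.

Let proj_space_openI : setI_closed proj_space_open.
Proof.
move=> A B oA oB; rewrite /proj_space_open.
rewrite (_ : proj_cone _ = proj_cone A `&` proj_cone B); first exact: openI.
apply/seteqP; split=> v /=.
  by case=> v0 [l [Al Bl] vl]; split; split=> //; exists l.
case=> -[v0 [l Al vl]] [_ [m Bm vm]]; split=> //; exists l => //; split=> //.
by rewrite (_ : l = m) //; apply: val_inj; rewrite (proj_memE v0 vl) (proj_memE v0 vm).
Qed.

Let proj_space_open_bigU (I : Type) (f : I -> set (proj_space R N)) :
  (forall i, proj_space_open (f i)) -> proj_space_open (\bigcup_i f i).
Proof.
move=> of_; rewrite /proj_space_open.
rewrite (_ : proj_cone _ = \bigcup_i proj_cone (f i)).
  by apply: bigcup_open => i _; exact: of_.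
apply/seteqP; split=> v /=.
  by case=> v0 [l [i _ fl] vl]; exists i => //; split=> //; exists l.
by case=> i _ [v0 [l fl vl]]; split=> //; exists l => //; exists i.
Qed.

HB.instance Definition _ :=
  isOpenTopological.Build (proj_space R N) proj_space_openT proj_space_openI proj_space_open_bigU.

End ProjTopology.

(* The exterior power of order p of R^n, in the coordinates of the standard
   basis e_(f 0) /\ ... /\ e_(f p.-1), f ranging over the strictly increasing
   maps 'I_p -> 'I_n. *)

Definition incr_map (p n : nat) : Type :=
  {f : {ffun 'I_p -> 'I_n} |
    [forall i : 'I_p, forall j : 'I_p, (i < j)%N ==> (f i < f j)%N]}.

HB.instance Definition _ p n := Finite.on (incr_map p n).

Definition ext_dim (p n : nat) : nat := #|{: incr_map p n}|.

Section Pluecker.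
Variables (R : realType) (p n : nat).
Implicit Types (s t : seq 'rV[R]_n).

Definition rows_of s : 'M[R]_(p, n) := \matrix_(i < p) s`_i.

(* The coordinates of s`_0 /\ ... /\ s`_p.-1 are its p x p minors. *)
Definition wedge s : 'rV[R]_(ext_dim p n) :=
  \row_k \det (colsub (val (enum_val k : incr_map p n)) (rows_of s)).

Lemma rows_of_free s : size s = p -> free s -> row_free (rows_of s).
Proof.
move=> /eqP ss fs; rewrite -kermx_eq0; apply/eqP/row_matrixP => i.
rewrite row0; set u := row i _.
have u0 : u *m rows_of s = 0 by rewrite -row_mul mulmx_ker row0.
have /freeP/(_ (fun j => u 0 j)) k0 : free (Tuple ss) by [].
apply/rowP => j; rewrite [RHS]mxE k0// -[RHS]u0.
apply/rowP => k; rewrite mxE summxE; apply: eq_bigr => l _.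
by rewrite !mxE.
Qed.

Lemma wedge_neq0 s : size s = p -> free s -> wedge s != 0.
Proof.
move=> ss fs; set B := (rows_of s)^T.
have rB : row_full B by rewrite /row_full mxrank_tr; exact: rows_of_free.
have [f [f_inj f_full]] : exists f : 'I_p -> 'I_n,
    injective f /\ row_full (rowsub f B).
  exists (fullrankfun rB); split; last exact: fullrowsub_full.
  exact: (@fullrankfun_inj _ _ _ _ rB).
pose e := [seq x <- enum 'I_n | x \in codom f].
have se : size e = p.
  rewrite -[RHS]card_ord -(card_codom f_inj) cardE.
  by rewrite /enum_mem -enumT.
have soe : sorted (fun a b : 'I_n => (a < b)%N) e.
  apply: sorted_filter => [a b c|]; first exact: ltn_trans.
  by have := iota_ltn_sorted 0 n; rewrite -val_enum_ord sorted_map.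
pose g := [ffun i : 'I_p => nth (f i) e i].
have gi : [forall i : 'I_p, forall j : 'I_p, (i < j)%N ==> (g i < g j)%N].
  apply/forallP => i; apply/forallP => j; apply/implyP => ij; rewrite !ffunE.
  rewrite (set_nth_default (f j) (f i)) ?se//.
  by apply: (@sorted_ltn_nth _ (fun a b : 'I_n => (a < b)%N)) => //;
    rewrite ?inE ?se// => a b c; exact: ltn_trans.
apply/negP => /eqP/rowP/(_ (enum_rank (exist _ g gi : incr_map p n))).
rewrite !mxE enum_rankK /= => /eqP; apply/negP.
rewrite -unitfE -[_ \is a _]/(_ \in unitmx) -unitmx_tr -row_full_unit.
rewrite -sub1mx (submx_trans _ (_ : (rowsub f B <= _)%MS))//.
  by rewrite sub1mx.
apply/row_subP => i.
have /(nthP (f i)) [j] : f i \in e by rewrite mem_filter codom_f mem_enum.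
rewrite se => jp ej.
apply: (eq_row_sub (Ordinal jp)); apply/rowP => k.
by rewrite !mxE ffunE /= (set_nth_default (f i)) ?se// ej.
Qed.

(* s`_0 /\ ... /\ s`_p.-1 depends on the span of s only up to a scalar. *)
Lemma wedge_span s t : size s = p -> size t = p -> free s -> free t ->
  span s = span t -> <[wedge s]>%VS = <[wedge t]>%VS.
Proof.
move=> ss st fs ft est; apply/eqP; rewrite eqEdim !dim_vline.
rewrite !wedge_neq0//= andbT -memvE.
have /eqP st' := st.
pose C := \matrix_(i < p, j < p) coord (Tuple st') j s`_i.
suff -> : wedge s = \det C *: wedge t by rewrite memvZ ?memv_line.
have Cst : rows_of s = C *m rows_of t.
  apply/row_matrixP => i; rewrite row_mul; apply/rowP => k; rewrite !mxE.
  have : s`_i \in span (Tuple st').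
    by rewrite /= -est memv_span// mem_nth// ss.
  move=> /coord_span/rowP/(_ k) ->; rewrite summxE; apply: eq_bigr => j _.
  by rewrite !mxE.
apply/rowP => k; rewrite !mxE -det_mulmx Cst; congr (\det _).
by apply/matrixP => i j; rewrite !mxE; apply: eq_bigr => l _; rewrite !mxE.
Qed.

End Pluecker.

(* The Grassmannian of p-dimensional subspaces of R^(p+q), with the topology
   induced by the Pluecker embedding in P(/\^p R^(p+q)). *)

Definition Gr (R : realType) (p q : nat) : Type :=
  {U : {vspace 'rV[R]_(p + q)} | \dim U == p}.

HB.instance Definition _ (R : realType) p q := Choice.on (Gr R p q).

Section Grassmannian.
Variables (R : realType) (p q : nat).

Lemma wedge_vbasis_neq0 (U : Gr R p q) : wedge p (vbasis (val U)) != 0.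
Proof.
apply: wedge_neq0; first by rewrite size_tuple (eqP (valP U)).
by rewrite (basis_free (vbasisP _)).
Qed.

Definition pluecker (U : Gr R p q) : proj_space R (ext_dim p (p + q)) :=
  exist _ <[wedge p (vbasis (val U))]>%VS (proj_dim_line (wedge_vbasis_neq0 U)).

Lemma plueckerE (U : Gr R p q) (s : seq 'rV[R]_(p + q)) :
  basis_of (val U) s -> val (pluecker U) = <[wedge p s]>%VS.
Proof.
move=> bs; have bU := vbasisP (val U).
apply: wedge_span; rewrite ?(basis_free bs) ?(basis_free bU)//.
- by rewrite size_tuple (eqP (valP U)).
- by rewrite -(eqP (basis_free bs)) (span_basis bs) (eqP (valP U)).
- by rewrite (span_basis bs) (span_basis bU).
Qed.

End Grassmannian.

HB.instance Definition _ (R : realType) p q :=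
  Topological.copy (Gr R p q) (initial_topology (@pluecker R p q)).

(* A projective line of P(R^N) is a 2-dimensional subspace L of R^N, its points
   being the lines of R^N contained in L. *)
Definition on_proj_line (R : realType) (N : nat) (L : {vspace 'rV[R]_N}) :
  set (proj_space R N) := [set l | (val l <= L)%VS].

(* The set of projective lines of P(/\^p R^(p+q)) contained in Gr. *)
Definition gr_lines (R : realType) (p q : nat) :
    set {vspace 'rV[R]_(ext_dim p (p + q))} :=
  [set L | \dim L = 2%N /\ on_proj_line L `<=` range (@pluecker R p q)].

Definition R_proper (R : realType) (p q : nat) (Om : set (Gr R p q)) : Prop :=
  [/\ open Om, connected Om &
      forall L, @gr_lines R p q L ->
        exists l1 l2, [/\ l1 <> l2,
          (on_proj_line L `\` (@pluecker R p q @` Om)) l1 &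
          (on_proj_line L `\` (@pluecker R p q @` Om)) l2]].

Section Charts.
Variables (R : realType) (p q : nat).
Local Notation V := 'rV[R]_(p + q).
Implicit Types (W : {vspace V}) (U : Gr R p q) (u : p.-tuple V)
  (w : q.-tuple V) (Om : set (Gr R p q)).

Definition affine_chart W : set (Gr R p q) :=
  [set U | (val U :&: W)%VS = 0%VS].

Definition chart_bases W U u w : Prop :=
  [/\ \dim W = q, affine_chart W U, basis_of (val U) u & basis_of W w].

(* The graph {x + T x : x in U} of the linear map T : U -> W with matrix X
   in the bases u of U and w of W. *)
Definition graph_space u w (X : 'M[R]_(q, p)) : {vspace V} :=
  span [seq tnth u j + \sum_(i < q) X i j *: tnth w i | j <- enum 'I_p].

(* Om seen in M_(q,p)(R). *)
Definition chart_coord u w Om : set 'M[R]_(q, p) :=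
  [set X | exists2 U, Om U & val U = graph_space u w X].

(* Changing U, u, w acts on M_(q,p)(R) by X |-> A X B + C, so convexity does not
   depend on them. *)
Definition convex_in_chart W Om : Prop :=
  Om `<=` affine_chart W /\
  exists U u w, chart_bases W U u w /\
    @convex_set R 'M[R]_(q, p) (chart_coord u w Om).

Definition convex_in_some_chart Om : Prop :=
  exists W, \dim W = q /\ convex_in_chart W Om.

End Charts.

(* PGL_(p+q)(R): linear automorphisms of R^(p+q) modulo nonzero scalars. *)

Definition GL (R : realType) (n : nat) : Type :=
  {f : 'End('rV[R]_n) | lker f == 0%VS}.

HB.instance Definition _ (R : realType) n := Choice.on (GL R n).

Section PGL.
Variables (R : realType) (n : nat).

Definition GL_prop (f g : GL R n) : bool :=
  `[< exists2 c : R, c != 0 & val g = c *: val f >].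

Lemma GL_prop_refl : reflexive GL_prop.
Proof. by move=> f; apply/asboolP; exists 1; rewrite ?oner_neq0 ?scale1r. Qed.

Lemma GL_prop_sym : symmetric GL_prop.
Proof.
suff H f g : GL_prop f g -> GL_prop g f by move=> f g; apply/idP/idP; exact: H.
move=> /asboolP[c c0 e]; apply/asboolP; exists c^-1; first by rewrite invr_eq0.
by rewrite e scalerA mulVf// scale1r.
Qed.

Lemma GL_prop_trans : transitive GL_prop.
Proof.
move=> g f h /asboolP[c c0 e] /asboolP[d d0 e']; apply/asboolP.
by exists (d * c); rewrite ?mulf_neq0// e' e scalerA.
Qed.

Canonical GL_prop_equiv := EquivRel GL_prop GL_prop_refl GL_prop_sym GL_prop_trans.

Definition PGL : Type := {eq_quot GL_prop_equiv}%qT.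

End PGL.

Section Action.
Variables (R : realType) (p q : nat).
Local Open Scope quotient_scope.

Lemma GL_act_dim (f : GL R (p + q)) (U : Gr R p q) :
  \dim (val f @: val U)%VS == p.
Proof. by rewrite limg_dim_eq ?(valP U)// (eqP (valP f)) capv0. Qed.

Definition GL_act (f : GL R (p + q)) (U : Gr R p q) : Gr R p q :=
  exist _ (val f @: val U)%VS (GL_act_dim f U).

Definition PGL_act (F : PGL R (p + q)) : Gr R p q -> Gr R p q :=
  GL_act (repr F).

Lemma GL_act_prop (f g : GL R (p + q)) U : GL_prop f g -> GL_act f U = GL_act g U.
Proof.
move=> /asboolP[c c0 e]; apply: val_inj; rewrite /= e.
apply/eqP; rewrite eqEdim; apply/andP; split; last first.
  by rewrite -e !limg_dim_eq ?(eqP (valP f)) ?(eqP (valP g)) ?capv0.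
apply/subvP => _ /memv_imgP[x xU ->].
rewrite (_ : val f x = (c *: val f)%VF (c^-1 *: x)).
  by rewrite memv_img// memvZ.
by rewrite scale_lfunE linearZ scalerA mulfV// scale1r.
Qed.

Lemma PGL_act_pi (f : GL R (p + q)) U :
  PGL_act (\pi_(PGL R (p + q)) f) U = GL_act f U.
Proof. by apply: GL_act_prop; rewrite -eqmodE reprK. Qed.

Definition Aut_gr (Om : set (Gr R p q)) : set (PGL R (p + q)) :=
  [set F | PGL_act F @` Om = Om].

End Action.

Section LengthMetric.
Variables (R : realType) (T : Type) (A : set T) (d : T -> T -> R).
Local Open Scope ereal_scope.

Definition metric_on : Prop :=
  [/\ forall x y, A x -> A y -> (0 <= d x y)%R,
      forall x y, A x -> A y -> (d x y = 0%R <-> x = y),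
      forall x y, A x -> A y -> d x y = d y x &
      forall x y z, A x -> A y -> A z -> (d x z <= d x y + d y z)%R].

Definition complete_on : Prop :=
  forall u : nat -> T, (forall n, A (u n)) ->
    (forall e : R, (0 < e)%R -> exists N, forall m n,
       (N <= m)%N -> (N <= n)%N -> (d (u m) (u n) < e)%R) ->
    exists2 l, A l & (fun n => d (u n) l) @ \oo --> (0 : R)%R.

(* Curves in A joining x to y, continuous for the metric d. *)
Definition curve_on (x y : T) : set (R -> T) :=
  [set c | [/\ c 0%R = x, c 1%R = y,
    forall t, t \in `[0, 1]%R -> A (c t) &
    forall t, t \in `[0, 1]%R -> forall e : R, (0 < e)%R ->
      exists2 r : R, (0 < r)%R & forall s, s \in `[0, 1]%R ->
        (`|s - t| < r)%R -> (d (c s) (c t) < e)%R]].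

Definition polygonal_length (c : R -> T) (s : seq R) : R :=
  let F := c \o nth 1%R (0%R :: s) in
  (\sum_(0 <= n < size s) d (F n) (F n.+1))%R.

Definition curve_length (c : R -> T) : \bar R :=
  ereal_sup [set (polygonal_length c s)%:E | s in itv_partition 0%R 1%R].

Definition complete_length_metric_on : Prop :=
  [/\ metric_on, complete_on &
      forall x y, A x -> A y ->
        (d x y)%:E = ereal_inf [set curve_length c | c in curve_on x y]].

End LengthMetric.

Section LocalHausdorff.
Variables (R : realType) (m n : nat).
Implicit Types (X Y : 'M[R]_(m, n)) (A B : set 'M[R]_(m, n)).

(* The library norm on matrices is the sup norm. *)
Definition eucl_norm X : R := Num.sqrt (\sum_i \sum_j X i j ^+ 2).

Definition eucl_nbhd (e : R) A : set 'M[R]_(m, n) :=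
  [set X | exists2 Y, A Y & eucl_norm (X - Y) < e].

Definition ball_part (r : R) A : set 'M[R]_(m, n) :=
  A `&` [set X | eucl_norm X <= r].

(* The infimum is +oo when exactly one of A, B is empty. *)
Definition hausdorff_dist A B : \bar R :=
  ereal_inf [set e%:E | e in
    [set e : R | [/\ 0 < e, A `<=` eucl_nbhd e B & B `<=` eucl_nbhd e A]]].

Definition local_hausdorff_cvg (An : nat -> set 'M[R]_(m, n)) A : Prop :=
  forall r : R, 0 < r ->
    (fun k => hausdorff_dist (ball_part r (closure (An k)))
                             (ball_part r (closure A))) @ \oo --> 0%E.

End LocalHausdorff.

Section Hilbert.
Variables (R : realType) (p q : nat).
Local Notation V := 'rV[R]_(p + q).
Implicit Types (Om : set (Gr R p q)) (x y : Gr R p q) (va vb : V)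
  (e : 2.-tuple V).

(* Om meets the projective line through x and y exactly in the open interval
   {[s va + t vb] : s, t > 0} with endpoints [va] and [vb]; replacing vb by
   - vb gives the other interval with these endpoints. *)
Definition line_section Om x y va vb : Prop :=
  basis_of (val x + val y)%VS [:: va; vb] /\
  [set z | Om z /\ (val z <= val x + val y)%VS] =
  [set z | exists s t : R,
     [/\ 0 < s, 0 < t & val z = <[s *: va + t *: vb]>%VS]].

(* If v = e_0 + a e_1 and v' = e_0 + a' e_1 then pl_bracket e v v' = a' - a, so
   that the ratio below is the usual cross ratio in any affine coordinate. It
   does not depend on the basis e of the plane nor on the vectors chosen to
   represent the four points. *)
Definition pl_bracket e (v v' : V) : R :=
  coord e ord0 v * coord e ord_max v' - coord e ord_max v * coord e ord0 v'.

Definition cross_ratio e (va vx vy vb : V) : R :=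
  (pl_bracket e vx vb * pl_bracket e vy va) /
  (pl_bracket e vx va * pl_bracket e vy vb).

(* d is the classical Hilbert distance from x to y, for p = 1. *)
Definition hilbert_dist Om x y (d : R) : Prop :=
  (x = y /\ d = 0) \/
  (x <> y /\ exists e va vb vx vy,
    [/\ basis_of (val x + val y)%VS e, line_section Om x y va vb,
        val x = <[vx]>%VS, val y = <[vy]>%VS &
        d = `| ln `| cross_ratio e va vx vy vb | |]).

End Hilbert.

Section Main.
Variables (R : realType) (p q : nat).
Implicit Types (Om : set (Gr R p q)) (K : set (Gr R p q) -> Gr R p q -> Gr R p q -> R).

Definition convex_proper Om : Prop :=
  [/\ Om !=set0, open Om, R_proper Om & convex_in_some_chart Om].

(* The values of K Om' are meaningful only on Om', hence the first
   conjunct. *)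
Definition cvg_unif_on_compacts K (Omn : nat -> set (Gr R p q)) Om : Prop :=
  forall C : set (Gr R p q * Gr R p q), compact C -> C `<=` Om `*` Om ->
    forall e : R, 0 < e -> \forall n \near \oo,
      C `<=` Omn n `*` Omn n /\
      forall z, C z -> `|K (Omn n) z.1 z.2 - K Om z.1 z.2| < e.

End Main.

(* Main.v *)
Require Import Defs.
From HB Require Import structures.
From mathcomp Require Import all_boot all_order all_algebra.
From mathcomp Require Import all_classical all_reals all_analysis.
From mathcomp Require Import perm.
From mathcomp Require Import ring lra.
Set Implicit Arguments.
Unset Strict Implicit.
Unset Printing Implicit Defensive.
Import Order.TTheory GRing.Theory Num.Theory.
Import numFieldNormedType.Exports.
Local Open Scope classical_set_scope.
Local Open Scope ring_scope.

(** The metric is the Kobayashi distance of Om: a step joins two points of an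
    interval of a projective line of the Grassmannian which is contained in Om
    and costs their Hilbert distance in this interval, and the distance of two
    points is the infimum of the costs of the chains of steps joining them
    (kob_dist). Its projective invariance is built into the definition, and it is
    a length metric because intervals are geodesics for their Hilbert metrics
    (chain_dist_length).

    In an affine chart Om becomes an open convex set D of matrices, and the
    steps become segments X + t *: (Y - X) where Y - X has rank one
    (gr_dist_chart); that Om is R-proper implies that D contains no affine line
    of rank one (R_proper_no_rank1_line). Everything rests on one remark: if f
    and g are affine functions which are positive on D, then the quotient f / g
    changes along a chain of cost L at most by the factor expR L (chain_pos),
    since on each interval it is a homography between positive quantities.

    First consequence: in a ball for the chain distance all positive affine
    functions f are comparable with their value at the centre O. For a direction
    M of rank one there is a point O + r1 *: M or O - r1 *: M outside D, with r1
    independent of M by compactness, hence an f which varies fast along M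
    (seg_step_lower). So the length of a chain for the norm is bounded by a
    multiple of its cost (chain_lower), though D may well contain lines of
    higher rank. In the other direction, changing the entries of a matrix one by
    one bounds the distance by the norm locally (chain_ball). Thus the distance
    is finite and separates points. It is complete: a limit point Z on the
    boundary of D would be a zero of some f, but f stays away from 0 along a
    Cauchy sequence (seg_dist_complete).

    For the continuity, let D' be close to D in a large ball around O. A
    homothety of centre O and ratio close to 1 maps the part of D in this ball
    into D'. It preserves the directions of rank one, so that it maps steps to
    steps, provided that their intervals are first cut off far away; the lower
    bound for costs shows that the cut is cheap (chain_dist_compare). Exchanging
    D and D' gives the convergence of the distances (seg_dist_cvg), which is
    uniform on compact sets since these distances are locally equicontinuous.

    When p = 1 all directions have rank one, and the functions f and g supporting
    D at the ends of the maximal interval through X and Y show that no chain is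
    cheaper than the direct step (seg_dist_max_interval), whose cost is the
    Hilbert distance. *)

(** * Chains and length metrics *)

Section Chains.
Variables (R : realType) (T : Type) (step : T -> T -> R -> Prop).

Inductive chain : T -> T -> R -> Prop :=
| chain_nil x : chain x x 0
| chain_cons x y z d L : step x y d -> chain y z L -> chain x z (d + L).

Definition chain_dist (x y : T) : R := inf [set L | chain x y L].

Lemma chain_step x y d : step x y d -> chain x y d.
Proof.
by move=> xy; rewrite -[d]addr0; apply: chain_cons xy (chain_nil _).
Qed.

Lemma chain_cat x y z L L' : chain x y L -> chain y z L' -> chain x z (L + L').
Proof.
move=> xy; elim: xy z L' => [|a b c d L0 ab _ IH] z L' yz; first by rewrite add0r.
by rewrite -addrA; apply: chain_cons ab (IH _ _ yz).
Qed.

Hypothesis step_ge0 : forall x y d, step x y d -> 0 <= d.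

Lemma chain_ge0 x y L : chain x y L -> 0 <= L.
Proof. by elim=> // a b c d L0 /step_ge0 d0 _ L00; rewrite addr_ge0. Qed.

Lemma chain_lbound x y : lbound [set L | chain x y L] 0.
Proof. by move=> L /chain_ge0. Qed.

Lemma chain_dist_le x y L : chain x y L -> chain_dist x y <= L.
Proof. by move=> xy; apply: ge_inf => //; exists 0; exact: chain_lbound. Qed.

Lemma chain_dist_ge0 x y : 0 <= chain_dist x y.
Proof.
have [S0|/set0P S0] := eqVneq [set L | chain x y L] set0.
  by rewrite /chain_dist S0 inf0.
by apply: lb_le_inf => //; exact: chain_lbound.
Qed.

Lemma chain_distxx x : chain_dist x x = 0.
Proof.
apply/eqP; rewrite eq_le chain_dist_ge0 andbT.
by apply: chain_dist_le; exact: chain_nil.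
Qed.

Lemma chain_dist_lt x y r : (exists L, chain x y L) -> chain_dist x y < r ->
  exists2 L, chain x y L & L < r.
Proof.
move=> [L xy] /inf_lt[]; first by exists L.
by move=> L' xy' lr; exists L'.
Qed.

Lemma chain_dist_triangle x y z :
  (exists L, chain x y L) -> (exists L, chain y z L) ->
  chain_dist x z <= chain_dist x y + chain_dist y z.
Proof.
move=> xy yz; apply/ler_addgt0Pr => e e0.
have e2 : 0 < e / 2 by rewrite divr_gt0.
have [L xyL Ll] : exists2 L, chain x y L & L < chain_dist x y + e / 2.
  by apply: chain_dist_lt => //; rewrite ltrDl.
have [L' yzL Ll'] : exists2 L, chain y z L & L < chain_dist y z + e / 2.
  by apply: chain_dist_lt => //; rewrite ltrDl.
have := chain_dist_le (chain_cat xyL yzL); lra.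
Qed.

Hypothesis step_sym : forall x y d, step x y d -> step y x d.

Lemma chain_sym x y L : chain x y L -> chain y x L.
Proof.
elim=> [a|a b c d L0 ab _ ca]; first exact: chain_nil.
by rewrite addrC; apply: chain_cat ca (chain_step (step_sym ab)).
Qed.

Lemma chain_distC x y : chain_dist x y = chain_dist y x.
Proof.
by congr inf; apply/seteqP; split=> L /= /chain_sym.
Qed.

Variable A : set T.

(** The increments are measured by costs of chains, which add up when curves
    are juxtaposed. *)
Definition lipschitz_curve (L : R) (c : R -> T) : Prop :=
  (forall t : R, 0 <= t <= 1 -> A (c t)) /\
  (forall s t : R, 0 <= s -> s <= t -> t <= 1 ->
     exists2 d, chain (c s) (c t) d & d <= L * (t - s)).

(** The curves are run through at times proportional to their Lipschitz
    constants, so that the constants add up. *)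
Lemma lipschitz_curve_cat (L L' : R) c c' : 0 < L -> 0 < L' -> c 1 = c' 0 ->
  lipschitz_curve L c -> lipschitz_curve L' c' ->
  exists2 c'', c'' 0 = c 0 /\ c'' 1 = c' 1 & lipschitz_curve (L + L') c''.
Proof.
move=> L0 L'0 cc' [Ac lc] [Ac' lc'].
pose M := L + L'; have M0 : 0 < M by rewrite addr_gt0.
pose m := L / M.
have m0 : 0 < m by rewrite divr_gt0.
have mM : m * M = L by rewrite /m divfK ?gt_eqF.
have m1 : m < 1 by rewrite /m ltr_pdivrMr// mul1r /M; lra.
pose g t := if t <= m then c (t * M / L) else c' ((t * M - L) / L').
have gl t : t <= m -> g t = c (t * M / L) by rewrite /g => ->.
have gr t : m <= t -> g t = c' ((t * M - L) / L').
  rewrite /g le_eqVlt => /orP[/eqP<-|]; last by rewrite ltNge => /negbTE ->.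
  by rewrite lexx mM subrr mul0r divff ?gt_eqF.
have wl t : 0 <= t -> t <= m -> 0 <= t * M / L <= 1.
  move=> t0 tm; rewrite divr_ge0 ?mulr_ge0 ?(ltW M0) ?(ltW L0)//= ler_pdivrMr// mul1r -mM.
  by rewrite ler_pM2r.
have wr t : m <= t -> t <= 1 -> 0 <= (t * M - L) / L' <= 1.
  move=> tm t1; rewrite divr_ge0 ?(ltW L'0)//=; last first.
    by rewrite subr_ge0 -mM ler_pM2r.
  rewrite ler_pdivrMr// mul1r lerBlDr [L' + L]addrC -/M.
  by rewrite -[leRHS]mul1r ler_pM2r.
have ll s t : 0 <= s -> s <= t -> t <= m ->
    exists2 d, chain (g s) (g t) d & d <= M * (t - s).
  move=> s0 st tm; have sm := le_trans st tm; rewrite !gl//.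
  have /andP[s0' _] := wl s s0 sm.
  have /andP[_ t1] := wl t (le_trans s0 st) tm.
  have [|d h hd] := lc _ _ s0' _ t1.
    by rewrite ler_pM2r ?invr_gt0// ler_pM2r.
  exists d => //; apply: (le_trans hd).
  suff -> : L * (t * M / L - s * M / L) = M * (t - s) by [].
  by field; rewrite gt_eqF.
have rr s t : m <= s -> s <= t -> t <= 1 ->
    exists2 d, chain (g s) (g t) d & d <= M * (t - s).
  move=> ms st t1; have mt := le_trans ms st; rewrite !gr//.
  have /andP[s0' _] := wr s ms (le_trans st t1).
  have /andP[_ t1'] := wr t mt t1.
  have [|d h hd] := lc' _ _ s0' _ t1'.
    by rewrite ler_pM2r ?invr_gt0// lerB// ler_pM2r.
  exists d => //; apply: (le_trans hd).
  suff -> : L' * ((t * M - L) / L' - (s * M - L) / L') = M * (t - s) by [].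
  by field; rewrite gt_eqF.
exists g.
  split; first by rewrite gl ?ltW// !mul0r.
  by rewrite gr ?ltW// mul1r /M addrC addKr divff ?gt_eqF.
split=> [t /andP[t0 t1]|s t s0 st t1].
  have [tm|/ltW tm] := leP t m; first by rewrite gl//; apply: Ac; exact: wl.
  by rewrite gr//; apply: Ac'; exact: wr.
have [tm|/ltW mt] := leP t m; first exact: ll.
have [ms|/ltW sm] := leP m s; first exact: rr.
have [d h hd] := ll s m s0 sm (lexx _).
have [d' h' hd'] := rr m t (lexx _) mt t1.
exists (d + d'); first exact: chain_cat h h'.
by apply: (le_trans (lerD hd hd')); rewrite -mulrDr addrC subrKA.
Qed.

Hypothesis step_geodesic : forall x y d, step x y d ->
  exists c : R -> T, [/\ c 0 = x, c 1 = y,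
    forall t : R, 0 <= t <= 1 -> A (c t) &
    forall s t : R, 0 <= s -> s <= t -> t <= 1 -> step (c s) (c t) (d * (t - s))].

(** The pieces of the chain are juxtaposed. The constant exceeds the cost, so
    that also the pieces of cost 0 are given some time. *)
Lemma chain_lipschitz x y L L' : A x -> chain x y L -> L < L' ->
  exists2 c, c 0 = x /\ c 1 = y & lipschitz_curve L' c.
Proof.
move=> Ax xy; elim: xy Ax L' => {x y L} [x Ax L' L'0|x y z d L xy yz IH Ax L' LL'].
  exists (fun=> x) => //; split=> // s t s0 st t1; exists 0; first exact: chain_nil.
  by rewrite mulr_ge0 ?(ltW L'0) ?subr_ge0.
have d0 := step_ge0 xy; have L0 := chain_ge0 yz.
pose e := (L' - (d + L)) / 2; have e0 : 0 < e by rewrite /e; lra.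
have [c [c0 c1 Ac lc]] := step_geodesic xy.
have Ay : A y by rewrite -c1; apply: Ac; rewrite ler01 lexx.
have [|c' [c'0 c'1] lc'] := IH Ay (L + e); first by rewrite ltrDl.
have [|||||g [g0 g1] lg] := @lipschitz_curve_cat (d + e) (L + e) c c'.
- by rewrite ltr_wpDl.
- by rewrite ltr_wpDl.
- by rewrite c1.
- split=> // s t s0 st t1; exists (d * (t - s)); first exact/chain_step/lc.
  by rewrite ler_wpM2r ?subr_ge0// lerDl ltW.
- by [].
exists g; first by rewrite g0 g1.
by have -> : L' = d + e + (L + e) by rewrite /e; field.
Qed.

Hypothesis chainable : forall x y, A x -> A y -> exists L, chain x y L.

(** The terms of a polygonal length are bounded by the increments of t |-> L *
    t. *)
Lemma lipschitz_length L c : lipschitz_curve L c ->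
  (curve_length chain_dist c <= L%:E)%E.
Proof.
move=> [Ac lc]; apply: ub_ereal_sup => _ [s s01 <-]; rewrite lee_fin.
rewrite /polygonal_length.
pose t := nth (1:R) (0 :: s).
have -> : L = L * (t (size s) - t 0%N).
  by rewrite /t (itv_partition_nth_size _ s01)/= subr0 mulr1.
rewrite -(telescope_sumr t)// mulr_sumr big_nat [leRHS]big_nat.
apply: ler_sum => i /andP[_ si].
have ti k : (k <= size s)%N -> 0 <= t k <= 1.
  move=> ks; apply/andP; split.
    exact: (itv_partition_nth_ge (b := 1) ks s01).
  exact: (itv_partition_nth_le (b := 1) ks s01).
have /andP[ti0 _] := ti _ (ltnW si); have /andP[_ ti1] := ti _ si.
have [|d h hd] := lc _ _ ti0 _ ti1; last exact: le_trans (chain_dist_le h) hd.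
have [srt _] := s01.
have lt3 : transitive (@Order.lt _ R) by exact: lt_trans.
apply/ltW/(@sorted_ltn_nth _ _ lt3 1 (0 :: s) srt i i.+1) => //; rewrite inE/= ltnS//.
exact: ltnW.
Qed.

(** The triangle inequality bounds the distance by the length of any curve;
    conversely a nearly optimal chain is followed by a curve which is hardly
    longer. *)
Lemma chain_dist_length x y : A x -> A y ->
  (chain_dist x y)%:E = ereal_inf [set curve_length chain_dist c | c in curve_on A chain_dist x y].
Proof.
move=> Ax Ay; apply/eqP; rewrite eq_le; apply/andP; split.
  apply: le_ereal_inf_tmp => _ [c [c0 c1 _ _] <-].
  apply: ereal_sup_ubound; exists [:: 1].
    by apply: itv_partition1; exact: ltr01.
  by rewrite /polygonal_length/= big_nat1/= c0 c1.
apply/lee_addgt0Pr => e e0; rewrite -EFinD.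
have [L xyL LL] : exists2 L, chain x y L & L < chain_dist x y + e.
  by apply: chain_dist_lt; rewrite ?ltrDl//; exact: chainable.
have [c [c0 c1] lc] := chain_lipschitz Ax xyL LL.
apply: le_trans (lipschitz_length lc); apply: ereal_inf_lbound; exists c => //.
have [Ac lc'] := lc; split=> // t; rewrite in_itv/= => t01.
move=> eps eps0; pose M := chain_dist x y + e.
have M0 : 0 < M by rewrite /M ltr_wpDl// chain_dist_ge0.
exists (eps / M); first by rewrite divr_gt0.
move=> s; rewrite in_itv/= => s01 st; rewrite -[eps](divfK (lt0r_neq0 M0)).
apply: (@le_lt_trans _ _ (M * `|s - t|)); last by rewrite mulrC ltr_pM2r.
case/andP: t01 => t0 t1; case/andP: s01 => s0 s1.
have [sle|/ltW tle] := leP s t.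
  have [d h hd] := lc' _ _ s0 sle t1.
  by rewrite distrC ger0_norm ?subr_ge0//; exact: le_trans (chain_dist_le h) hd.
have [d h hd] := lc' _ _ t0 tle s1; rewrite chain_distC.
by rewrite ger0_norm ?subr_ge0//; exact: le_trans (chain_dist_le h) hd.
Qed.

End Chains.

Lemma chain_map (R : realType) (T T' : Type) (step : T -> T -> R -> Prop)
    (step' : T' -> T' -> R -> Prop) (f : T -> T') :
  (forall x y d, step x y d -> step' (f x) (f y) d) ->
  forall x y L, chain step x y L -> chain step' (f x) (f y) L.
Proof.
move=> h x y L; elim=> [a|a b c d L' ab _ IH]; first exact: chain_nil.
by apply: chain_cons IH; exact: h.
Qed.

(** * Supporting hyperplanes *)

(** A coordinate of z - projv H z which does not vanish at z = x, divided by
    its value there. *)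
Lemma subspace_functional (K : fieldType) (vT : vectType K) (H : {vspace vT})
    (x : vT) : x \notin H ->
  exists f : {scalar vT}, (forall h, h \in H -> f h = 0) /\ f x = 1.
Proof.
move=> xH; pose b := vbasis {:vT}; pose y := x - projv H x.
have [j yj] : exists j, coord b j y != 0.
  apply/existsP; apply: contraNT xH; rewrite negb_exists => /forallP y0.
  suff -> : x = projv H x by exact: memv_proj.
  apply/eqP; rewrite -subr_eq0 -/y (coord_vbasis (memvf y)) big1// => i _.
  by move: (y0 i); rewrite negbK => /eqP ->; rewrite scale0r.
pose f z := coord b j (z - projv H z) / coord b j y.
have lf : scalar f.
  move=> a u v; rewrite /f [projv H _]linearP/= opprD addrACA -scalerBr linearP/=.
  by rewrite mulrDl mulrA.
pose fL := GRing.isLinear.Build K vT K *%R f lf.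
exists (HB.pack f fL : {scalar vT}); split=> /= [h hH|]; rewrite /f.
  by rewrite projv_id// subrr linear0 mul0r.
exact: divff.
Qed.

Section ConvexMatrices.
Variables (R : realType) (q p : nat).
Local Notation E := 'M[R]_(q, p).
Implicit Types (D : set E) (X Y Z : E).

Definition is_convex D := forall X Y (t : R), D X -> D Y -> 0 <= t <= 1 ->
  D (t *: X + (1 - t) *: Y).

Lemma convex_set_is_convex D : convex_set (D : set (convex_lmodType E)) -> is_convex D.
Proof.
move=> cD X Y t DX DY /andP[t0 t1].
have := cD X Y (Itv01 t0 t1); rewrite !inE => /(_ DX DY).
by rewrite /conv.
Qed.

Lemma open_ball_sub D X : open D -> D X ->
  exists2 e : R, 0 < e & forall Z, `|Z - X| < e -> D Z.
Proof.
move=> oD DX; have /nbhs_normP[e /= e0 De] := open_nbhs_nbhs (conj oD DX).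
by exists e => // Z; rewrite distrC => /De.
Qed.

Lemma open_of_balls D : (forall X, D X -> exists2 e : R, 0 < e &
  forall Z, `|Z - X| < e -> D Z) -> open D.
Proof.
move=> h; rewrite openE => X /h[e e0 De].
by apply: (iffRL (nbhs_normP X D)); exists e => //= Z; rewrite /ball_/= distrC => /De.
Qed.

(** A subspace H of maximal dimension among those which miss the open convex
    cone C spanned by D is a hyperplane. Otherwise some vector v outside H
    lies neither in C + H nor in - (C + H), because a path from a point of C
    to its opposite in the complement of H is connected and cannot be covered
    by these two disjoint open sets; then H + <v> still misses C. *)
Lemma open_convex_functional0 D : open D -> is_convex D -> ~ D 0 ->
  exists f : {scalar E}, forall X, D X -> 0 < f X.
Proof.
move=> oD cD D0.
pose C := [set Z : E | exists2 t : R, 0 < t & D (t *: Z)].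
have CD Z : D Z -> C Z by move=> DZ; exists 1; rewrite ?scale1r.
have CZ k Z : 0 < k -> C Z -> C (k *: Z).
  move=> k0 [t t0 Dt]; exists (t / k); first exact: divr_gt0.
  by rewrite scalerA divfK ?gt_eqF.
have CA Y Z : C Y -> C Z -> C (Y + Z).
  move=> [t t0 Dt] [s s0 Ds]; exists (t * s / (s + t)).
    by rewrite divr_gt0 ?mulr_gt0 ?addr_gt0.
  have st0 : s + t != 0 by rewrite gt_eqF// addr_gt0.
  have -> : (t * s / (s + t)) *: (Y + Z) =
      (s / (s + t)) *: (t *: Y) + (1 - s / (s + t)) *: (s *: Z).
    rewrite !scalerA scalerDr; congr (_ *: _ + _ *: _); by field.
  apply: cD => //; apply/andP; split; first by rewrite divr_ge0 ?addr_ge0 ?ltW.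
  by rewrite ler_pdivrMr ?addr_gt0// mul1r lerDl ltW.
have C0 : ~ C 0 by move=> [t t0]; rewrite scaler0.
have oC : open C.
  apply: open_of_balls => Z [t t0 /(open_ball_sub oD)[e e0 De]]; exists (e / t).
    exact: divr_gt0.
  move=> Y YZ; exists t => //; apply: De; rewrite -scalerBr normrZ gtr0_norm//.
  by rewrite mulrC -ltr_pdivlMr.
have [[X DX]|noD] := pselect (exists X, D X); last first.
  by exists \0 => X DX; case: noD; exists X.
pose avoid (H : {vspace E}) := forall h, h \in H -> ~ C h.
pose P n := `[< exists2 H, avoid H & \dim H = n >].
have P0 : exists n, P n.
  exists 0%N; apply/asboolP; exists 0%VS; last exact: dimv0.
  by move=> h; rewrite memv0 => /eqP ->.
have Pmax n : P n -> (n <= \dim (fullv : {vspace E}))%N.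
  by move=> /asboolP[H _ <-]; apply: dimvS; exact: subvf.
case: (ex_maxnP P0 Pmax) => n /asboolP[H aH dH] nmax.
have XH : X \notin H by apply/negP => /aH; apply; exact: CD.
pose CH := [set v : E | exists2 h, h \in H & C (v - h)].
have CHN v : CH v -> CH (- v) -> False.
  move=> [h hH Ch] [k kH Ck]; apply: (aH (- (h + k))).
    by rewrite memvN memvD.
  suff -> : - (h + k) = (v - h) + (- v - k) by exact: CA.
  by rewrite opprD addrACA subrr add0r.
have HX v : v \in (H + <[X]>)%VS.
  apply/negPn/negP => vHX.
  have vH : v \notin H.
    by apply: contra vHX; exact/subvP/addvSl.
  (* A path from X to - X. It avoids H, since v is not in H + <X>. *)
  pose g (t : R) : E := (1 - t *+ 2) *: X + (t * (1 - t)) *: v.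
  have gH t : g t \notin H.
    apply/negP => gtH; have [t01|t01] := eqVneq (t * (1 - t)) 0; last first.
      move/negP: vHX; apply.
      rewrite (_ : v = (t * (1 - t))^-1 *: g t + (- (1 - t *+ 2) / (t * (1 - t))) *: X).
        by apply: memv_add; rewrite memvZ// memv_line.
      rewrite /g scalerDr !scalerA mulVf// scale1r addrAC -scalerDl.
      by rewrite mulNr mulrC subrr scale0r add0r.
    move: gtH; rewrite /g t01 scale0r addr0.
    have [->|t0 gtH] := eqVneq t 0; first by rewrite mul0rn subr0 scale1r; exact/negP.
    have t1 : t = 1.
      by move/eqP: t01; rewrite mulf_eq0 (negbTE t0)/= subr_eq0 => /eqP.
    move: gtH; rewrite t1 (_ : 1 - 1 *+ 2 = -1 :> R); last by rewrite mulr2n; ring.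
    by rewrite scaleN1r memvN; exact/negP.
  have cg : continuous g.
    move=> t; apply: cvgD; last first.
      apply: cvgZr_tmp; apply: cvgM; first exact: cvg_id.
      by apply: cvgB; [exact: cvg_cst|exact: cvg_id].
    apply: cvgZr_tmp; apply: cvgB; first exact: cvg_cst.
    by apply: cvgMn; exact: cvg_id.
  have oCH : open CH.
    apply: open_of_balls => Z [h hH /(open_ball_sub oC)[e e0 Ce]]; exists e => // Y YZ.
    by exists h => //; apply: Ce; rewrite opprB addrA subrK.
  have oCHN : open [set v | CH (- v)].
    apply: open_of_balls => Z /(open_ball_sub oCH)[e e0 Ce]; exists e => // Y YZ; apply: Ce.
    by rewrite opprK addrC distrC.
  have [t gt gt'] : exists2 t, ~ CH (g t) & ~ CH (- g t).
    apply: contrapT => /forall2NP hg.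
    pose B := `[0, 1]%classic `&` [set t | CH (g t)].
    have : B = `[0, 1]%classic.
      apply: (@segment_connected R 0 1).
      - exists 0; split; first by rewrite /= in_itv/= lexx ler01.
        exists 0; rewrite ?mem0v// subr0 /g mul0rn mul0r subr0 scale0r addr0.
        by rewrite scale1r; exact: CD.
      - exists [set t | CH (g t)] => //.
        by apply: (open_comp _ oCH) => t _; exact: cg.
      - exists (~` [set t | CH (- g t)]).
          by apply: open_closedC; apply: (open_comp _ oCHN) => t _; exact: cg.
        apply/seteqP; split=> t [t01]/= gt; split=> //; first by move/(CHN _ gt).
        by have [/contrapT|/contrapT] := hg t.
    move=> /seteqP[_ /(_ 1)]; rewrite /= in_itv/= lexx ler01 => /(_ isT)[_].
    rewrite /= /g subrr mulr0 scale0r addr0.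
    rewrite (_ : 1 - 1 *+ 2 = -1 :> R); last by rewrite mulr2n; ring.
    rewrite scaleN1r => -[h hH Ch]; apply: (aH (- h)); first by rewrite memvN.
    by rewrite (_ : - h = X + (- X - h)); [exact: CA (CD _ DX) Ch|rewrite addrA subrr add0r].
  have aHv : avoid (H + <[g t]>)%VS.
    move=> _ /memv_addP[h hH [_ /vlineP[k ->] ->]] Chk.
    have [k0|k0|k0] := ltgtP k 0.
    - apply: gt'; exists (k^-1 *: h); first exact: memvZ.
      rewrite (_ : - g t - _ = (- k^-1) *: (h + k *: g t)).
        by apply: CZ => //; rewrite oppr_gt0 invr_lt0.
      by rewrite scalerDr scalerA mulNr mulVf ?lt_eqF// scaleN1r scaleNr addrC.
    - apply: gt; exists (- (k^-1 *: h)); first by rewrite memvN memvZ.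
      rewrite (_ : g t - _ = k^-1 *: (h + k *: g t)).
        by apply: CZ => //; rewrite invr_gt0.
      by rewrite scalerDr scalerA mulVf ?gt_eqF// scale1r opprK addrC.
    - by move: Chk; rewrite k0 scale0r addr0; exact: aH.
  have := nmax (\dim (H + <[g t]>)%VS); rewrite leqNgt => /(_ _)/negP; apply.
    by apply/asboolP; exists (H + <[g t]>)%VS.
  rewrite -dH ltn_neqAle dimvS ?addvSl// andbT; apply/negP => /eqP dHg.
  have /eqP eH : H == (H + <[g t]>)%VS by rewrite eqEdim addvSl dHg/=.
  by move: (gH t); rewrite eH; apply/negP; rewrite negbK;
    apply/subvP: (memv_line (g t)); exact: addvSr.
have [f [fH fX]] := subspace_functional XH.
exists f => Z DZ; have /memv_addP[h hH [_ /vlineP[k ->] Zhk]] := HX Z.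
rewrite Zhk linearD fH// add0r linearZ/= fX mulr1 ltNge; apply/negP => k0.
move: k0; rewrite le_eqVlt => /predU1P[k0|k0].
  by apply: (aH Z (_ : Z \in H)); [rewrite Zhk k0 scale0r addr0|exact: CD].
apply: (aH h hH); rewrite (_ : h = Z + (- k) *: X).
  by apply: CA (CD _ DZ) (CZ _ _ _ (CD _ DX)); rewrite oppr_gt0.
by rewrite Zhk scaleNr addrK.
Qed.

End ConvexMatrices.

(** * Steps along segments of rank one *)

Section MatrixNorm.
Variables (R : realType) (m n : nat).
Implicit Types M : 'M[R]_(m, n).

Lemma mx_norm_entry M i j : `|M i j| <= `|M|.
Proof.
by rewrite [leRHS]/Num.Def.normr/= mx_normrE;
  exact: (le_bigmax _ (fun ij => `|M ij.1 ij.2|) (i, j)).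
Qed.

Lemma mx_norm_le M e : 0 <= e -> (forall i j, `|M i j| <= e) -> `|M| <= e.
Proof.
move=> e0 Me; rewrite [leLHS]/Num.Def.normr/= mx_normrE.
by apply/bigmax_leP; split => // -[i j] _; exact: Me.
Qed.

End MatrixNorm.

Section RankOne.
Variables (R : realType) (q p : nat).

Lemma mulmx_norm_le (a : 'rV[R]_q) (b : 'rV[R]_p) : `|a^T *m b| <= `|a| * `|b|.
Proof.
apply: mx_norm_le => [|i j]; first by rewrite mulr_ge0.
rewrite mxE big_ord1 mxE normrM ler_pM// ?mx_norm_entry//.
Qed.

Definition rank_le1 (N : 'M[R]_(q, p)) : Prop :=
  exists (a : 'rV[R]_q) (b : 'rV[R]_p), N = a^T *m b.

Lemma rank_le1Z k N : rank_le1 N -> rank_le1 (k *: N).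
Proof. by move=> [a [b ->]]; exists a, (k *: b); rewrite scalemxAr. Qed.

Lemma rank_le1_unit N : rank_le1 N -> N != 0 ->
  exists (a : 'rV[R]_q) (b : 'rV[R]_p) (k : R),
    [/\ `|a| = 1, `|b| = 1, `|N| <= k & N = k *: (a^T *m b)].
Proof.
move=> [a [b Nab]] N0.
have a0 : a != 0 by apply: contra_neq N0 => a0; rewrite Nab a0 trmx0 mul0mx.
have b0 : b != 0 by apply: contra_neq N0 => b0; rewrite Nab b0 mulmx0.
have na : `|a| != 0 by rewrite normr_eq0.
have nb : `|b| != 0 by rewrite normr_eq0.
exists (`|a|^-1 *: a), (`|b|^-1 *: b), (`|a| * `|b|).
rewrite !normrZ !normfV !normr_id !mulVf//; split=> //.
  by rewrite Nab; exact: mulmx_norm_le.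
rewrite [in LHS]Nab [(_ *: a)^T]linearZ/= -scalemxAl -scalemxAr !scalerA.
by rewrite -[LHS]scale1r; congr (_ *: _); field; rewrite na nb.
Qed.

End RankOne.

Section SegmentSteps.
Variables (R : realType) (q p : nat).
Local Notation E := 'M[R]_(q, p).
Implicit Types (D : set E) (X Y Z O : E).

(** The interval of the parameters t with 0 < 1 + l * t and 0 < 1 - m * t
    contains 0 and 1, and the Hilbert distance of these two points in it is ln
    ((1 + l) / (1 - m)). One of l and m vanishes when the interval is a
    half-line. *)
Variant seg_step D X Y : R -> Prop := SegStep (l m : R) of
  0 <= l & 0 <= m & 0 < l + m & m < 1 & rank_le1 (Y - X) &
  (forall t, 0 < 1 + l * t -> 0 < 1 - m * t -> D (X + t *: (Y - X))) :
  seg_step D X Y (ln (1 + l) - ln (1 - m)).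

Lemma seg_step_ge0 D X Y d : seg_step D X Y d -> 0 <= d.
Proof.
case=> l m l0 m0 _ m1 _ _.
by rewrite subr_ge0 (@le_trans _ _ 0)// ?ln_le0 ?ln_ge0 ?lerDl// gerBl.
Qed.

Lemma seg_step_in D X Y d : seg_step D X Y d -> D X /\ D Y.
Proof.
case=> l m l0 m0 _ m1 _ h; split.
  by have := h 0; rewrite !mulr0 addr0 subr0 ltr01 scale0r addr0; exact.
have := h 1; rewrite !mulr1 scale1r [X + _]addrC subrK; apply; last by rewrite subr_gt0.
by rewrite ltr_wpDr.
Qed.

Lemma expR_cost (l m : R) : 0 <= l -> m < 1 ->
  expR (ln (1 + l) - ln (1 - m)) = (1 + l) / (1 - m).
Proof.
by move=> l0 m1; rewrite expRB !lnK// posrE ?subr_gt0// ltr_wpDr.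
Qed.

Definition pos_on D (c : R) (f : {scalar E}) : Prop := forall X, D X -> 0 < c + f X.

Lemma open_convex_functional D Z : open D -> is_convex D -> ~ D Z ->
  exists c f, pos_on D c f /\ c + f Z = 0.
Proof.
move=> oD cD DZ; pose D' := [set X | D (X + Z)].
have [||X0|f fD] := @open_convex_functional0 _ _ _ D'.
- apply: open_of_balls => X /(open_ball_sub oD)[e e0 De]; exists e => // Y YX; apply: De.
  by rewrite opprD addrACA subrr addr0.
- move=> X Y t; rewrite /D'/= => DX DY t01; have := cD _ _ t DX DY t01.
  by rewrite !scalerDr addrACA -scalerDl subrKC scale1r.
- by move: X0; rewrite /D'/= add0r.
exists (- f Z), f; split; last by rewrite addNr.
move=> X DX; rewrite addrC -linearB; apply: fD.
by rewrite /D'/= subrK.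
Qed.

(** An affine function has at most one zero on the line through X and Y, and
    it must not lie in the interval. *)
Lemma seg_step_pos1 D X Y (l m : R) c f : 0 <= l -> 0 <= m -> m < 1 ->
  (forall t, 0 < 1 + l * t -> 0 < 1 - m * t -> D (X + t *: (Y - X))) ->
  pos_on D c f ->
  (1 - m) * (c + f X) <= c + f Y <= (1 + l) * (c + f X).
Proof.
move=> l0 m0 m1 h fD.
have FX : 0 < c + f X.
  by have := fD _ (h 0 _ _); rewrite scale0r addr0 !mulr0 addr0 subr0; exact.
set F := c + f X in FX *; pose n := f Y - f X.
have fE t : c + f (X + t *: (Y - X)) = F + t * n.
  by rewrite linearD linearZ/= linearB/= addrA.
have -> : c + f Y = F + n by rewrite /F /n -addrA subrKC.
have no t : n != 0 -> t = - F / n -> ~ (0 < 1 + l * t /\ 0 < 1 - m * t).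
  move=> n0 -> [h1 h2]; have := fD _ (h _ h1 h2).
  by rewrite fE divfK// subrr ltxx.
apply/andP; split.
  rewrite leNgt; apply/negP => nm.
  have n0 : n < 0 by nra.
  apply: (no (- F / n)) => //; first by rewrite lt_eqF.
  have t0 : 0 < - F / n by rewrite mulNr -mulrN -invrN divr_gt0// oppr_gt0.
  split; first by rewrite ltr_wpDr// mulr_ge0// ltW.
  rewrite subr_gt0 mulrA ltr_ndivrMr// mul1r; lra.
rewrite leNgt; apply/negP => nm.
have n0 : 0 < n by nra.
apply: (no (- F / n)) => //; first by rewrite gt_eqF.
rewrite !(mulrA _ _ n^-1); split.
  by rewrite -[1](divff (lt0r_neq0 n0)) -mulrDl divr_gt0//; lra.
by rewrite ltr_pwDl// mulrN mulNr opprK divr_ge0 ?mulr_ge0// ltW.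
Qed.

(** The quotient of two affine functions which are positive on an interval
    varies on it at most like the cross ratio with its ends. *)
Lemma seg_step_pos D X Y d c f c' g : seg_step D X Y d ->
  pos_on D c f -> pos_on D c' g ->
  (c + f Y) * (c' + g X) <= expR d * ((c + f X) * (c' + g Y)).
Proof.
move=> XYd fD gD; have [DX DY] := seg_step_in XYd.
case: XYd => l m l0 m0 lm m1 _ h; rewrite expR_cost//.
have /andP[_ fl] := seg_step_pos1 l0 m0 m1 h fD.
have /andP[gm _] := seg_step_pos1 l0 m0 m1 h gD.
have fX := fD _ DX; have gX := gD _ DX; have fY := fD _ DY; have gY := gD _ DY.
have m1' : 0 < 1 - m by rewrite subr_gt0.
rewrite mulrAC ler_pdivlMr//.
apply: (@le_trans _ _ ((1 + l) * (c + f X) * (c' + g X) * (1 - m))).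
  by rewrite ler_pM2r// ler_pM2r.
rewrite -!mulrA ler_pM2l ?ltr_wpDr// ler_pM2l//.
by rewrite mulrC.
Qed.

Local Notation schain D := (chain (seg_step D)).

Lemma chain_in D X Y L : D X -> schain D X Y L -> D Y.
Proof.
by move=> DX XY; elim: XY DX => {X Y L} [|X Y Z d L XY _ IH _]//; have [_ /IH] := seg_step_in XY.
Qed.

(** The bounds for the single steps multiply along the chain. *)
Lemma chain_pos D X Y L c f c' g : D X -> schain D X Y L ->
  pos_on D c f -> pos_on D c' g ->
  (c + f Y) * (c' + g X) <= expR L * ((c + f X) * (c' + g Y)).
Proof.
move=> DX XY fD gD; elim: XY DX => {X Y L} [X|X Y Z d L XY YZ IH] DX.
  by rewrite expR0 mul1r.
have [_ DY] := seg_step_in XY; have DZ := chain_in DY YZ.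
have := seg_step_pos XY fD gD; have := IH DY.
have := fD _ DX; have := gD _ DX; have := fD _ DY; have := gD _ DY.
have := gD _ DZ; rewrite expRD; move: (expR_gt0 d) (expR_gt0 L).
set e1 := expR d; set e2 := expR L.
set fx := c + f X; set fy := c + f Y; set fz := c + f Z.
set gx := c' + g X; set gy := c' + g Y; set gz := c' + g Z.
move=> e10 e20 gz0 gy0 fy0 gx0 fx0 h1 h2.
rewrite -(ler_pM2r gy0).
have h3 : fz * gx * gy <= e2 * gz * (fy * gx).
  by rewrite mulrAC -[leRHS](_ : e2 * (fy * gz) * gx = _) ?ler_pM2r//; ring.
apply: (le_trans h3).
rewrite (_ : _ * gy = e2 * gz * (e1 * (fx * gy))); last by ring.
by rewrite ler_pM2l// mulr_gt0.
Qed.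

Lemma pos_on1 D : pos_on D 1 \0.
Proof. by move=> X _; rewrite addr0 ltr01. Qed.

(** A quantitative form, seen from O, of the absence of lines of rank one in a
    convex set. *)
Definition rank1_bounded D O (r : R) : Prop :=
  forall (a : 'rV[R]_q) (b : 'rV[R]_p), `|a| = 1 -> `|b| = 1 ->
    ~ (D (O + r *: (a^T *m b)) /\ D (O - r *: (a^T *m b))).

Lemma expR_sub1_le (d : R) : expR d - 1 <= d * expR d.
Proof.
have := expR_ge1Dx (- d); rewrite expRN -div1r ler_pdivlMr ?expR_gt0//; lra.
Qed.

(** Let M be the unit direction of the step. Some affine function f that is
    positive on D vanishes at O + r1 M or at O - r1 M, whence f(O) <= r1
    |f(M)| for its linear part; and f(X), f(Y) differ at most by the factor
    expR d. *)
Lemma seg_step_lower D O X Y d (r1 s r : R) : open D -> is_convex D -> D O ->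
  0 < r1 -> rank1_bounded D O r1 ->
  (forall c f, pos_on D c f -> c + f X <= expR s * (c + f O)) ->
  s + d <= r -> seg_step D X Y d -> `|Y - X| <= r1 * expR r * d.
Proof.
move=> oD cD DO r10 bD sX sdr XYd; have [DX DY] := seg_step_in XYd.
have d0 := seg_step_ge0 XYd.
have [->|N0] := eqVneq (Y - X) 0.
  by rewrite normr0 !mulr_ge0 ?expR_ge0// ltW.
have rk : rank_le1 (Y - X) by case: XYd.
have [a [b [k [a1 b1 Nk NE]]]] := rank_le1_unit rk N0.
apply: (le_trans Nk).
have k0 : 0 < k by rewrite (lt_le_trans _ Nk)// normr_gt0.
set M := a^T *m b in NE.
(* This is the function which vanishes at one of the points O + r1 M, O - r1
   M. *)
suff [c [f [fD fM]]] : exists c f, pos_on D c f /\ c + f O <= r1 * `|f M|.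
  have fYX : f Y - f X = k * f M by rewrite -linearB NE linearZ.
  have h1 := seg_step_pos XYd fD (@pos_on1 D).
  have h2 := seg_step_pos XYd (@pos_on1 D) fD.
  rewrite /= !addr0 !mulr1 !mul1r in h1 h2.
  have h3 := sX _ _ fD; have fO := fD _ DO; have fX := fD _ DX.
  have e1 : 1 <= expR d by rewrite -expR0 ler_expR.
  have h4 : `|k * f M| <= (expR d - 1) * (c + f X).
    rewrite -fYX ler_norml; apply/andP; split; last by lra.
    have [fXY|fXY] := leP (f X) (f Y); first by nra.
    have : (expR d - 1) * (c + f Y) <= (expR d - 1) * (c + f X).
      by rewrite ler_wpM2l ?subr_ge0// lerD2l ltW.
    lra.
  have h5 : (expR d - 1) * (c + f X) <= d * expR r * (c + f O).
    apply: (@le_trans _ _ (d * expR d * (c + f X))).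
      by rewrite ler_pM2r// expR_sub1_le.
    apply: (@le_trans _ _ (d * expR d * (expR s * (c + f O)))).
      by rewrite ler_wpM2l// mulr_ge0// expR_ge0.
    rewrite mulrA ler_pM2r// -mulrA ler_wpM2l// -expRD ler_expR.
    by rewrite addrC.
  have fM0 : 0 < `|f M|.
    by rewrite -(pmulr_rgt0 _ r10) (lt_le_trans fO).
  rewrite -(ler_pM2r fM0) -{1}(gtr0_norm k0) -normrM.
  apply: (le_trans h4); apply: (le_trans h5).
  rewrite (_ : _ * `|f M| = d * expR r * (r1 * `|f M|)); last by ring.
  by rewrite ler_wpM2l// mulr_ge0// expR_ge0.
have [DM|DM] := pselect (D (O + r1 *: M)).
  have [|c [f [fD f0]]] := @open_convex_functional D (O - r1 *: M) oD cD.
    by move=> DM'; apply: (bD a b).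
  exists c, f; split=> //; move: f0; rewrite linearB linearZ/= => f0.
  have -> : c + f O = r1 * f M by lra.
  by rewrite ler_wpM2l ?(ltW r10)// ler_norm.
have [c [f [fD f0]]] := open_convex_functional oD cD DM.
exists c, f; split=> //; move: f0; rewrite linearD linearZ/= => f0.
have -> : c + f O = r1 * - f M by lra.
by rewrite ler_wpM2l ?(ltW r10)// -normrN ler_norm.
Qed.

(** Along a chain the growth of the positive affine functions, hence the
    constant in the estimate for the next step, is controlled by the cost. *)
Lemma chain_lower D O X Y L (r1 s r : R) : open D -> is_convex D -> D O ->
  0 < r1 -> rank1_bounded D O r1 -> D X ->
  (forall c f, pos_on D c f -> c + f X <= expR s * (c + f O)) ->
  s + L <= r -> schain D X Y L -> `|Y - X| <= r1 * expR r * L.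
Proof.
move=> oD cD DO r10 bD DX sX sLr XY.
elim: XY s DX sX sLr => {X Y L} [X|X Y Z d L XY YZ IH] s DX sX sLr.
  by rewrite subrr normr0 mulr0.
have [_ DY] := seg_step_in XY.
have L0 := chain_ge0 (@seg_step_ge0 D) YZ.
have h1 : `|Y - X| <= r1 * expR r * d.
  by apply: (seg_step_lower oD cD DO r10 bD sX) => //; lra.
have h2 : `|Z - Y| <= r1 * expR r * L.
  apply: (IH (d + s)) => //; last by lra.
  move=> c f fD; have := seg_step_pos XY fD (@pos_on1 D).
  rewrite /= !addr0 !mulr1 => h; apply: (le_trans h).
  by rewrite expRD -mulrA ler_pM2l ?expR_gt0//; exact: sX.
rewrite mulrDr (_ : Z - X = (Y - X) + (Z - Y)); last by rewrite [RHS]addrC subrKA.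
by apply: (le_trans (ler_normD _ _)); exact: lerD.
Qed.

End SegmentSteps.

(** * Exit times and upper bounds for the chain distance *)

Lemma norm_lt_nbhs (K : numFieldType) (V : normedModType K) (x : V) (e : K) :
  0 < e -> nbhs x [set z | `|z - x| < e].
Proof.
move=> e0; apply/nbhs_ballP; exists e => //= z.
by rewrite -ball_normE /ball_/= distrC.
Qed.

Section UpperBounds.
Variables (R : realType) (q p : nat).
Local Notation E := 'M[R]_(q, p).
Implicit Types (D : set E) (X Y Z O : E).
Local Notation schain D := (chain (seg_step D)).

Definition no_rank1_line D : Prop := forall X (a : 'rV[R]_q) (b : 'rV[R]_p),
  a^T *m b != 0 -> ~ (forall t, D (X + t *: (a^T *m b))).

Lemma convex_segment D X Y (t : R) : is_convex D -> D X -> D Y -> 0 <= t <= 1 ->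
  D (X + t *: (Y - X)).
Proof.
move=> cD DX DY t01; have := cD _ _ t DY DX t01.
by rewrite scalerBl scale1r addrCA -scalerBr.
Qed.

Lemma sphere_compact (n : nat) : compact [set a : 'rV[R]_n | `|a| = 1].
Proof.
apply: bounded_closed_compact.
  by exists 1; split; [exact: num_real|move=> x x1 a /= ->; exact: ltW].
rewrite (_ : mkset _ = (Num.norm : 'rV[R]_n -> R) @^-1` [set 1]); last by [].
by apply: closed_comp => [a _|]; [exact: norm_continuous|exact: closed_eq].
Qed.

(** The pairs (a, b) of unit vectors form a compact set, and the exit times of
    D along the lines of direction a^T *m b are locally bounded in (a, b). *)
Lemma no_rank1_line_bounded D O : open D -> is_convex D -> no_rank1_line D ->
  D O -> exists2 r : R, 0 < r & rank1_bounded D O r.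
Proof.
move=> oD cD nD DO; have [e e0 De] := open_ball_sub oD DO.
have /compact_near_coveringP cov := compact_setX (@sphere_compact q) (@sphere_compact p).
pose P (r : R) (ab : 'rV[R]_q * 'rV[R]_p) := 0 < r /\
  ~ (D (O + r *: (ab.1^T *m ab.2)) /\ D (O - r *: (ab.1^T *m ab.2))).
suff : \forall r \near +oo,
    [set a : 'rV[R]_q | `|a| = 1] `*` [set b : 'rV[R]_p | `|b| = 1] `<=` P r.
  case=> M [_ h]; have M1 : M < `|M| + 1 by rewrite ltr_pwDr// ler_norm.
  exists (`|M| + 1); first by rewrite ltr_wpDl.
  by move=> a b a1 b1; have [] := h _ M1 (a, b) (conj a1 b1).
apply: cov => -[a b] [/= a1 b1].
have ab0 : a^T *m b != 0.
  have [i ai] : exists i, a 0 i != 0.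
    apply/existsP; apply: contra_eqT a1; rewrite negb_exists => /forallP a0.
    rewrite (_ : a = 0) ?normr0 1?eq_sym ?oner_neq0//.
    by apply/rowP => i; move: (a0 i); rewrite negbK mxE => /eqP.
  have [j bj] : exists i, b 0 i != 0.
    apply/existsP; apply: contra_eqT b1; rewrite negb_exists => /forallP b0.
    rewrite (_ : b = 0) ?normr0 1?eq_sym ?oner_neq0//.
    by apply/rowP => j; move: (b0 j); rewrite negbK mxE => /eqP.
  apply/eqP => /matrixP/(_ i j); rewrite !mxE big_ord1 !mxE => /eqP.
  by rewrite mulf_eq0 (negbTE ai) (negbTE bj).
have [t Dt] : exists t, ~ D (O + t *: (a^T *m b)).
  by apply/existsNP; exact: nD.
set M := a^T *m b in ab0 Dt.
pose e' := Num.min 1 (e / (6 * (`|t| + 1))).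
have t1 : 0 < `|t| + 1 by rewrite ltr_wpDl.
have e'0 : 0 < e' by rewrite lt_min ltr01 divr_gt0// mulr_gt0.
exists ([set ab : _ * _ | `|ab.1 - a| < e' /\ `|ab.2 - b| < e'], [set r | 2 * (`|t| + 1) < r]).
  split=> /=; last first.
    by exists (2 * (`|t| + 1)); split=> //; exact: num_real.
  exists ([set a' | `|a' - a| < e'], [set b' | `|b' - b| < e']) => //=.
  by split; exact: norm_lt_nbhs.
move=> [[a' b'] r] [/= [aa bb] tr]; split; first by apply: lt_trans tr; rewrite mulr_gt0.
set M' := a'^T *m b' => -[D1 D2]; apply: Dt.
have r0 : 0 < r by apply: lt_trans tr; rewrite mulr_gt0.
have MM : `|M - M'| <= 3 * e'.
  have -> : M - M' = (a - a')^T *m b' + a^T *m (b - b').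
    by rewrite [(a - a')^T]linearB/= mulmxBl mulmxBr [RHS]addrC subrKA.
  apply: (le_trans (ler_normD _ _)).
  have h1 := mulmx_norm_le (a - a') b'; have h2 := mulmx_norm_le a (b - b').
  rewrite a1 mul1r distrC in h2; rewrite [`|a - a'|]distrC in h1.
  have b'2 : `|b'| <= 2.
    rewrite -[b'](subrK b); apply: (le_trans (ler_normD _ _)); rewrite b1.
    have : e' <= 1 by rewrite ge_min lexx.
    by move: bb; lra.
  have h3 : `|a' - a| * `|b'| <= e' * 2 by rewrite ler_pM// ltW.
  by rewrite distrC in h2; move: h1 h2 h3 bb; rewrite [`|b - b'|]distrC; lra.
have te : (2 * `|t|) * (3 * e') < e.
  have : e' <= e / (6 * (`|t| + 1)) by rewrite ge_min lexx orbT.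
  rewrite ler_pdivlMr ?mulr_gt0// => h.
  have : 0 <= `|t| by []. nra.
clearbody M M'.
have tr2 : `|2 * t / r| <= 1.
  rewrite normrM normfV (gtr0_norm r0) ler_pdivrMr// mul1r normrM ger0_norm//.
  by rewrite (le_trans _ (ltW tr))// ler_pM2l// lerDl.
(* O + t *: M is the midpoint of O + (2 * t) *: M', which lies between the two
   points of the line of direction M', and of a point close to O. *)
have D3 : D (O + (2 * t) *: M').
  pose u := (1 + 2 * t / r) / 2.
  rewrite (_ : O + _ = u *: (O + r *: M') + (1 - u) *: (O - r *: M')); last first.
    by apply/matrixP => i j; rewrite !mxE /u; field; rewrite gt_eqF.
  apply: cD => //; move: tr2; rewrite ler_norml /u; lra.
have D4 : D (O + (2 * t) *: (M - M')).
  apply: De; rewrite addrC addKr normrZ normrM ger0_norm//.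
  by apply: le_lt_trans te; rewrite ler_wpM2l// mulr_ge0.
rewrite (_ : O + _ = (1/2) *: (O + (2 * t) *: M') + (1 - 1/2) *: (O + (2 * t) *: (M - M'))).
  by apply: cD => //; lra.
by apply/matrixP => i j; rewrite !mxE; field.
Qed.

Lemma ln_1B_ge (x : R) : 0 <= x -> x <= 1/2 -> - (2 * x) <= ln (1 - x).
Proof.
move=> x0 x2; rewrite -[leLHS]expRK ler_ln ?posrE ?expR_gt0 ?subr_gt0//; last by lra.
rewrite expRN -div1r ler_pdivrMr ?expR_gt0//.
have := expR_ge1Dx (2 * x) => h.
apply: (@le_trans _ _ ((1 - x) * (1 + 2 * x))); first by nra.
by rewrite ler_wpM2l//; lra.
Qed.

(** The interval around X whose half-length is rho / (2 * e) times the step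
    stays in the ball. *)
Lemma seg_step_ball D X Y (rho e : R) : 0 < e -> e <= rho / 4 ->
  rank_le1 (Y - X) -> `|Y - X| <= e -> (forall Z, `|Z - X| < rho / 2 -> D Z) ->
  exists2 d, seg_step D X Y d & d <= 6 * e / rho.
Proof.
move=> e0 er rk XYe DB; have rho0 : 0 < rho by lra.
pose k := 2 * e / rho.
have k0 : 0 < k by rewrite divr_gt0// mulr_gt0.
have k2 : k <= 1/2 by rewrite ler_pdivrMr//; lra.
exists (ln (1 + k) - ln (1 - k)).
  split; rewrite ?(ltW k0) ?addr_gt0//; first by lra.
  move=> t t1 t2; apply: DB; rewrite addrC addKr normrZ.
  have tk : `|t| * k < 1.
    by rewrite -[k]gtr0_norm// -normrM ltr_norml; apply/andP; split; lra.
  apply: (@le_lt_trans _ _ (`|t| * e)); first by rewrite ler_wpM2l.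
  rewrite (_ : e = k * (rho / 2)); last by rewrite /k; field; rewrite gt_eqF.
  by rewrite [ltLHS]mulrA gtr_pMl// divr_gt0.
have h1 : ln (1 + k) <= k by apply: le_ln1Dx; lra.
have h2 := ln_1B_ge (ltW k0) k2.
have -> : 6 * e / rho = 3 * k by rewrite /k; field; rewrite gt_eqF.
lra.
Qed.

(** A ball for the supremum norm is a box, inside which X is turned into Y by
    changing one entry at a time. *)
Lemma chain_ball D O X Y (rho e : R) : 0 < e -> e <= rho / 4 ->
  (forall Z, `|Z - O| < rho -> D Z) -> `|X - O| < rho / 2 -> `|Y - O| < rho / 2 ->
  `|Y - X| <= e -> exists2 L, schain D X Y L & L <= (q * p)%:R * (6 * e / rho).
Proof.
move=> e0 er DB XO YO XY.
(* mix s has the entries of Y at the places in s and those of X elsewhere. *)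
pose mix (s : seq ('I_q * 'I_p)) : E :=
  \matrix_(i, j) if (i, j) \in s then Y i j else X i j.
have mixO s : `|mix s - O| < rho / 2.
  apply: (@le_lt_trans _ _ (Num.max `|X - O| `|Y - O|)); last by rewrite gt_max XO.
  apply: mx_norm_le => [|i j]; first by rewrite le_max normr_ge0.
  rewrite !mxE; case: ifP => _; rewrite le_max; apply/orP; [right|left].
    by have := mx_norm_entry (Y - O) i j; rewrite !mxE.
  by have := mx_norm_entry (X - O) i j; rewrite !mxE.
have h s : exists2 L, schain D X (mix s) L & L <= (size s)%:R * (6 * e / rho).
  elim: s => [|[i j] s [L XL Ls]].
    exists 0; last by rewrite mul0r.
    have -> : mix [::] = X by apply/matrixP => i j; rewrite mxE.
    exact: chain_nil.
  have NE : mix ((i, j) :: s) - mix s =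
      ((Y i j - mix s i j) *: delta_mx 0 i)^T *m (delta_mx 0 j : 'rV_p).
    apply/matrixP => k l; rewrite [RHS]mxE big_ord1 !mxE !inE !eqxx/= xpair_eqE.
    have [->|ki] := eqVneq k i; have [->|lj] := eqVneq l j;
      rewrite /= ?mulr0 ?mul0r ?mulr1 ?subrr//.
  have [|||d hd dle] := @seg_step_ball D (mix s) (mix ((i, j) :: s)) rho e e0 er.
  - by rewrite NE; eexists; eexists.
  - apply: mx_norm_le; first exact: ltW.
    move=> k l; rewrite !mxE inE; apply: le_trans XY.
    have := mx_norm_entry (Y - X) k l; rewrite !mxE => YXkl.
    by case: eqP => [_|_]/=; case: ifP => _; rewrite ?subrr ?normr0.
  - move=> Z Zs; apply: DB; rewrite -(subrK (mix s) Z) -addrA.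
    by apply: (le_lt_trans (ler_normD _ _)); move: (mixO s); lra.
  exists (L + d); first exact: chain_cat XL (chain_step hd).
  rewrite /= -natr1 mulrDl mul1r; exact: lerD.
have [L XYL Lle] := h (enum {: 'I_q * 'I_p}).
exists L; last by move: Lle; rewrite -cardE card_prod !card_ord.
suff <- : mix (enum {: 'I_q * 'I_p}) = Y by [].
by apply/matrixP => i j; rewrite mxE mem_enum.
Qed.

(** The segment from X to Y is cut into pieces that are short compared to rho;
    by convexity the balls of radius rho around its points lie in D. The bound
    B depends on rho and M only. *)
Lemma chain_bounded (rho M : R) : 0 < rho -> exists B : R, forall D X Y,
  is_convex D -> (forall Z, `|Z - X| < rho -> D Z) ->
  (forall Z, `|Z - Y| < rho -> D Z) -> `|Y - X| <= M ->
  exists2 L, schain D X Y L & L <= B.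
Proof.
move=> rho0; pose C : R := (q * p)%:R * (6 * (rho / 4) / rho).
pose n := (Num.truncn (`|M| * 8 / rho)).+1.
have n0 : 0 < n%:R :> R by rewrite ltr0n.
have nM : `|M| / n%:R <= rho / 8.
  have : `|M| * 8 / rho < n%:R by rewrite truncnS_gt.
  by rewrite ltr_pdivrMr// ler_pdivrMr// => h; lra.
exists (n%:R * C) => D X Y cD DX DY XYM.
pose z (k : nat) := X + (k%:R / n%:R) *: (Y - X).
have zB k Z : (k <= n)%N -> `|Z - z k| < rho -> D Z.
  move=> kn Zk; pose u : R := k%:R / n%:R.
  rewrite (_ : Z = u *: (Y + (Z - z k)) + (1 - u) *: (X + (Z - z k))).
    apply: cD; [by apply: DY; rewrite addrC addKr|by apply: DX; rewrite addrC addKr|].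
    by rewrite divr_ge0//= ler_pdivrMr// mul1r ler_nat.
  by apply/matrixP => i j; rewrite !mxE -/u; ring.
have h k : (k <= n)%N -> exists2 L, schain D X (z k) L & L <= k%:R * C.
  elim: k => [_|k IH kn].
    exists 0; last by rewrite mul0r.
    by rewrite /z mul0r scale0r addr0; exact: chain_nil.
  have [L XL Lk] := IH (ltnW kn).
  have zz : z k.+1 - z k = n%:R^-1 *: (Y - X).
    by apply/matrixP => i j; rewrite !mxE -natr1; field; rewrite gt_eqF.
  have zzr : `|z k.+1 - z k| <= rho / 8.
    rewrite zz normrZ normfV gtr0_norm// mulrC; apply: le_trans nM.
    by rewrite ler_pM2r ?invr_gt0// (le_trans XYM)// ler_norm.
  have [||||||d kd dC] := @chain_ball D (z k) (z k) (z k.+1) rho (rho / 4).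
  - by rewrite divr_gt0.
  - by [].
  - by move=> Z; apply: zB; exact: ltnW.
  - by rewrite subrr normr0 divr_gt0.
  - by apply: le_lt_trans zzr _; lra.
  - by apply: (le_trans zzr); lra.
  exists (L + d); first exact: chain_cat XL kd.
  by rewrite -natr1 mulrDl mul1r; exact: lerD.
have [L XL Ln] := h n (leqnn n).
exists L => //; suff <- : z n = Y by [].
by rewrite /z divff ?gt_eqF// scale1r subrKC.
Qed.

End UpperBounds.

(** * Comparison of two convex sets *)

Section Comparison.
Variables (R : realType) (q p : nat).
Local Notation E := 'M[R]_(q, p).
Implicit Types (D : set E) (X Y Z O : E).
Local Notation schain D := (chain (seg_step D)).

Definition shrink O (e : R) Z : E := O + (1 + e)^-1 *: (Z - O).

(** An interval may be cut off at distance k from the step: this changes the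
    cost by a small factor only, because the length of the step is bounded by
    a multiple of its cost. *)
Lemma seg_step_shrink D D' O X Y d (e r r0 k c eta : R) :
  (forall Z, D Z -> `|Z - O| < r0 + k -> D' (shrink O e Z)) ->
  0 < k -> 0 <= c -> c * r <= k * expR (- r) / 2 ->
  c * (1 + 2 * expR r) <= eta * k -> d <= r ->
  `|X - O| <= r0 -> `|Y - X| <= c * d -> seg_step D X Y d ->
  exists2 d', seg_step D' (shrink O e X) (shrink O e Y) d' & d' <= (1 + eta) * d.
Proof.
move=> DD' k0 c0 crk cek dr XO YX XYd; have d0 := seg_step_ge0 XYd.
case: d / XYd d0 dr YX => l m l0 m0 lm0 m1 rk h.
set d := ln (1 + l) - _ => d0 dr YX.
(* In the interval with parameters l + u and m + u one has |t| * u < 1, which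
   bounds |t *: (Y - X)| by k. *)
pose u := c * d / k.
have u0 : 0 <= u by rewrite divr_ge0 ?mulr_ge0 ?(ltW k0).
have uk : u * k = c * d by rewrite /u divfK// gt_eqF.
have m1' : 0 < 1 - m by rewrite subr_gt0.
have mr : expR (- r) <= 1 - m.
  rewrite -[leRHS]lnK ?posrE// ler_expR lerNl (le_trans _ dr)//.
  by rewrite /d lerDr ln_ge0// lerDl.
have er0 := expR_gt0 r.
pose v := u * expR r.
have v0 : 0 <= v by rewrite mulr_ge0// ltW.
have v2 : v <= 1/2.
  have h1 : u <= expR (- r) / 2.
    rewrite -(ler_pM2r k0) uk (le_trans (ler_wpM2l c0 dr))// (le_trans crk)//.
    by rewrite [leRHS]mulrC mulrA.
  by have := ler_wpM2r (ltW er0) h1; rewrite [leRHS]mulrAC -expRD addNr expR0.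
have um : u <= v * (1 - m).
  have : u * (expR r * expR (- r)) <= u * (expR r * (1 - m)).
    by rewrite ler_wpM2l// ler_wpM2l// ltW.
  by rewrite -expRD subrr expR0 mulr1 mulrA.
exists (ln (1 + (l + u)) - ln (1 - (m + u))).
  have -> : shrink O e Y = shrink O e X + (1 + e)^-1 *: (Y - X).
    by apply/matrixP => i j; rewrite !mxE; ring.
  split; rewrite ?addr_ge0//.
  - by rewrite addrACA ltr_wpDr// addr_ge0.
  - by nra.
  - by rewrite [_ - _]addrC addKr; exact: rank_le1Z.
  move=> t t1 t2; rewrite [_ - shrink O e X]addrC addKr [shrink _ _ _ + _]addrC.
  have -> : t *: ((1 + e)^-1 *: (Y - X)) + shrink O e X = shrink O e (X + t *: (Y - X)).
    by apply/matrixP => i j; rewrite !mxE; ring.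
  have [ht1 ht2 tu] : [/\ 0 < 1 + l * t, 0 < 1 - m * t & `|t| * u < 1].
    rewrite mulrDl in t1; rewrite mulrDl in t2.
    have [t0|t0] := leP 0 t.
      have := mulr_ge0 l0 t0; have := mulr_ge0 m0 t0; have := mulr_ge0 u0 t0.
      by rewrite (ger0_norm t0); split; lra.
    have := mulr_ge0_le0 l0 (ltW t0); have := mulr_ge0_le0 m0 (ltW t0).
    have := mulr_ge0_le0 u0 (ltW t0).
    by rewrite (ltr0_norm t0); split; lra.
  apply: DD'; first exact: h.
  rewrite addrAC; apply: (le_lt_trans (ler_normD _ _)); apply: ler_ltD => //.
  rewrite normrZ; apply: (@le_lt_trans _ _ (`|t| * (u * k))).
    by rewrite ler_wpM2l// uk.
  by rewrite mulrA gtr_pMl.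
have l1 : ln (1 + (l + u)) <= ln (1 + l) + u.
  rewrite -[leRHS]expRK ler_ln ?posrE ?expR_gt0//; last by lra.
  rewrite expRD lnK ?posrE; last by lra.
  apply: (@le_trans _ _ ((1 + l) * (1 + u))); first by nra.
  by rewrite ler_wpM2l ?expR_ge1Dx//; lra.
have l2 : ln (1 - m) - 2 * v <= ln (1 - (m + u)).
  apply: (@le_trans _ _ (ln (1 - m) + ln (1 - v))).
    by rewrite lerD2l; exact: ln_1B_ge.
  rewrite -lnM ?posrE//; last by lra.
  rewrite ler_ln ?posrE//; [nra|rewrite mulr_gt0//; lra|nra].
have l3 : u + 2 * v <= eta * d.
  rewrite (_ : u + 2 * v = u * (1 + 2 * expR r)); last by rewrite /v; ring.
  rewrite -(ler_pM2r k0) mulrAC uk mulrAC [leRHS]mulrAC; nra.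
by rewrite mulrDl mul1r {1}/d; lra.
Qed.

(** A chain of cost at most r which starts near O stays in a fixed ball around
    O, so that all its intervals may be cut off outside a larger ball. *)
Lemma chain_shrink D D' O X Y L (e r k r1 s eta : R) : open D -> is_convex D -> D O ->
  0 < r1 -> rank1_bounded D O r1 ->
  let c := r1 * expR r in
  (forall Z, D Z -> `|Z - O| < c * r + k -> D' (shrink O e Z)) ->
  0 < k -> c * r <= k * expR (- r) / 2 ->
  c * (1 + 2 * expR r) <= eta * k ->
  0 <= s -> s + L <= r -> `|X - O| <= c * s ->
  (forall c' f, pos_on D c' f -> c' + f X <= expR s * (c' + f O)) ->
  schain D X Y L ->
  exists2 L', schain D' (shrink O e X) (shrink O e Y) L' & L' <= (1 + eta) * L.
Proof.
move=> oD cD DO r10 bD c DD' k0 crk cek s0 sL XO sX XY.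
have c0 : 0 <= c by rewrite mulr_ge0 ?expR_ge0// ltW.
elim: XY s s0 sL XO sX => {X Y L} [X|X Y Z d L XY YZ IH] s s0 sL XO sX.
  by exists 0; [exact: chain_nil|rewrite mulr0].
have L0 := chain_ge0 (@seg_step_ge0 _ _ _ D) YZ; have d0 := seg_step_ge0 XY.
have YX : `|Y - X| <= c * d.
  by apply: (seg_step_lower oD cD DO r10 bD sX) => //; lra.
have [||d' XY' d'd] := seg_step_shrink DD' k0 c0 crk cek _ _ YX XY.
- by lra.
- by apply: (le_trans XO); rewrite ler_wpM2l//; lra.
have [||||L' YZ' L'L] := IH (d + s).
- by rewrite addr_ge0.
- by lra.
- rewrite -(subrKA X) mulrDr; apply: (le_trans (ler_normD _ _)); exact: lerD.
- move=> c' f fD; have := seg_step_pos XY fD (@pos_on1 _ _ _ D).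
  rewrite /= !addr0 !mulr1 => h; apply: (le_trans h).
  by rewrite expRD -mulrA ler_pM2l ?expR_gt0//; exact: sX.
exists (d' + L'); first exact: chain_cons XY' YZ'.
by rewrite mulrDr lerD.
Qed.

(** A nearly optimal chain from O to Y0 in D is shrunk into D'; its end point,
    which is close to Y0, is joined to Y0 inside a ball. The numbers r' and e
    are the same for all D and D', as needed for sequences of sets. *)
Lemma chain_dist_compare O Y0 (rho r1 r e0 : R) : 0 < rho -> 0 < r1 -> 0 < r -> 0 < e0 ->
  exists r' e : R, [/\ 0 < r', 0 < e, e <= 1 & forall D D',
    open D -> is_convex D -> D O -> rank1_bounded D O r1 ->
    (exists L, schain D O Y0 L) -> chain_dist (seg_step D) O Y0 < r ->
    (forall Z, `|Z - Y0| < rho -> D' Z) ->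
    (forall Z, D Z -> `|Z - O| < r' -> D' (shrink O e Z)) ->
    chain_dist (seg_step D') O Y0 <= chain_dist (seg_step D) O Y0 + e0].
Proof.
move=> rho0 r10 r0 e00.
pose c := r1 * expR r; have c0 : 0 < c by rewrite mulr_gt0 ?expR_gt0.
pose eta := e0 / (2 * r); have eta0 : 0 < eta by rewrite divr_gt0// mulr_gt0.
have er0 := expR_gt0 r.
(* By the first summand of k the cut intervals still contain the steps, by the
   second one their costs grow at most by the factor 1 + eta. *)
pose k := 2 * (c * r) * expR r + c * (1 + 2 * expR r) / eta.
have k0 : 0 < k by rewrite addr_gt0// ?divr_gt0// ?mulr_gt0// ltr_wpDl// mulr_gt0.
have crk : c * r <= k * expR (- r) / 2.
  rewrite ler_pdivlMr// -(ler_pM2r er0) -[leRHS]mulrA -expRD addNr expR0 mulr1.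
  rewrite /k [c * r * 2]mulrC lerDl; apply: divr_ge0; last exact: ltW.
  by apply: mulr_ge0; lra.
have cek : c * (1 + 2 * expR r) <= eta * k.
  rewrite /k [leRHS]mulrDr [eta * (_ / _)]mulrC divfK ?gt_eqF// lerDr.
  by apply/ltW; rewrite !mulr_gt0// invr_gt0 mulr_gt0.
pose A : R := (q * p)%:R; have A0 : 0 <= A by rewrite ler0n.
pose e1 := Num.min (rho / 4) (e0 * rho / (12 * (A + 1))).
have e10 : 0 < e1 by rewrite lt_min !divr_gt0// ?mulr_gt0// ltr_wpDl.
have e1A : A * (6 * e1 / rho) <= e0 / 2.
  have : e1 <= e0 * rho / (12 * (A + 1)) by rewrite ge_min lexx orbT.
  rewrite ler_pdivlMr ?mulr_gt0 ?ltr_wpDl// => h.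
  rewrite !mulrA ler_pdivrMr//; nra.
have e1r : e1 <= rho / 4 by rewrite ge_min lexx.
pose e := Num.min 1 (e1 / (`|Y0 - O| + 1)).
have Y01 : 0 < `|Y0 - O| + 1 by rewrite ltr_wpDl.
have e_gt0 : 0 < e by rewrite lt_min ltr01 divr_gt0.
have ele1 : e <= 1 by rewrite ge_min lexx.
exists (c * r + k), e; split=> //; first by rewrite addr_gt0// mulr_gt0.
move=> D D' oD cD DO bD OY OYr DY DD'.
have hOO : shrink O e O = O by rewrite /shrink subrr scaler0 addr0.
have hY : `|shrink O e Y0 - Y0| <= e1.
  have -> : shrink O e Y0 - Y0 = (- (e / (1 + e))) *: (Y0 - O).
    by apply/matrixP => i j; rewrite !mxE; field; rewrite gt_eqF// ltr_pwDl// ltW.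
  rewrite normrZ normrN ger0_norm ?divr_ge0 ?addr_ge0 ?(ltW e_gt0)//.
  have : e <= e1 / (`|Y0 - O| + 1) by rewrite ge_min lexx orbT.
  rewrite ler_pdivlMr// => h.
  have h2 : e / (1 + e) <= e by rewrite ler_pdivrMr ?ltr_pwDl ?(ltW e_gt0)//; nra.
  have h3 : 0 <= `|Y0 - O| by [].
  have := ler_wpM2r h3 h2; nra.
have [L2 Y02 L2le] : exists2 L, schain D' (shrink O e Y0) Y0 L & L <= e0 / 2.
  have [||||||L hL Lle] := @chain_ball _ _ _ D' Y0 (shrink O e Y0) Y0 rho e1 => //.
  - by apply: (le_lt_trans hY); lra.
  - by rewrite subrr normr0 divr_gt0.
  - by rewrite distrC.
  by exists L => //; exact: le_trans Lle e1A.
apply/ler_addgt0Pr => e2 e20.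
have [L OYL LL] : exists2 L, schain D O Y0 L &
    L < Num.min r (chain_dist (seg_step D) O Y0 + e2).
  by apply: chain_dist_lt => //; rewrite lt_min OYr ltrDl.
move: LL; rewrite lt_min => /andP[Lr Le2].
have [||||L1 OY1 L1L] := @chain_shrink D D' O O Y0 L e r k r1 0 eta
    oD cD DO r10 bD DD' k0 crk cek (lexx 0).
- by rewrite add0r ltW.
- by rewrite subrr normr0 mulr0.
- by move=> c' f _; rewrite expR0 mul1r.
- by [].
rewrite hOO in OY1.
apply: (le_trans (chain_dist_le (@seg_step_ge0 _ _ _ D') (chain_cat OY1 Y02))).
have : eta * L <= e0 / 2.
  by rewrite (_ : e0 / 2 = eta * r) ?ler_pM2l ?ltW// /eta; field; rewrite gt_eqF.
by rewrite mulrDl mul1r in L1L; lra.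
Qed.

(** An affine function f that vanishes at a point Z outside D and is positive
    on D takes at some point of the ball a value so negative that no point of
    D can be near it. *)
Lemma ball_sub_of_near D O (rho e : R) : open D -> is_convex D -> e <= rho / 2 ->
  (forall Z, `|Z - O| < rho -> exists2 Y, D Y & `|Z - Y| < e) ->
  forall Z, `|Z - O| < rho / 2 -> D Z.
Proof.
move=> oD cD er near_D Z ZO; apply: contrapT => DZ.
have [c [f [fD fZ]]] := open_convex_functional oD cD DZ.
(* V is the point of the unit ball for the supremum norm at which f attains
   its maximum S. *)
pose V : E := \matrix_(i, j) Num.sg (f (delta_mx i j)).
pose S := \sum_i \sum_j `|f (delta_mx i j)|.
have fE M : f M = \sum_i \sum_j M i j * f (delta_mx i j).
  rewrite {1}(matrix_sum_delta M) linear_sum; apply: eq_bigr => i _.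
  by rewrite linear_sum; apply: eq_bigr => j _; rewrite linearZ.
have fV : f V = S.
  rewrite fE; apply: eq_bigr => i _; apply: eq_bigr => j _.
  by rewrite mxE normrEsg.
have fM M : f M <= `|M| * S.
  rewrite fE mulr_sumr; apply: ler_sum => i _; rewrite mulr_sumr.
  apply: ler_sum => j _; rewrite (le_trans (ler_norm _))// normrM.
  by rewrite ler_wpM2r// mx_norm_entry.
have V1 : `|V| <= 1.
  by apply: mx_norm_le => // i j; rewrite mxE normr_sg; case: eqP.
have S0 : 0 <= S by apply: sumr_ge0 => i _; exact: sumr_ge0.
have rho0 : 0 < rho by have := le_lt_trans (normr_ge0 _) ZO; lra.
pose T := Z - (rho / 2) *: V.
have fT : f T = f Z - rho / 2 * S by rewrite linearB linearZ/= fV.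
have [|Y DY YT] := near_D T.
  rewrite /T addrAC; apply: (le_lt_trans (ler_normB _ _)).
  have r20 : 0 <= rho / 2 by rewrite divr_ge0// ltW.
  rewrite normrZ ger0_norm//; have := ler_wpM2l r20 V1; rewrite mulr1; lra.
have := fD _ DY; have -> : f Y = f (Y - T) + f T by rewrite linearB subrK.
rewrite fT; have := fM (Y - T).
have : `|Y - T| * S <= rho / 2 * S.
  by rewrite ler_wpM2r// distrC (le_trans (ltW YT)).
lra.
Qed.

(** shrink O e Z is a convex combination of Y and of a point of the ball of
    radius rho around O. *)
Lemma shrink_in D O Z Y (rho e e' : R) : is_convex D -> 0 < e ->
  (forall W, `|W - O| < rho -> D W) -> e' <= e * rho -> `|Z - Y| < e' -> D Y ->
  D (shrink O e Z).
Proof.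
move=> cD e0 DO ee ZY DY.
have e1 : 0 < 1 + e by rewrite ltr_pwDl// ltW.
have -> : shrink O e Z = (1 + e)^-1 *: Y + (1 - (1 + e)^-1) *: (O + e^-1 *: (Z - Y)).
  by apply/matrixP => i j; rewrite !mxE; field; rewrite !gt_eqF.
apply: cD => //.
  apply: DO; rewrite addrC addKr normrZ gtr0_norm ?invr_gt0//.
  by rewrite mulrC ltr_pdivrMr// mulrC; exact: lt_le_trans ee.
by rewrite invr_ge0 (ltW e1) invf_le1// lerDl ltW.
Qed.

(** This makes the bounds for the members of a convergent sequence of sets
    uniform. *)
Lemma rank1_bounded_shrink D D' O (r1 e : R) : is_convex D -> D O -> 0 < r1 ->
  0 < e -> e <= 1 ->
  rank1_bounded D O r1 -> (forall Z, D' Z -> `|Z - O| < 2 * r1 + 1 -> D (shrink O e Z)) ->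
  rank1_bounded D' O (2 * r1).
Proof.
move=> cD DO r10 e0 e1 bD DD' a b a1 b1 [D1 D2]; apply: (bD a b a1 b1).
have abn : `|a^T *m b| <= 1 by have := mulmx_norm_le a b; rewrite a1 b1 mulr1.
have nrm : `|2 * r1 *: (a^T *m b)| < 2 * r1 + 1.
  rewrite normrZ gtr0_norm ?mulr_gt0//.
  have : 2 * r1 * `|a^T *m b| <= 2 * r1 * 1 by rewrite ler_pM2l// mulr_gt0.
  lra.
have h1 := DD' _ D1; have h2 := DD' _ D2.
rewrite addrC addKr in h1; rewrite addrC addKr normrN in h2.
have {}h1 := h1 nrm; have {}h2 := h2 nrm.
have t01 : 0 <= (1 + e) / 2 <= 1 by apply/andP; split; lra.
have e1' : 1 + e != 0 by rewrite gt_eqF// ltr_pwDl// ltW.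
have h3 := convex_segment cD DO h1 t01; have h4 := convex_segment cD DO h2 t01.
move: h3 h4; set M := a^T *m b; clearbody M => h3 h4.
split.
  suff -> : O + r1 *: M = O + ((1 + e) / 2) *: (shrink O e (O + 2 * r1 *: M) - O) by [].
  by apply/matrixP => i j; rewrite !mxE; field.
suff -> : O - r1 *: M = O + ((1 + e) / 2) *: (shrink O e (O - 2 * r1 *: M) - O) by [].
by apply/matrixP => i j; rewrite !mxE; field.
Qed.

End Comparison.

(** * Separation and completeness in a chart *)

Section ChartMetric.
Variables (R : realType) (q p : nat).
Local Notation E := 'M[R]_(q, p).
Implicit Types (D : set E) (X Y Z O : E).
Local Notation schain D := (chain (seg_step D)).
Local Notation dist D := (chain_dist (seg_step D)).
Local Notation cost_ge0 D := (@seg_step_ge0 R q p D).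

Lemma seg_chainable D X Y : open D -> is_convex D -> D X -> D Y ->
  exists L, schain D X Y L.
Proof.
move=> oD cD DX DY; have [e e0 De] := open_ball_sub oD DX; have [e' e'0 De'] := open_ball_sub oD DY.
have [|B hB] := @chain_bounded R q p (Num.min e e') `|Y - X|.
  by rewrite lt_min e0.
have [|||L XY _] := hB D X Y cD => //; last by exists L.
  by move=> Z; rewrite lt_min => /andP[/De].
by move=> Z; rewrite lt_min => /andP[_ /De'].
Qed.

Lemma scalar_bounded (f : {scalar E}) : exists2 S : R, 0 < S &
  forall M, `|f M| <= S * `|M|.
Proof.
exists (1 + \sum_i \sum_j `|f (delta_mx i j)|).
  by rewrite ltr_pwDl// sumr_ge0// => i _; exact: sumr_ge0.
move=> M; rewrite {1}(matrix_sum_delta M) linear_sum mulrDl mul1r.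
apply: (le_trans (ler_norm_sum _ _ _)); apply: (@le_trans _ _ (0 + _)); last first.
  by apply: lerD; [exact: normr_ge0|exact: lexx].
rewrite add0r mulr_suml; apply: ler_sum => i _; rewrite linear_sum mulr_suml.
apply: (le_trans (ler_norm_sum _ _ _)); apply: ler_sum => j _.
by rewrite linearZ normrM mulrC ler_wpM2l// mx_norm_entry.
Qed.

(** By chain_lower a chain of small cost has small extent. *)
Lemma seg_dist_eq0 D X Y : open D -> is_convex D -> no_rank1_line D ->
  D X -> D Y -> dist D X Y = 0 -> X = Y.
Proof.
move=> oD cD nD DX DY XY0; have [r1 r10 bD] := no_rank1_line_bounded oD cD nD DX.
pose c := r1 * expR 1; have c0 : 0 < c by rewrite mulr_gt0 ?expR_gt0.
apply/eqP; rewrite eq_sym -subr_eq0 -normr_le0; apply/ler_addgt0Pr => e e0.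
have [L XYL] : exists2 L, schain D X Y L & L < Num.min 1 (e / c).
  apply: chain_dist_lt; first exact: seg_chainable.
  by rewrite XY0 lt_min ltr01 divr_gt0.
rewrite lt_min ltr_pdivlMr// => /andP[L1 Le].
rewrite add0r; apply: le_trans (ltW Le); rewrite mulrC.
apply: (@chain_lower _ _ _ D X X Y L r1 0 1) => //; last by rewrite add0r ltW.
by move=> c' f _; rewrite expR0 mul1r.
Qed.

(** A Cauchy sequence stays in a ball for the chain distance. There the
    positive affine functions are bounded away from 0, so that the limit for
    the norm cannot lie on the boundary of D. *)
Lemma seg_dist_complete D (u : nat -> E) : open D -> is_convex D -> no_rank1_line D ->
  (forall n, D (u n)) ->
  (forall e, 0 < e -> exists N, forall m n, (N <= m)%N -> (N <= n)%N ->
     dist D (u m) (u n) < e) ->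
  exists2 Z, D Z & forall e, 0 < e ->
    exists N, forall n, (N <= n)%N -> dist D (u n) Z < e.
Proof.
move=> oD cD nD Du cu; have [N0 hN0] := cu 1 ltr01.
have chainu m n : exists L, schain D (u m) (u n) L by exact: seg_chainable.
pose O := u N0; have DO : D O by exact: Du.
have near_O n : (N0 <= n)%N -> exists2 L, schain D O (u n) L & L < 1.
  by move=> N0n; apply: chain_dist_lt; [exact: chainu|exact: hN0].
have [r1 r10 bD] := no_rank1_line_bounded oD cD nD DO.
pose c := r1 * expR 2; have c0 : 0 < c by rewrite mulr_gt0 ?expR_gt0.
have lower m n (e : R) : (N0 <= m)%N -> e <= 1 -> dist D (u m) (u n) < e ->
    `|u n - u m| <= c * e.
  move=> N0m e1 /(chain_dist_lt (chainu m n))[L mnL Le].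
  have h : `|u n - u m| <= c * L.
    apply: (@chain_lower _ _ _ D O (u m) (u n) L r1 1 2) => //; last by lra.
    move=> c' f fD; have [L' OmL L'1] := near_O m N0m.
    have := chain_pos DO OmL fD (@pos_on1 _ _ _ D).
    rewrite /= !addr0 !mulr1 => h; apply: (le_trans h).
    by rewrite ler_pM2r ?ler_expR ?ltW//; exact: fD.
  by apply: (le_trans h); rewrite ler_pM2l// ltW.
have cauchy_u : cauchy (u @ \oo).
  apply/cauchy_ballP => e e0; rewrite near_simpl.
  pose e' := Num.min 1 (e / (2 * c)).
  have e'0 : 0 < e' by rewrite lt_min ltr01 divr_gt0// mulr_gt0.
  have [N hN] := cu e' e'0.
  exists ([set n | (maxn N N0 <= n)%N], [set n | (maxn N N0 <= n)%N]).
    by split; exact: nbhs_infty_ge.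
  move=> [m n] [/=]; rewrite !geq_max => /andP[Nm N0m] /andP[Nn N0n].
  rewrite -ball_normE /ball_/= distrC.
  have e'1 : e' <= 1 by rewrite ge_min lexx.
  apply: (le_lt_trans (lower m n e' N0m e'1 (hN m n Nm Nn))).
  have : e' <= e / (2 * c) by rewrite ge_min lexx orbT.
  by rewrite ler_pdivlMr ?mulr_gt0//; lra.
have /cauchy_cvgP/cvg_ex[/= Z uZ] := cauchy_u.
have {}uZ e : 0 < e -> exists N, forall n, (N <= n)%N -> `|u n - Z| < e.
  move=> e0; have /cvgrPdist_lt/(_ _ e0) := uZ.
  by case=> N _ hN; exists N => n /hN/=; rewrite distrC.
have DZ : D Z.
  apply: contrapT => /(open_convex_functional oD cD)[c' [f [fD fZ]]].
  have [S S0 fS] := scalar_bounded f.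
  have fO : 0 < c' + f O by exact: fD.
  have e1 := expR_gt0 (1 : R).
  have [N hN] := uZ ((c' + f O) / (S * expR 1)) (divr_gt0 fO (mulr_gt0 S0 e1)).
  pose n := maxn N N0.
  have [L OnL L1] := near_O n (leq_maxr _ _).
  have := chain_pos DO OnL (@pos_on1 _ _ _ D) fD.
  rewrite /= !addr0 !mul1r => h.
  have fun_ : c' + f (u n) <= S * `|u n - Z|.
    rewrite -[X in c' + f X](subrK Z) linearD/= addrCA fZ addr0.
    by apply: le_trans (fS _); exact: ler_norm.
  have := hN n (leq_maxl _ _); rewrite ltr_pdivlMr ?mulr_gt0// => h2.
  have h3 : expR L * (c' + f (u n)) <= expR 1 * (c' + f (u n)).
    by rewrite ler_pM2r ?ler_expR ?ltW//; exact: fD.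
  have := ler_wpM2l (ltW e1) fun_; lra.
exists Z => // e e0; have [rho rho0 Dr] := open_ball_sub oD DZ.
pose A : R := (q * p)%:R; have A0 : 0 <= A by rewrite ler0n.
pose e1 := Num.min (rho / 4) (e * rho / (12 * (A + 1))).
have e10 : 0 < e1 by rewrite lt_min !divr_gt0// ?mulr_gt0// ltr_wpDl.
have e1r : e1 <= rho / 4 by rewrite ge_min lexx.
have e1A : A * (6 * e1 / rho) < e.
  have : e1 <= e * rho / (12 * (A + 1)) by rewrite ge_min lexx orbT.
  rewrite ler_pdivlMr ?mulr_gt0 ?ltr_wpDl// => h.
  rewrite !mulrA ltr_pdivrMr//; have := mulr_gt0 e0 rho0; nra.
have [N hN] := uZ _ e10; exists N => n Nn; have un := hN n Nn.
have [||||||L nZ Le] := @chain_ball R q p D Z (u n) Z rho e1 => //.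
- by apply: (lt_trans un); lra.
- by rewrite subrr normr0 divr_gt0.
- by rewrite distrC ltW.
by apply: le_lt_trans (chain_dist_le (cost_ge0 D) nZ) (le_lt_trans Le e1A).
Qed.

(** A single e' serves all sets D which contain the two balls: the distances
    of a sequence of such sets are equicontinuous. *)
Lemma chain_dist_perturb O Y0 (rho e : R) : 0 < rho -> 0 < e ->
  exists2 e', 0 < e' & forall D, is_convex D ->
    (forall Z, `|Z - O| < rho -> D Z) -> (forall Z, `|Z - Y0| < rho -> D Z) ->
    forall X Y, `|X - O| < e' -> `|Y - Y0| < e' ->
      [/\ D X, D Y & `|dist D X Y - dist D O Y0| < e].
Proof.
move=> rho0 e0.
pose A : R := (q * p)%:R; have A0 : 0 <= A by rewrite ler0n.
pose e1 := Num.min (rho / 4) (e * rho / (24 * (A + 1))).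
have e10 : 0 < e1 by rewrite lt_min !divr_gt0// ?mulr_gt0// ltr_wpDl.
have e1r : e1 <= rho / 4 by rewrite ge_min lexx.
have e1A : A * (6 * e1 / rho) <= e / 4.
  have : e1 <= e * rho / (24 * (A + 1)) by rewrite ge_min lexx orbT.
  rewrite ler_pdivlMr ?mulr_gt0 ?ltr_wpDl// => h.
  rewrite !mulrA ler_pdivrMr//; nra.
exists e1 => // D cD DO DY0 X Y XO YY0.
have le1 C X1 X2 : (forall Z, `|Z - C| < rho -> D Z) -> `|X1 - C| < e1 ->
    `|X2 - C| < e1 -> `|X2 - X1| <= e1 -> exists2 L, schain D X1 X2 L & L <= e / 4.
  move=> DC X1C X2C X12.
  have [||||||L h Le] := @chain_ball R q p D C X1 X2 rho e1 => //.
  - by apply: (lt_le_trans X1C); lra.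
  - by apply: (lt_le_trans X2C); lra.
  by exists L => //; exact: le_trans Le e1A.
have CC (C : E) : `|C - C| < e1 by rewrite subrr normr0.
have [L1 c1 l1] := le1 O O X DO (CC O) XO (ltW XO).
have [L2 c2 l2] : exists2 L, schain D X O L & L <= e / 4.
  by apply: (le1 O) => //; rewrite distrC ltW.
have [L3 c3 l3] := le1 Y0 Y0 Y DY0 (CC Y0) YY0 (ltW YY0).
have [L4 c4 l4] : exists2 L, schain D Y Y0 L & L <= e / 4.
  by apply: (le1 Y0) => //; rewrite distrC ltW.
have [B hB] := @chain_bounded R q p rho `|Y0 - O| rho0.
have [L0 c0 _] := hB D O Y0 cD DO DY0 (lexx _).
have DX : D X by apply: DO; lra.
have DY : D Y by apply: DY0; lra.
split=> //.
have ex X1 X2 L (h : schain D X1 X2 L) : exists L, schain D X1 X2 L by exists L.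
have t1 := chain_dist_triangle (cost_ge0 D) (ex _ _ _ c2) (ex _ _ _ (chain_cat c0 c3)).
have t2 := chain_dist_triangle (cost_ge0 D) (ex _ _ _ c0) (ex _ _ _ c3).
have t3 := chain_dist_triangle (cost_ge0 D) (ex _ _ _ c1)
  (ex _ _ _ (chain_cat (chain_cat c2 c0) (chain_cat c3 c4))).
have t4 := chain_dist_triangle (cost_ge0 D)
  (ex _ _ _ (chain_cat (chain_cat c2 c0) c3)) (ex _ _ _ c4).
have d1 := chain_dist_le (cost_ge0 D) c1; have d2 := chain_dist_le (cost_ge0 D) c2.
have d3 := chain_dist_le (cost_ge0 D) c3; have d4 := chain_dist_le (cost_ge0 D) c4.
rewrite ltr_norml; apply/andP; split; lra.
Qed.

End ChartMetric.

(** * Local Hausdorff convergence *)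

Section HausdorffConvergence.
Variables (R : realType) (q p : nat).
Local Notation E := 'M[R]_(q, p).
Implicit Types (D : set E) (X Y Z O : E).
Local Notation dist D := (chain_dist (seg_step D)).

Lemma norm_le_eucl (X : E) : `|X| <= eucl_norm X.
Proof.
apply: mx_norm_le => [|i j]; first exact: sqrtr_ge0.
rewrite -sqrtr_sqr ler_wsqrtr// (bigD1 i)//= (bigD1 j)//= -addrA lerDl.
by rewrite addr_ge0 ?sumr_ge0// => k _; rewrite ?sqr_ge0// sumr_ge0// => l _; rewrite sqr_ge0.
Qed.

Lemma eucl_le_norm (X : E) : eucl_norm X <= (q * p)%:R * `|X|.
Proof.
rewrite -[leRHS]ger0_norm ?mulr_ge0// -sqrtr_sqr ler_wsqrtr//.
apply: (@le_trans _ _ (\sum_(i < q) \sum_(j < p) `|X| ^+ 2)).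
  apply: ler_sum => i _; apply: ler_sum => j _.
  by rewrite -real_normK ?num_real// lerXn2r ?nnegrE ?mx_norm_entry.
rewrite !sumr_const !card_ord -mulrnA mulnC -(mulr_natl (`|X| ^+ 2)) exprMn.
rewrite ler_wpM2r ?sqr_ge0//.
by rewrite -natrX ler_nat; case: (q * p)%N => // n; rewrite expnS leq_pmulr.
Qed.

Lemma closure_norm D Z (e : R) : 0 < e -> closure D Z -> exists2 Y, D Y & `|Z - Y| < e.
Proof.
move=> e0 /(_ _ (norm_lt_nbhs Z e0))[Y [DY YZ]].
by exists Y => //; rewrite distrC.
Qed.

(** Closures are disposed of by halving e, and balls for the two norms are
    compared by enlarging the radius. *)
Lemma local_hausdorff_near (An : nat -> set E) A (r e : R) :
  local_hausdorff_cvg An A -> 0 < e ->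
  \forall n \near \oo,
    (forall Z, A Z -> `|Z| <= r -> exists2 Y, An n Y & `|Z - Y| < e) /\
    (forall Z, An n Z -> `|Z| <= r -> exists2 Y, A Y & `|Z - Y| < e).
Proof.
move=> cvgA e0; pose r' := (q * p)%:R * `|r| + 1.
have r'0 : 0 < r' by rewrite ltr_wpDl// mulr_ge0.
have e20 : 0 < e / 2 by rewrite divr_gt0.
have lim : \forall n \near \oo, (hausdorff_dist (ball_part r' (closure (An n)))
    (ball_part r' (closure A)) < (e / 2)%:E)%E.
  have := cvgA r' r'0 [set x | (x < (e / 2)%:E)%E]; apply.
  by apply: open_nbhs_nbhs; split; [exact: open_ereal_lt_ereal|rewrite /= lte_fin].
have rr Z : `|Z| <= r -> eucl_norm Z <= r'.
  move=> Zr; apply: (le_trans (eucl_le_norm Z)); apply: ler_wpDr => //.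
  by rewrite ler_wpM2l// (le_trans Zr)// ler_norm.
have close B B' e' Z : e' < e / 2 ->
    ball_part r' (closure B) `<=` eucl_nbhd e' (ball_part r' (closure B')) ->
    B Z -> `|Z| <= r -> exists2 Y, B' Y & `|Z - Y| < e.
  move=> ee BB' BZ Zr; have [|Y [cY _] ZY] := BB' Z.
    by split; [exact: subset_closure|exact: rr].
  have [Y' BY' YY'] := closure_norm e20 cY.
  exists Y' => //; rewrite -(subrKA Y); apply: (le_lt_trans (ler_normD _ _)).
  by have := norm_le_eucl (Z - Y); lra.
apply: filterS lim => n /ereal_inf_lt[_ [e' [e'0 h1 h2] <-]]; rewrite lte_fin => ee.
by split=> Z; [exact: close ee h2|exact: close ee h1].
Qed.

(** By local Hausdorff convergence, a homothety of centre O and ratio close to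
    1 maps a large part of A into An n, and conversely; so the distances can
    be compared in both directions. *)
Lemma seg_dist_cvg (An : nat -> set E) A O Y0 (e : R) :
  (forall n, open (An n)) -> (forall n, is_convex (An n)) ->
  open A -> is_convex A -> no_rank1_line A ->
  local_hausdorff_cvg An A -> A O -> A Y0 -> 0 < e ->
  exists2 e', 0 < e' & \forall n \near \oo, forall X Y, `|X - O| < e' -> `|Y - Y0| < e' ->
    [/\ An n X, An n Y & `|dist (An n) X Y - dist A X Y| < e].
Proof.
move=> oAn cAn oA cA nA cvgA AO AY0 e0.
have [rho [rho0 AOr AYr]] : exists rho : R, [/\ 0 < rho,
    forall Z, `|Z - O| < rho -> A Z & forall Z, `|Z - Y0| < rho -> A Z].
  have [r1 r10 h1] := open_ball_sub oA AO; have [r2 r20 h2] := open_ball_sub oA AY0.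
  exists (Num.min r1 r2); split=> [|Z|Z]; rewrite lt_min ?r10// => /andP[].
    by move=> /h1.
  by move=> _ /h2.
have rho20 : 0 < rho / 2 by rewrite divr_gt0.
have rho2 : rho / 2 < rho by lra.
have [B hB] := @chain_bounded R q p (rho / 2) `|Y0 - O| rho20.
pose r := `|B| + 1; have r0 : 0 < r by rewrite ltr_wpDl.
have e40 : 0 < e / 4 by rewrite divr_gt0.
have [r1 r10 bA] := no_rank1_line_bounded oA cA nA AO.
have r120 : 0 < 2 * r1 by rewrite mulr_gt0.
have [e' e'0 he'] := @chain_dist_perturb R q p O Y0 (rho / 2) (e / 4) rho20 e40.
have [R1 [e1 [R10 e10 e11 h1]]] := chain_dist_compare O Y0 rho20 r10 r0 e40.
have [R2 [e2 [R20 e20 e21 h2]]] := chain_dist_compare O Y0 rho20 r120 r0 e40.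
exists e' => //.
pose M := `|O| + `|Y0| + rho + R1 + R2 + (2 * r1 + 1).
pose d := Num.min (rho / 2) (Num.min (e1 * (rho / 2)) (e2 * (rho / 2))).
have d0 : 0 < d by rewrite !lt_min rho20 !mulr_gt0.
have d1 : d <= rho / 2 by rewrite ge_min lexx.
have d2 : d <= e1 * (rho / 2) by rewrite !ge_min lexx orbT.
have d3 : d <= e2 * (rho / 2) by rewrite !ge_min lexx !orbT.
apply: filterS (local_hausdorff_near M cvgA d0) => n [A_An An_A].
have inM C Z (s : R) : `|Z - C| < s -> `|C| + s <= M -> `|Z| <= M.
  move=> ZC CM; rewrite -(subrK C Z); apply: (le_trans (ler_normD _ _)); lra.
have O0 : 0 <= `|O| by []. have Y00 : 0 <= `|Y0| by [].
have AnO : forall Z, `|Z - O| < rho / 2 -> An n Z.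
  apply: (ball_sub_of_near (oAn n) (cAn n) d1) => Z ZO.
  by apply: A_An; [exact: AOr|apply: (inM _ _ _ ZO); rewrite /M; lra].
have AnY : forall Z, `|Z - Y0| < rho / 2 -> An n Z.
  apply: (ball_sub_of_near (oAn n) (cAn n) d1) => Z ZO.
  by apply: A_An; [exact: AYr|apply: (inM _ _ _ ZO); rewrite /M; lra].
have AO2 Z : `|Z - O| < rho / 2 -> A Z by move=> ZO; apply: AOr; exact: lt_trans rho2.
have AY2 Z : `|Z - Y0| < rho / 2 -> A Z by move=> ZO; apply: AYr; exact: lt_trans rho2.
have AnOO : An n O by apply: AnO; rewrite subrr normr0.
have bAn : rank1_bounded (An n) O (2 * r1).
  apply: (@rank1_bounded_shrink _ _ _ A (An n) O r1 1) => // Z AnZ ZO.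
  have [|Y AY ZY] := An_A Z AnZ; first by apply: (inM _ _ _ ZO); rewrite /M; lra.
  by apply: (@shrink_in _ _ _ A O Z Y (rho / 2) 1 d) => //; rewrite mul1r.
have A_c Z : A Z -> `|Z - O| < R1 -> An n (shrink O e1 Z).
  move=> AZ ZO; have [|Y AY ZY] := A_An Z AZ; first by apply: (inM _ _ _ ZO); rewrite /M; lra.
  exact: (@shrink_in _ _ _ (An n) O Z Y (rho / 2) e1 d).
have An_c Z : An n Z -> `|Z - O| < R2 -> A (shrink O e2 Z).
  move=> AZ ZO; have [|Y AY ZY] := An_A Z AZ; first by apply: (inM _ _ _ ZO); rewrite /M; lra.
  exact: (@shrink_in _ _ _ A O Z Y (rho / 2) e2 d).
have [L hL LB] := hB A O Y0 cA AO2 AY2 (lexx _).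
have [L' hL' LB'] := hB (An n) O Y0 (cAn n) AnO AnY (lexx _).
have Br : B < r by rewrite /r ltr_pwDr// ler_norm.
have dA := chain_dist_le (@seg_step_ge0 _ _ _ A) hL.
have dAn := chain_dist_le (@seg_step_ge0 _ _ _ (An n)) hL'.
have c1 : dist (An n) O Y0 <= dist A O Y0 + e / 4.
  by apply: h1 => //; [exists L|lra].
have c2 : dist A O Y0 <= dist (An n) O Y0 + e / 4.
  by apply: h2 => //; [exists L'|lra].
move=> X Y XO YY0.
have [_ _ p1] := he' A cA AO2 AY2 X Y XO YY0.
have [AnX AnY' p2] := he' (An n) (cAn n) AnO AnY X Y XO YY0.
split=> //; move: p1 p2; rewrite !ltr_norml => /andP[p1 p2] /andP[p3 p4].
apply/andP; split; lra.
Qed.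

End HausdorffConvergence.

(** * Projective intervals and chart coordinates *)

Lemma vlineZ (K : fieldType) (vT : vectType K) (k : K) (v : vT) : k != 0 ->
  <[k *: v]>%VS = <[v]>%VS.
Proof.
move=> k0; apply/eqP; rewrite eqEsubv -!memvE memvZ ?memv_line//=.
by rewrite -{1}[v](scalerK k0) memvZ// memv_line.
Qed.

Lemma vline0 (K : fieldType) (vT : vectType K) : <[0 : vT]>%VS = 0%VS.
Proof. by apply/eqP; rewrite -dimv_eq0 dim_vline eqxx. Qed.

Section GrSteps.
Variables (R : realType) (p q : nat).
Local Notation V := 'rV[R]_(p + q).
Implicit Types (Om : set (Gr R p q)) (x y z : Gr R p q).

(** The points A + <s *: a + t *: b> with s, t > 0 form an interval of a
    projective line in Om, whose ends correspond to a and b. Larger intervals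
    give smaller costs, so that the infimum over chains leads to the maximal
    one. If a and b are dependent modulo A, the interval is a single point. *)
Variant gr_step Om x y : R -> Prop := GrStep (A : {vspace V}) (a b : V) (r : R) of
  1 <= r &
  (forall s t : R, 0 < s -> 0 < t -> exists2 z, Om z & val z = (A + <[s *: a + t *: b]>)%VS) &
  val x = (A + <[a + b]>)%VS & val y = (A + <[a + r *: b]>)%VS :
  gr_step Om x y (ln r).

Lemma gr_step_ge0 Om x y d : gr_step Om x y d -> 0 <= d.
Proof. by case=> A a b r r1 _ _ _; exact: ln_ge0. Qed.

Lemma gr_step_in Om x y d : gr_step Om x y d -> Om x /\ Om y.
Proof.
case=> A a b r r1 h xE yE; split.
  have [z Omz zE] := h 1 1 ltr01 ltr01; rewrite (_ : x = z)//.
  by apply: val_inj; rewrite xE zE !scale1r.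
have [z Omz zE] := h 1 r ltr01 (lt_le_trans ltr01 r1); rewrite (_ : y = z)//.
by apply: val_inj; rewrite yE zE scale1r.
Qed.

Lemma gr_step_sym Om x y d : gr_step Om x y d -> gr_step Om y x d.
Proof.
case=> A a b r r1 h xE yE; have r0 : 0 < r by exact: lt_le_trans r1.
apply: (GrStep (A := A) (a := r *: b) (b := a)) => //.
- move=> s t s0 t0; have [z Omz zE] := h t (s * r) t0 (mulr_gt0 s0 r0).
  by exists z => //; rewrite zE scalerA addrC.
- by rewrite yE addrC.
- rewrite xE; congr (_ + _)%VS.
  by rewrite -scalerDr vlineZ 1?addrC// gt_eqF.
Qed.

(** The curve t |-> A + <a + r ^ t *: b> has constant speed. *)
Lemma gr_step_geodesic Om x y d : gr_step Om x y d ->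
  exists c : R -> Gr R p q, [/\ c 0 = x, c 1 = y,
    forall t : R, 0 <= t <= 1 -> Om (c t) &
    forall s t : R, 0 <= s -> s <= t -> t <= 1 -> gr_step Om (c s) (c t) (d * (t - s))].
Proof.
case=> A a b r r1 h xE yE; have r0 : 0 < r by exact: lt_le_trans r1.
pose e (t : R) := expR (t * ln r); have e0 t : 0 < e t by exact: expR_gt0.
have /choice[c hc] t : exists z, Om z /\ val z = (A + <[a + e t *: b]>)%VS.
  by have [z Omz zE] := h 1 (e t) ltr01 (e0 t); exists z; rewrite zE scale1r.
exists c; split.
- by apply: val_inj; rewrite (hc 0).2 xE /e mul0r expR0 scale1r.
- by apply: val_inj; rewrite (hc 1).2 yE /e mul1r lnK ?posrE.
- by move=> t _; exact: (hc t).1.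
move=> s t s0 st t1.
have -> : ln r * (t - s) = ln (expR ((t - s) * ln r)) by rewrite expRK mulrC.
apply: (GrStep (A := A) (a := a) (b := e s *: b)).
- by rewrite -expR0 ler_expR mulr_ge0 ?subr_ge0// ln_ge0.
- move=> s' t' s'0 t'0; have [z Omz zE] := h s' (t' * e s) s'0 (mulr_gt0 t'0 (e0 s)).
  by exists z => //; rewrite zE scalerA.
- exact: (hc s).2.
- by rewrite (hc t).2 scalerA -expRD -mulrDl subrK.
Qed.

End GrSteps.

Section ChartCoordinates.
Variables (R : realType) (p q : nat).
Local Notation V := 'rV[R]_(p + q).
Variables (u : p.-tuple V) (w : q.-tuple V).

(** The kernel of chart_fst is W, and the graph of X is given by the equation
    chart_snd v = X *m chart_fst v. *)
Definition chart_fst (v : V) : 'cV[R]_p :=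
  \col_j coord (cat_tuple u w) (lshift q j) v.
Definition chart_snd (v : V) : 'cV[R]_q :=
  \col_i coord (cat_tuple u w) (rshift p i) v.

Let chart_fst_linear : linear chart_fst.
Proof. by move=> a v v'; apply/colP => j; rewrite !mxE linearP. Qed.

Let chart_snd_linear : linear chart_snd.
Proof. by move=> a v v'; apply/colP => j; rewrite !mxE linearP. Qed.

HB.instance Definition _ := GRing.isLinear.Build R V 'cV[R]_p _ chart_fst chart_fst_linear.
HB.instance Definition _ := GRing.isLinear.Build R V 'cV[R]_q _ chart_snd chart_snd_linear.

Definition chart_vec (a : 'cV[R]_p) (b : 'cV[R]_q) : V :=
  \sum_j a j 0 *: tnth u j + \sum_i b i 0 *: tnth w i.

Variables (W : {vspace V}) (U0 : Gr R p q).
Hypothesis uw : chart_bases W U0 u w.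

Lemma chart_basis : basis_of fullv (cat_tuple u w).
Proof.
case: uw => dW UW bU bW.
have dUW : directv (val U0 + W)%VS by apply/directv_addP.
have -> : fullv = (val U0 + W)%VS.
  apply/esym/eqP; rewrite eqEdim subvf/= dimvf (directvP dUW)/= (eqP (valP U0)) dW.
  by rewrite /dim/= mul1n.
exact: cat_basis.
Qed.

Lemma chart_vecE v : v = chart_vec (chart_fst v) (chart_snd v).
Proof.
rewrite {1}(coord_basis chart_basis (memvf v)) big_split_ord/=; congr (_ + _).
  apply: eq_bigr => j _; rewrite mxE (tnth_nth 0) nth_cat size_tuple.
  by rewrite ltn_ord.
apply: eq_bigr => i _; rewrite mxE (tnth_nth 0) nth_cat size_tuple.
by rewrite ltnNge leq_addr/= addKn.
Qed.

Lemma chart_vecK a b : chart_fst (chart_vec a b) = a /\ chart_snd (chart_vec a b) = b.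
Proof.
pose k (i : 'I_(p + q)) := (col_mx a b) i 0.
have -> : chart_vec a b = \sum_i k i *: (cat_tuple u w)`_i.
  rewrite big_split_ord/=; congr (_ + _).
    apply: eq_bigr => j _; rewrite /k col_mxEu (tnth_nth 0) nth_cat size_tuple.
    by rewrite ltn_ord.
  apply: eq_bigr => i _; rewrite /k col_mxEd (tnth_nth 0) nth_cat size_tuple.
  by rewrite ltnNge leq_addr/= addKn.
have fr := basis_free chart_basis.
split; apply/colP => i; rewrite mxE coord_sum_free// /k.
  by rewrite col_mxEu.
by rewrite col_mxEd.
Qed.

Lemma chart_inj v v' : chart_fst v = chart_fst v' -> chart_snd v = chart_snd v' -> v = v'.
Proof. by move=> h1 h2; rewrite (chart_vecE v) (chart_vecE v') h1 h2. Qed.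

Lemma chart_mem_W v : (v \in W) = (chart_fst v == 0).
Proof.
case: uw => dW UW bU bW; apply/idP/eqP => [vW|v0].
  have -> : v = chart_vec 0 (\col_i coord w i v).
    rewrite /chart_vec big1 ?add0r; last by move=> j _; rewrite mxE scale0r.
    rewrite {1}(coord_basis bW vW); apply: eq_bigr => i _.
    by rewrite mxE (tnth_nth 0).
  exact: (chart_vecK _ _).1.
rewrite (chart_vecE v) v0 /chart_vec big1 ?add0r; last by move=> j _; rewrite mxE scale0r.
apply: memv_suml => i _; rewrite memvZ//.
by rewrite (basis_mem bW)// mem_tnth.
Qed.

Definition graph_vec (X : 'M[R]_(q, p)) (j : 'I_p) : V :=
  tnth u j + \sum_(i < q) X i j *: tnth w i.

Lemma graph_vecE X j : graph_vec X j = chart_vec (delta_mx j 0) (col j X).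
Proof.
rewrite /chart_vec (bigD1 j)//= mxE !eqxx scale1r big1 ?addr0; last first.
  by move=> k kj; rewrite mxE (negbTE kj) scale0r.
by congr (_ + _); apply: eq_bigr => i _; rewrite mxE.
Qed.

Lemma graph_vec_nth X (j : 'I_p) : [tuple graph_vec X j | j < p]`_j = graph_vec X j.
Proof. by rewrite -(tnth_nth 0 [tuple graph_vec X j | j < p] j) tnth_mktuple. Qed.

Lemma graph_vec_sum X v : chart_snd v = X *m chart_fst v ->
  v = \sum_j chart_fst v j 0 *: graph_vec X j.
Proof.
move=> vX; apply: chart_inj.
  rewrite linear_sum {1}(matrix_sum_delta (chart_fst v)).
  by apply: eq_bigr => j _; rewrite big_ord1 linearZ/= graph_vecE (chart_vecK _ _).1.
rewrite vX linear_sum {1}(matrix_sum_delta (chart_fst v)) linear_sum.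
apply: eq_bigr => j _; rewrite big_ord1 !linearZ/= graph_vecE (chart_vecK _ _).2.
by rewrite -colE.
Qed.

Lemma mem_graph X v :
  (v \in graph_space u w X) = (chart_snd v == X *m chart_fst v).
Proof.
apply/idP/eqP => [vX|vX].
  pose g := [tuple graph_vec X j | j < p].
  have : v \in span g by [].
  move=> /coord_span ->; rewrite !linear_sum; apply: eq_bigr => j _.
  rewrite graph_vec_nth !linearZ/= graph_vecE.
  by rewrite !(chart_vecK _ _).1 !(chart_vecK _ _).2 -colE.
rewrite (graph_vec_sum vX).
apply: memv_suml => j _; rewrite memvZ// memv_span//.
by apply/mapP; exists j => //; rewrite mem_enum.
Qed.

Lemma graph_vec_free X : free [tuple graph_vec X j | j < p].
Proof.
apply/freeP => k k0 j; have := congr1 chart_fst k0.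
rewrite linear0 linear_sum => /colP/(_ j); rewrite mxE summxE (bigD1 j)//= big1.
  rewrite addr0 graph_vec_nth linearZ/= graph_vecE (chart_vecK _ _).1.
  by rewrite !mxE !eqxx mulr1.
move=> i ij; rewrite graph_vec_nth linearZ/= graph_vecE (chart_vecK _ _).1.
by rewrite !mxE eq_sym (negbTE ij) mulr0.
Qed.

Lemma graph_dim X : \dim (graph_space u w X) == p.
Proof. by have := graph_vec_free X; rewrite /free size_tuple. Qed.

Definition gr_of X : Gr R p q := exist _ (graph_space u w X) (graph_dim X).

Lemma graph_vec_basis X : basis_of (val (gr_of X)) [tuple graph_vec X j | j < p].
Proof. by apply/andP; split; [exact: eqxx|exact: graph_vec_free]. Qed.

Lemma gr_eq_sub x X : (val x <= graph_space u w X)%VS -> x = gr_of X.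
Proof.
move=> xX; apply: val_inj; apply/eqP; rewrite eqEdim xX/= (eqP (graph_dim X)).
by rewrite (eqP (valP x)).
Qed.

Lemma gr_of_inj : injective gr_of.
Proof.
move=> X Y /(congr1 val)/= XY; apply/matrixP => i j.
have : graph_vec X j \in graph_space u w Y.
  by rewrite -XY memv_span//; apply/mapP; exists j => //; rewrite mem_enum.
rewrite mem_graph graph_vecE (chart_vecK _ _).1 (chart_vecK _ _).2 -colE => /eqP/colP/(_ i).
by rewrite !mxE.
Qed.

(** A subspace of dimension p which meets W trivially is mapped isomorphically
    by chart_fst; X is read off from a basis. *)
Lemma chart_surj x : affine_chart W x -> exists X, x = gr_of X.
Proof.
move=> xW; pose s := vbasis (val x); have bs : basis_of (val x) s := vbasisP _.
have ds : \dim (val x) = p := eqP (valP x).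
pose P : 'M[R]_p := \matrix_(i, j) chart_fst s`_i j 0.
pose Q : 'M[R]_(p, q) := \matrix_(i, j) chart_snd s`_i j 0.
have uP : P \in unitmx.
  rewrite -row_free_unit -kermx_eq0; apply/eqP/row_matrixP => i.
  rewrite row0; set k := row i _.
  have k0 : k *m P = 0 by rewrite -row_mul mulmx_ker row0.
  have v0 : \sum_(j < p) k 0 j *: s`_j = 0.
    apply/eqP; rewrite -memv0 -xW memv_cap; apply/andP; split.
      by apply: memv_suml => j _; rewrite memvZ// vbasis_mem// mem_nth// size_tuple ds.
    rewrite chart_mem_W linear_sum; apply/eqP/colP => l; rewrite summxE mxE.
    move/rowP/(_ l): k0; rewrite !mxE => k0; rewrite -[RHS]k0; apply: eq_bigr => j _.
    by rewrite linearZ !mxE.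
  have ssz : size s == p by rewrite size_tuple ds.
  have /freeP fs : free (Tuple ssz) by exact: basis_free bs.
  by apply/rowP => j; rewrite [RHS]mxE (fs (fun j => k 0 j)).
exists (invmx P *m Q)^T; apply: gr_eq_sub; apply/subvP => v vx.
rewrite (coord_vbasis vx) memv_suml// => j _; rewrite memvZ// mem_graph.
apply/eqP; rewrite -/s; have jp : (j < p)%N by rewrite -[X in (_ < X)%N]ds ltn_ord.
have PE : (chart_fst s`_j)^T = row (Ordinal jp) P by apply/rowP => k; rewrite !mxE.
have QE : (chart_snd s`_j)^T = row (Ordinal jp) Q by apply/rowP => k; rewrite !mxE.
by apply: trmx_inj; rewrite trmx_mul trmxK PE QE -row_mul mulKVmx.
Qed.

Lemma chart_coordE Om : chart_coord u w Om = gr_of @^-1` Om.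
Proof.
apply/seteqP; split=> X /=; last by move=> OX; exists (gr_of X).
by move=> [x Ox xE]; rewrite (_ : gr_of X = x)//; apply: val_inj.
Qed.

End ChartCoordinates.

(** * Projective intervals read in a chart *)

Section ConvexityOfCharts.
Variables (R : realType) (p q : nat).
Local Notation V := 'rV[R]_(p + q).
Variables (W : {vspace V}).

(** A description of the affine combinations of graphs that mentions W but not
    the bases. *)
Lemma mem_graph_conv (U0 : Gr R p q) u w (uw : chart_bases W U0 u w) X Y (t : R) v :
  v \in graph_space u w (t *: X + (1 - t) *: Y) <->
  exists a b, [/\ a \in graph_space u w X, b \in graph_space u w Y,
    a - v \in W, b - v \in W & v = t *: a + (1 - t) *: b].
Proof.
rewrite (mem_graph uw); split=> [/eqP vXY|[a [b [aX bY av bv vab]]]].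
  pose f := chart_fst u w v.
  exists (chart_vec u w f (X *m f)), (chart_vec u w f (Y *m f)).
  have [aP aQ] := chart_vecK uw f (X *m f); have [bP bQ] := chart_vecK uw f (Y *m f).
  rewrite !(mem_graph uw) !(chart_mem_W uw) !linearB/= aP aQ bP bQ !subrr !eqxx.
  split=> //; apply: (chart_inj uw); rewrite linearD !linearZ/= ?aP ?bP ?aQ ?bQ.
    by rewrite -scalerDl subrKC scale1r.
  by rewrite vXY mulmxDl -!scalemxAl.
move: aX bY av bv; rewrite !(mem_graph uw) !(chart_mem_W uw) !linearB/= !subr_eq0.
move=> /eqP aX /eqP bY /eqP av /eqP bv; rewrite {1}vab linearD !linearZ/= aX bY av bv.
by rewrite mulmxDl -!scalemxAl.
Qed.

(** By mem_graph_conv, convexity does not depend on the bases in which the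
    chart is read. *)
Lemma convex_chart_coord (U0 : Gr R p q) u w (uw : chart_bases W U0 u w) (Om : set (Gr R p q)) :
  convex_in_chart W Om -> is_convex (chart_coord u w Om).
Proof.
move=> [OW [U1 [u' [w' [uw' /convex_set_is_convex cO]]]]] X Y t.
rewrite (chart_coordE uw) (chart_coordE uw') /= in cO * => OX OY t01.
have [X' XX'] := chart_surj uw' (OW _ OX); have [Y' YY'] := chart_surj uw' (OW _ OY).
have /= := cO X' Y' t; rewrite -XX' -YY' => /(_ OX OY t01).
suff -> : gr_of uw' (t *: X' + (1 - t) *: Y') = gr_of uw (t *: X + (1 - t) *: Y) by [].
apply: gr_eq_sub; apply/subvP => v /(mem_graph_conv uw')[a [b [aX bY av bv vab]]].
apply/(mem_graph_conv uw); exists a, b; split=> //.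
  by move/(congr1 val): XX' => /= ->.
by move/(congr1 val): YY' => /= ->.
Qed.

End ConvexityOfCharts.

Section StepsInChart.
Variables (R : realType) (p q : nat).
Local Notation V := 'rV[R]_(p + q).
Variables (W : {vspace V}) (U0 : Gr R p q) (u : p.-tuple V) (w : q.-tuple V).
Hypothesis uw : chart_bases W U0 u w.
Implicit Types (X Y : 'M[R]_(q, p)) (Om : set (Gr R p q)).
Local Notation cP := (chart_fst u w).
Local Notation cQ := (chart_snd u w).
Local Notation gr := (gr_of uw).

(** A consists of the vectors of the graph of X on which b vanishes, and e + t
    *: c is the vector of the graph of X + t *: (a^T *m b) above a vector on
    which b takes the value 1. *)
Lemma graph_rank1_line X (a : 'rV[R]_q) (b : 'rV[R]_p) : b != 0 ->
  exists (A : {vspace V}) (e c : V), forall t : R,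
    graph_space u w (X + t *: (a^T *m b)) = (A + <[e + t *: c]>)%VS.
Proof.
move=> b0; have [j bj] : exists j, b 0 j != 0.
  apply/existsP; apply: contraNT b0; rewrite negb_exists => /forallP b0.
  by apply/eqP/rowP => j; move: (b0 j); rewrite negbK mxE => /eqP.
have [e0 be0] : exists e0 : 'cV[R]_p, b *m e0 = 1%:M.
  exists ((b 0 j)^-1 *: delta_mx j 0); apply/matrixP => i k.
  rewrite -scalemxAr -colE !mxE !ord1 eqxx; exact: mulVf.
have [e [eP eQ]] : exists e, cP e = e0 /\ cQ e = X *m e0.
  by exists (chart_vec u w e0 (X *m e0)); exact: chart_vecK uw _ _.
have [c [ccP ccQ]] : exists c, cP c = 0 /\ cQ c = a^T.
  by exists (chart_vec u w 0 a^T); exact: chart_vecK uw _ _.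
pose h := linfun (fun v : V => b *m cP v).
have hE v : h v = b *m cP v.
  have lin : linear (fun v : V => b *m cP v).
    by move=> k x y; rewrite linearP/= linearP.
  pose hL := GRing.isLinear.Build R V 'M[R]_(1, 1) *:%R (fun v : V => b *m cP v) lin.
  by rewrite /h (lfunE (HB.pack (fun v : V => b *m cP v) hL : {linear V -> 'M[R]_(1, 1)})).
exists (graph_space u w X :&: lker h)%VS, e, c => t.
have memA v : (v \in (graph_space u w X :&: lker h)%VS) =
    (cQ v == X *m cP v) && (b *m cP v == 0).
  by rewrite memv_cap memv_ker hE (mem_graph uw).
apply/eqP; rewrite eqEsubv; apply/andP; split; apply/subvP => v.
  rewrite (mem_graph uw) => /eqP vX.
  pose k := (b *m cP v) 0 0; have kE : b *m cP v = k%:M by rewrite [LHS]mx11_scalar.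
  rewrite -[v](subrK (k *: (e + t *: c))); apply: memv_add; last by rewrite memvZ// memv_line.
  rewrite memA !linearB !linearZ/= !linearD !linearZ/= eP eQ ccP ccQ vX !mulmx0.
  rewrite !oppr0 !scaler0 !addr0 be0 kE !scalerN scale_scalar_mx mulr1 subrr eqxx andbT.
  rewrite mulmxDl -scalemxAl -mulmxA kE mul_mx_scalar.
  by rewrite -!addrA [X in _ + X]addrCA subrr addr0.
move=> /memv_addP[y + [_ /vlineP[k ->] ->]]; rewrite memA => /andP[/eqP yX /eqP yb].
rewrite (mem_graph uw) !linearD !linearZ/= eP eQ ccP ccQ yX mulmx0 !scaler0 addr0.
rewrite !mulmxDl -!scalemxAl -!mulmxA yb be0 mulmx0 mulmx1 scaler0 addr0.
by rewrite scalerDr.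
Qed.

(** The ends of the interval are the points of parameters - 1 / l and 1 / m,
    the point at infinity of the line taking the place of an end when l or m
    vanishes. *)
Lemma gr_step_of_seg Om X Y d : seg_step (chart_coord u w Om) X Y d ->
  gr_step Om (gr X) (gr Y) d.
Proof.
rewrite (chart_coordE uw) => XYd; have [/= OX OY] := seg_step_in XYd.
have d0 := seg_step_ge0 XYd.
have [XY|XY] := eqVneq Y X.
  rewrite XY (_ : d = ln (expR d)); last by rewrite expRK.
  apply: (GrStep (A := val (gr X)) (a := 0) (b := 0)).
  - by rewrite -expR0 ler_expR.
  - by move=> s t _ _; exists (gr X) => //; rewrite !scaler0 addr0 vline0 addv0.
  - by rewrite addr0 vline0 addv0.
  - by rewrite scaler0 addr0 vline0 addv0.
case: d / XYd d0 => l m l0 m0 lm0 m1 [a [b NE]] h d0.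
have b0 : b != 0.
  by apply: contra_neq XY => b0; apply/eqP; rewrite -subr_eq0 NE b0 mulmx0.
have [A [e [c AE]]] := graph_rank1_line X a b0.
rewrite -NE in AE.
have l1 : 0 < 1 + l by rewrite ltr_wpDr.
have m1' : 0 < 1 - m by rewrite subr_gt0.
pose va := (l + m)^-1 *: (l *: e - c); pose vb := (l + m)^-1 *: (m *: e + c).
have vE (s t : R) : s *: va + t *: vb = (l + m)^-1 *: ((s * l + t * m) *: e + (t - s) *: c).
  by apply/rowP => i; rewrite !mxE; ring.
have lm : l + m != 0 by rewrite gt_eqF.
rewrite -ln_div ?posrE//.
apply: (GrStep (A := A) (a := va) (b := vb)).
- by rewrite ler_pdivlMr//; lra.
- move=> s t s0 t0; have st : 0 < s * l + t * m.
    have sl := mulr_ge0 (ltW s0) l0; have tm := mulr_ge0 (ltW t0) m0.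
    have [lp|lz] := ltP 0 l; first by rewrite ltr_wpDr// mulr_gt0.
    by rewrite ltr_wpDl// mulr_gt0//; lra.
  pose k := (t - s) / (s * l + t * m).
  have kE : k * (s * l + t * m) = t - s by rewrite /k divfK// gt_eqF.
  exists (gr (X + k *: (Y - X))).
    apply: h.
      have : (1 + l * k) * (s * l + t * m) = t * (l + m) by rewrite mulrDl -mulrA kE; ring.
      by rewrite -(pmulr_lgt0 _ st) => ->; exact: mulr_gt0.
    have : (1 - m * k) * (s * l + t * m) = s * (l + m) by rewrite mulrDl mulNr -mulrA kE; ring.
    by rewrite -(pmulr_lgt0 _ st) => ->; exact: mulr_gt0.
  rewrite /= AE vE vlineZ ?invr_eq0//; congr (_ + _)%VS.
  rewrite -[RHS](@vlineZ _ _ (s * l + t * m)^-1) ?invr_eq0 ?gt_eqF//.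
  by rewrite scalerDr !scalerA mulVf ?gt_eqF// scale1r mulrC.
- have -> : va + vb = e.
    by have := vE 1 1; rewrite !scale1r !mul1r subrr scale0r addr0 scalerA mulVf// scale1r.
  by have := AE 0; rewrite !scale0r !addr0.
have -> : va + ((1 + l) / (1 - m)) *: vb = (1 - m)^-1 *: (e + c).
  by apply/rowP => i; rewrite !mxE; field; rewrite gt_eqF// gt_eqF.
by rewrite vlineZ ?invr_eq0 ?gt_eqF//; have := AE 1; rewrite !scale1r subrKC.
Qed.

(** The graphs A + <s *: a + t *: b> share the hyperplane A, so that their
    matrices differ by matrices of rank one with a common row e. The points of
    the pencil that belong to the chart are those where s * phi + t * (1 -
    phi) does not vanish, and (s - t) / (s * phi + t * (1 - phi)) is the
    affine parameter of the line; being defined for all s, t > 0, it forces 0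
    <= phi <= 1. *)
Lemma seg_step_of_gr Om X y d : Om `<=` affine_chart W -> gr_step Om (gr X) y d ->
  exists2 Y, y = gr Y & Y = X \/ seg_step (chart_coord u w Om) X Y d.
Proof.
move=> OW XYd; have [OX Oy] := gr_step_in XYd.
have [Y yY] := chart_surj uw (OW _ Oy); exists Y => //.
have [/eqP|YX] := eqVneq Y X; first by move/eqP; left.
right; case: d / XYd => A a b r r1 h xE yE; rewrite {y}yY in Oy yE.
have r0 : 0 < r by exact: lt_le_trans r1.
have /= xE' := xE; have /= yE' := yE.
have coord (s t : R) : 0 < s -> 0 < t ->
    exists Z, Om (gr Z) /\ graph_space u w Z = (A + <[s *: a + t *: b]>)%VS.
  move=> s0 t0; have [z Omz zE] := h s t s0 t0.
  by have [Z zZ] := chart_surj uw (OW _ Omz); exists Z; rewrite -zZ; split=> //; rewrite -zE zZ.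
have YXgr : ~ (val (gr Y) <= graph_space u w X)%VS.
  by move=> /gr_eq_sub/gr_of_inj YX'; move/eqP: YX.
have abA : a + b \notin A.
  apply/negP => abA; have XA : graph_space u w X = A.
    by rewrite xE'; apply/addv_idPl; rewrite -memvE.
  have XY : (val (gr X) <= graph_space u w Y)%VS by rewrite /= yE' XA addvSl.
  by apply: YXgr; rewrite -(gr_eq_sub uw XY).
have [f [fA fab]] := subspace_functional abA.
have AX v : v \in A -> v \in graph_space u w X.
  by move=> vA; rewrite xE'; apply: (subvP (addvSl _ _)).
have abX : a + b \in graph_space u w X.
  by rewrite xE'; apply: (subvP (addvSr _ _)); exact: memv_line.
pose e : 'rV[R]_p := \row_j f (graph_vec u w X j).
have eE v : v \in graph_space u w X -> e *m cP v = (f v)%:M.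
  rewrite (mem_graph uw) => /eqP vX; rewrite {2}(graph_vec_sum uw vX).
  apply/matrixP => i k; rewrite !ord1 !mxE eqxx linear_sum mulr1n.
  by apply: eq_bigr => j _; rewrite linearZ/= mxE mulrC.
(* k0 measures how far a is from the graph of X; b is as far on the other
   side. *)
pose k0 := cQ a - X *m cP a; pose phi := (e *m cP a) 0 0.
have phiE : e *m cP a = phi%:M by exact: mx11_scalar.
have eb : e *m cP b = (1 - phi)%:M.
  have := eE _ abX; rewrite fab linearD/= mulmxDr phiE => /(canRL (addKr _)) ->.
  by rewrite addrC raddfB.
have k0b : cQ b - X *m cP b = - k0.
  have h1 : cQ a + cQ b = X *m cP a + X *m cP b.
    by move: abX; rewrite (mem_graph uw) !linearD/= => /eqP.
  have -> : cQ b = X *m cP a + X *m cP b - cQ a by rewrite -h1 addrC addKr.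
  by rewrite /k0 opprB addrAC addrK.
have key (s t : R) Z : graph_space u w Z = (A + <[s *: a + t *: b]>)%VS ->
    exists2 v : 'cV_q, Z - X = v *m e & (s * phi + t * (1 - phi)) *: v = (s - t) *: k0.
  move=> ZE; pose v := (Z - X) *m cP (a + b).
  have Zv : Z - X = v *m e.
    apply/matrixP => i j.
    have h1 (M : 'M[R]_(q, p)) : M i j = (M *m (delta_mx j 0 : 'cV_p)) i 0.
      by rewrite -colE mxE.
    rewrite h1 [RHS]h1; congr (fun_of_matrix _ i 0).
    set al := delta_mx j 0; have [y [yP yQ]] : exists y, cP y = al /\ cQ y = X *m al.
      by exists (chart_vec u w al (X *m al)); exact: chart_vecK uw _ _.
    have yX : y \in graph_space u w X by rewrite (mem_graph uw) yP yQ.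
    have := eE _ yX; rewrite yP -mulmxA => ->.
    move: yX; rewrite xE' => /memv_addP[g gA [_ /vlineP[k ->] yE'']].
    rewrite yE'' linearD fA// add0r linearZ/= fab mulr1 mul_mx_scalar.
    rewrite -yP yE'' linearD linearZ/= mulmxDr -scalemxAr -/v.
    suff -> : (Z - X) *m cP g = 0 by rewrite add0r.
    have gZ : g \in graph_space u w Z by rewrite ZE (subvP (addvSl _ _)).
    have := AX _ gA; move: gZ; rewrite !(mem_graph uw) mulmxBl => /eqP <- /eqP <-.
    by rewrite subrr.
  exists v => //.
  have gZ : s *: a + t *: b \in graph_space u w Z.
    by rewrite ZE (subvP (addvSr _ _))// memv_line.
  have h1 : (Z - X) *m cP (s *: a + t *: b) = (s * phi + t * (1 - phi)) *: v.
    rewrite Zv -mulmxA linearD !linearZ/= mulmxDr -!scalemxAr phiE eb.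
    by rewrite !scale_scalar_mx -raddfD/= mul_mx_scalar.
  rewrite -h1 mulmxBl; move: gZ; rewrite (mem_graph uw) => /eqP <-.
  by rewrite !linearD !linearZ/= addrACA -!scalerDr k0b scalerN -scalerBl.
have k00 : k0 != 0.
  apply/eqP => k00; apply: YXgr; rewrite yE.
  have aX : a \in graph_space u w X.
    by rewrite (mem_graph uw) -subr_eq0 -/k0 k00.
  have bX : b \in graph_space u w X by rewrite -[b](addKr a) memvD ?memvN.
  rewrite subv_add -memvE memvD ?memvZ// andbT.
  by apply/subvP => y; exact: AX.
have den0 (s t : R) : 0 < s -> 0 < t -> s * phi + t * (1 - phi) != 0.
  move=> s0 t0; have [<-|st] := eqVneq s t.
    by rewrite -mulrDr subrKC mulr1 gt_eqF.
  apply/eqP => den0; have [Z [_ /key[v _]]] := coord s t s0 t0.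
  rewrite den0 scale0r => /esym/eqP; rewrite scaler_eq0 (negbTE k00) orbF.
  by rewrite subr_eq0 (negbTE st).
have phi0 : 0 <= phi.
  rewrite leNgt; apply/negP => phi0.
  by have := den0 (1 - phi) (- phi); rewrite mulNr mulrC subrr eqxx => /(_ _ _)/negP; case; lra.
have phi1 : phi <= 1.
  rewrite leNgt; apply/negP => phi1.
  have : (phi - 1) * phi + phi * (1 - phi) = 0 by ring.
  by move/eqP; apply/negP/den0; lra.
pose D0 := phi + r * (1 - phi).
have D00 : 0 < D0 by rewrite /D0; nra.
have YXE : Y - X = ((1 - r) / D0) *: (k0 *m e).
  have [|v -> ] := key 1 r Y; first by rewrite yE' scale1r.
  rewrite mul1r -/D0 => vE; rewrite mulrC -scalerA scalemxAl -vE -scalemxAl.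
  by rewrite scalerA mulVf ?gt_eqF// scale1r.
have r1' : 1 < r.
  rewrite lt_neqAle r1 andbT; apply: contra_neq YX => r1'.
  by apply/eqP; rewrite -subr_eq0 YXE -r1' subrr mul0r scale0r.
pose l := phi * (r - 1) / D0; pose m := (1 - phi) * (r - 1) / D0.
have lE : 1 + l = r / D0 by rewrite /l /D0; field; rewrite gt_eqF.
have mE : 1 - m = D0^-1 by rewrite /m /D0; field; rewrite gt_eqF.
have lmE : l + m = (r - 1) / D0 by rewrite /l /m; field; rewrite gt_eqF.
have -> : ln r = ln (1 + l) - ln (1 - m).
  by rewrite lE mE lnV ?posrE// opprK lnM ?posrE ?invr_gt0// lnV ?posrE// subrK.
rewrite (chart_coordE uw); split.
- by rewrite divr_ge0 ?mulr_ge0 ?subr_ge0 ?(ltW D00).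
- by rewrite divr_ge0 ?mulr_ge0 ?subr_ge0 ?(ltW D00).
- by rewrite lmE divr_gt0 ?subr_gt0.
- by rewrite -subr_gt0 mE invr_gt0.
- by rewrite YXE; apply: rank_le1Z; exists k0^T, e; rewrite trmxK.
move=> t t1 t2; have [Z [OZ ZE]] := coord _ _ t2 t1.
suff -> : X + t *: (Y - X) = Z by [].
have [v ZX] := key _ _ _ ZE.
have -> : (1 - m * t) * phi + (1 + l * t) * (1 - phi) = 1.
  by rewrite /l /m; field; rewrite gt_eqF.
rewrite scale1r => vE; rewrite -[Z](subrKC X) ZX vE YXE -scalemxAl scalerA.
congr (_ + _ *: _); rewrite (_ : 1 - m * t - (1 + l * t) = - ((l + m) * t)); last by ring.
by rewrite lmE; ring.
Qed.

(** The steps of both kinds correspond to each other with equal costs, apart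
    from steps that join a point to itself. *)
Lemma gr_dist_chart Om X Y : Om `<=` affine_chart W ->
  chain_dist (gr_step Om) (gr X) (gr Y) = chain_dist (seg_step (chart_coord u w Om)) X Y.
Proof.
move=> OW; have h1 := chain_map (@gr_step_of_seg Om).
have h2 L : chain (gr_step Om) (gr X) (gr Y) L ->
    exists2 L', chain (seg_step (chart_coord u w Om)) X Y L' & L' <= L.
  move: (erefl (gr X)) (erefl (gr Y)); move: {1 3}(gr X) {1 3}(gr Y) => x y + + xy.
  elim: xy X => {x y L} [x|x y z d L xy yz IH] X' xX' zY.
    exists 0 => //; rewrite (_ : Y = X'); first exact: chain_nil.
    by apply: (@gr_of_inj _ _ _ _ _ _ _ uw); rewrite -zY.
  have d0 := gr_step_ge0 xy; rewrite xX' in xy.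
  have [Y' yY' h] := seg_step_of_gr OW xy.
  have [L' YL' LL'] := IH Y' yY' zY.
  case: h => [YX|XY].
    by exists L'; [rewrite -YX|rewrite (le_trans LL')// lerDr].
  by exists (d + L'); [exact: chain_cons XY YL'|rewrite lerD2l].
have ge1 := @gr_step_ge0 _ _ _ Om; have ge2 := @seg_step_ge0 _ _ _ (chart_coord u w Om).
have [[L gL]|noL] := pselect (exists L, chain (gr_step Om) (gr X) (gr Y) L).
  have [L' sL' _] := h2 _ gL.
  apply/eqP; rewrite eq_le; apply/andP; split; apply/ler_addgt0Pr => e e0.
    have [|L1 c1 /ltW le1] := @chain_dist_lt _ _ _ X Y
        (chain_dist (seg_step (chart_coord u w Om)) X Y + e) (ex_intro _ _ sL').
      by rewrite ltrDl.
    exact: le_trans (chain_dist_le ge1 (h1 _ _ _ c1)) le1.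
  have [|L1 c1 /ltW le1] := @chain_dist_lt _ _ _ (gr X) (gr Y)
      (chain_dist (gr_step Om) (gr X) (gr Y) + e) (ex_intro _ _ gL).
    by rewrite ltrDl.
  have [L2 c2 le2] := h2 _ c1.
  exact: le_trans (le_trans (chain_dist_le ge2 c2) le2) le1.
rewrite /chain_dist; congr inf; apply/seteqP; split=> L /= hL; exfalso; apply: noL.
  by exists L.
by exists L; exact: h1.
Qed.

End StepsInChart.

(** * Pluecker coordinates *)

Section CauchyBinet.
Variables (R : realType) (p n : nat).

Lemma sort_injection (g : 'I_p -> 'I_n) : injective g ->
  exists (k : incr_map p n) (s : 'S_p), forall i, g i = val k (s i).
Proof.
move=> g_inj; pose e := [seq x <- enum 'I_n | x \in codom g].
have se : size e = p.
  rewrite -[RHS]card_ord -(card_codom g_inj) cardE.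
  by rewrite /enum_mem -enumT.
have ue : uniq e by rewrite filter_uniq// enum_uniq.
have lt_trans3 : transitive (fun a b : 'I_n => (a < b)%N).
  by move=> a b c; exact: ltn_trans.
have soe : sorted (fun a b : 'I_n => (a < b)%N) e.
  apply: sorted_filter => //.
  by have := iota_ltn_sorted 0 n; rewrite -val_enum_ord sorted_map.
pose h := [ffun i : 'I_p => nth (g i) e i].
have hi : [forall i : 'I_p, forall j : 'I_p, (i < j)%N ==> (h i < h j)%N].
  apply/forallP => i; apply/forallP => j; apply/implyP => ij; rewrite !ffunE.
  rewrite (set_nth_default (g j) (g i)) ?se//.
  by apply: (@sorted_ltn_nth _ (fun a b : 'I_n => (a < b)%N)); rewrite ?inE ?se.
have ge i : g i \in e by rewrite mem_filter codom_f mem_enum.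
have idx i : (index (g i) e < p)%N by rewrite -[X in (_ < X)%N]se index_mem.
have s_inj : injective (fun i => Ordinal (idx i)).
  move=> i j [ij]; apply: g_inj.
  by rewrite -(nth_index (g i) (ge i)) ij nth_index.
exists (exist _ h hi), (perm s_inj) => i.
by rewrite permE /= ffunE nth_index.
Qed.

(** Up to the sign a minor is one of the coordinates of the wedge when the
    columns are distinct; otherwise it vanishes. *)
Lemma minor_linear (g : 'I_p -> 'I_n) : exists xi : 'cV[R]_(ext_dim p n),
  forall s, \det (colsub g (rows_of p s)) = (wedge p s *m xi) 0 0.
Proof.
have [/injectiveP g_inj|] := boolP (injectiveb g).
  have [k [s gE]] := sort_injection g_inj.
  exists ((-1) ^+ s *: delta_mx (enum_rank k) 0) => t.
  rewrite -scalemxAr -colE !mxE enum_rankK.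
  have -> : colsub g (rows_of p t) = col_perm s (colsub (val k) (rows_of p t)).
    by apply/matrixP => i j; rewrite !mxE gE.
  by rewrite col_permE det_mulmx det_perm odd_permV mulrC.
move/injectivePn => [i [j ij gij]]; exists 0 => s; rewrite mulmx0 mxE -det_tr.
by apply: (determinant_alternate ij) => k; rewrite !mxE gij.
Qed.

Lemma det_mulmx_sum (A : 'M[R]_(p, n)) (B : 'M[R]_(n, p)) :
  \det (A *m B) = \sum_(g : {ffun 'I_p -> 'I_n}) (\prod_i A i (g i)) * \det (rowsub g B).
Proof.
rewrite /determinant.
under eq_bigr => s _ do under eq_bigr => i _ do rewrite mxE.
under eq_bigr => s _ do rewrite bigA_distr_bigA/= mulr_sumr.
rewrite exchange_big/=; apply: eq_bigr => g _; rewrite mulr_sumr.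
apply: eq_bigr => s _; rewrite big_split/= mulrCA; congr (_ * (_ * _)).
by apply: eq_bigr => i _; rewrite mxE.
Qed.

(** The Cauchy-Binet formula, with the coefficients left implicit. *)
Lemma det_mulmx_linear (B : 'M[R]_(n, p)) : exists xi : 'cV[R]_(ext_dim p n),
  forall s, \det (rows_of p s *m B) = (wedge p s *m xi) 0 0.
Proof.
have /choice[xi hxi] g := minor_linear (fun i => (g : {ffun 'I_p -> 'I_n}) i).
exists (\sum_(g : {ffun 'I_p -> 'I_n}) (\prod_i B (g i) i) *: xi g) => s.
rewrite -det_tr trmx_mul det_mulmx_sum mulmx_sumr summxE; apply: eq_bigr => g _.
rewrite -scalemxAr mxE -hxi; congr (_ * _); first by apply: eq_bigr => i _; rewrite mxE.
by rewrite -det_tr; congr (\det _); apply/matrixP => i j; rewrite !mxE.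
Qed.

(** The cofactors along column j are those of the identity matrix. *)
Lemma det_replace_col (x : 'I_p -> R) (j : 'I_p) :
  \det (\matrix_(k, l) (if l == j then x k else (k == l)%:R)) = x j.
Proof.
rewrite (expand_det_col _ j); set M := \matrix_(k, l) _.
have adj1 : \adj (1%:M : 'M[R]_p) = 1%:M.
  by have := mul_adj_mx (1%:M : 'M[R]_p); rewrite mulmx1 det1.
have cof k : cofactor M k j = (j == k)%:R.
  have := congr1 (fun A : 'M[R]_p => A j k) adj1; rewrite !mxE => <-.
  rewrite /cofactor; congr (_ * \det _); apply/matrixP => a b.
  by rewrite !mxE eq_sym (negbTE (neq_lift _ _)).
rewrite (bigD1 j)//= cof eqxx mulr1 mxE eqxx big1 ?addr0// => k kj.
by rewrite cof eq_sym (negbTE kj) mulr0.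
Qed.

End CauchyBinet.

Section ChartTopology.
Variables (R : realType) (p q : nat).
Local Notation V := 'rV[R]_(p + q).
Variables (W : {vspace V}) (U0 : Gr R p q) (u : p.-tuple V) (w : q.-tuple V).
Hypothesis uw : chart_bases W U0 u w.
Implicit Types (X Y : 'M[R]_(q, p)) (Om : set (Gr R p q)).
Local Notation cP := (chart_fst u w).
Local Notation cQ := (chart_snd u w).
Local Notation gr := (gr_of uw).

Definition chart_wedge X : 'rV[R]_(ext_dim p (p + q)) :=
  wedge p [tuple graph_vec u w X j | j < p].

Lemma pluecker_gr X : val (pluecker (gr X)) = <[chart_wedge X]>%VS.
Proof. exact: plueckerE (graph_vec_basis uw X). Qed.

Lemma chart_wedge_neq0 X : chart_wedge X != 0.
Proof. by apply: wedge_neq0 (graph_vec_free uw X); rewrite size_tuple. Qed.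

Lemma continuous_sum (T : topologicalType) (K : numFieldType) (E : normedModType K)
    (I : Type) (r : seq I) (F : I -> T -> E) :
  (forall i, continuous (F i)) -> continuous (fun x => \sum_(i <- r) F i x).
Proof.
move=> cF; apply: continuous_big => // x.
exact: add_continuous.
Qed.

Lemma continuous_prod (T : topologicalType) (I : Type) (r : seq I) (F : I -> T -> R) :
  (forall i, continuous (F i)) -> continuous (fun x => \prod_(i <- r) F i x).
Proof.
move=> cF; apply: continuous_big => // x.
exact: mul_continuous.
Qed.

Lemma chart_wedge_continuous : continuous chart_wedge.
Proof.
have -> : chart_wedge = fun X => \sum_k chart_wedge X 0 k *: delta_mx 0 k.
  by apply/funext => X; rewrite {1}[chart_wedge X]row_sum_delta.
suff h k : continuous (fun X => chart_wedge X 0 k : R).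
  by apply: continuous_sum => k X; exact: cvgZr_tmp (h k X).
pose g := val (enum_val k : incr_map p (p + q)).
rewrite (_ : (fun X => _) = fun X => \sum_(s : 'S_p) (-1) ^+ s *
    \prod_i (tnth u i 0 (g (s i)) + \sum_(l < q) X l i * tnth w l 0 (g (s i)))); last first.
  apply/funext => X; rewrite mxE /determinant; apply: eq_bigr => s _; congr (_ * _).
  apply: eq_bigr => i _; rewrite !mxE graph_vec_nth mxE summxE; congr (_ + _).
  by apply: eq_bigr => l _; rewrite mxE.
have hs i j : continuous (fun X : 'M[R]_(q, p) =>
    \sum_(l < q) X l i * tnth w l 0 j : R).
  apply: (@continuous_sum _ R R^o) => l X.
  exact: cvgMr_tmp (@coord_continuous R q p l i X).
have hp s : continuous (fun X : 'M[R]_(q, p) =>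
    \prod_i (tnth u i 0 (g (s i)) + \sum_(l < q) X l i * tnth w l 0 (g (s i))) : R).
  by apply: continuous_prod => i X; exact: cvgD (cvg_cst _) (hs _ _ X).
by apply: (@continuous_sum _ R R^o) => s X; exact: cvgMl_tmp (hp s X).
Qed.

Lemma chart_coord_open Om : open Om -> open (chart_coord u w Om).
Proof.
case=> O' oO' OE; rewrite (chart_coordE uw) -OE.
have -> : gr @^-1` (@pluecker R p q @^-1` O') = chart_wedge @^-1` proj_cone O'.
  apply/seteqP; split=> X /= => [hX|[w0 [l Ol wl]]].
    split; first exact: chart_wedge_neq0.
    by exists (pluecker (gr X)) => //; rewrite pluecker_gr memv_line.
  rewrite (_ : pluecker (gr X) = l)//; apply: val_inj.
  by rewrite pluecker_gr (proj_memE w0 wl).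
by apply: open_comp => // X _; exact: chart_wedge_continuous.
Qed.

End ChartTopology.

(** * Lines and neighbourhoods in the Grassmannian *)

Section LinesAndNeighbourhoods.
Variables (R : realType) (p q : nat).
Local Notation V := 'rV[R]_(p + q).
Variables (W : {vspace V}) (U0 : Gr R p q) (u : p.-tuple V) (w : q.-tuple V).
Hypothesis uw : chart_bases W U0 u w.
Implicit Types (X Y : 'M[R]_(q, p)) (Om : set (Gr R p q)).
Local Notation cP := (chart_fst u w).
Local Notation cQ := (chart_snd u w).
Local Notation gr := (gr_of uw).

(** The spaces along an affine line of rank one are spanned by g_1, ..., v,
    ..., g_p, where only the vector v at place j0 varies, in a plane. The
    corresponding wedges fill a projective line in the Grassmannian, of which
    the affine line misses one point only. *)
Lemma R_proper_no_rank1_line Om : R_proper Om -> no_rank1_line (chart_coord u w Om).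
Proof.
move=> [_ _ hL] X a b ab0; rewrite (chart_coordE uw) => hX.
have a0 : a != 0 by apply: contra_neq ab0 => ->; rewrite trmx0 mul0mx.
have b0 : b != 0 by apply: contra_neq ab0 => ->; rewrite mulmx0.
have [j0 bj0] : exists j, b 0 j != 0.
  apply/existsP; apply: contraNT b0; rewrite negb_exists => /forallP b0.
  by apply/eqP/rowP => j; move: (b0 j); rewrite negbK mxE => /eqP.
pose k j := b 0 j / b 0 j0.
have [g [gP gQ]] : exists g : 'I_p -> V, (forall j, cP (g j) = delta_mx j 0) /\
    forall j, cQ (g j) = X *m delta_mx j 0.
  exists (graph_vec u w X); split=> j; rewrite (graph_vecE u w).
    exact: (chart_vecK uw _ _).1.
  by rewrite (chart_vecK uw _ _).2 colE.
have [C [CP CQ]] : exists C, cP C = 0 /\ cQ C = a^T.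
  by exists (chart_vec u w 0 a^T); exact: (chart_vecK uw).
pose S v := [tuple if j == j0 then v else g j - k j *: g j0 | j < p].
have SE v (j : 'I_p) : (S v)`_j = if j == j0 then v else g j - k j *: g j0.
  by rewrite -(tnth_nth 0 (S v) j) tnth_mktuple.
pose v s t := s *: g j0 + t *: C.
have vP s t : cP (v s t) = s *: delta_mx j0 0.
  by rewrite linearD !linearZ/= gP CP scaler0 addr0.
have vQ s t : cQ (v s t) = s *: (X *m delta_mx j0 0) + t *: a^T.
  by rewrite linearD !linearZ/= gQ CQ.
have v0 s t : (s != 0) || (t != 0) -> v s t != 0.
  apply: contraTneq => vst; rewrite negb_or !negbK.
  have s0 : s = 0.
    have := vP s t; rewrite vst linear0 => /colP/(_ j0).
    by rewrite !mxE !eqxx mulr1.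
  rewrite s0 eqxx/=; have := vQ s t; rewrite vst linear0 s0 scale0r add0r => /esym/eqP.
  rewrite scaler_eq0 => /orP[//|/eqP at0].
  by move: a0; rewrite -[a]trmxK at0 trmx0 eqxx.
have Sfree s t : (s != 0) || (t != 0) -> free (S (v s t)).
  move=> st; apply/freeP => c c0.
  have cj j : j != j0 -> c j = 0.
    move=> jj0; have := congr1 cP c0; rewrite linear0 linear_sum => /colP/(_ j).
    rewrite mxE summxE (bigD1 j)//= big1 ?addr0 => [|i ij]; rewrite SE.
      rewrite (negbTE jj0) linearZ/= linearB linearZ/= !gP !mxE eqxx (negbTE jj0)/=.
      by rewrite mulr0 subr0 mulr1.
    rewrite linearZ/=; case: eqP => [_|_].
      by rewrite vP !mxE (negbTE jj0) !mulr0.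
    rewrite linearB linearZ/= !gP !mxE (negbTE jj0) eq_sym (negbTE ij)/=.
    by rewrite mulr0 subr0 mulr0.
  move=> j; have [->|/cj//] := eqVneq j j0.
  move: c0; rewrite (bigD1 j0)//= big1 ?addr0 => [|i ij]; last by rewrite cj// scale0r.
  rewrite SE eqxx => /eqP; rewrite scaler_eq0 (negbTE (v0 _ _ st)) orbF.
  by move/eqP.
pose wd x := wedge p (S x).
have wdE s t : wd (v s t) = s *: wd (g j0) + t *: wd C.
  apply/rowP => i; rewrite !mxE; apply: (determinant_multilinear (i0 := j0)).
  - by apply/rowP => l; rewrite !mxE !SE eqxx !mxE.
  - by apply/matrixP => l m; rewrite !mxE !SE eq_sym (negbTE (neq_lift _ _)).
  - by apply/matrixP => l m; rewrite !mxE !SE eq_sym (negbTE (neq_lift _ _)).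
have wd0 s t : (s != 0) || (t != 0) -> wd (v s t) != 0.
  by move=> st; apply: wedge_neq0; rewrite ?size_tuple ?Sfree.
pose L := (<[wd (g j0)]> + <[wd C]>)%VS.
have memL om : om \in L -> exists s t, om = wd (v s t).
  by move=> /memv_addP[_ /vlineP[s ->] [_ /vlineP[t ->] ->]]; exists s, t; rewrite wdE.
have lineL l : on_proj_line L l -> exists s t, (s != 0) || (t != 0) /\ val l = <[wd (v s t)]>%VS.
  move=> lL; have l0 : val l != 0%VS by rewrite -dimv_eq0 (eqP (valP l)).
  have pl : vpick (val l) != 0 by rewrite vpick0.
  have [s [t st]] := memL _ (subvP lL _ (memv_pick (val l))).
  exists s, t; split; last by rewrite -st; exact: proj_memE (memv_pick _).
  move: pl; rewrite st wdE; apply: contraR; rewrite negb_or !negbK => /andP[/eqP -> /eqP ->].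
  by rewrite !scale0r addr0.
have dL : \dim L = 2.
  have : free [:: wd (g j0); wd C].
    rewrite free_cons seq1_free span_seq1; apply/andP; split.
      apply/negP => /vlineP[c gc]; have := wd0 1 (- c).
      by rewrite oner_neq0 wdE scale1r gc scaleNr subrr eqxx => /(_ isT).
    by have := wd0 0 1; rewrite oner_neq0 orbT wdE scale0r add0r scale1r => ->.
  by rewrite /free span_cons span_seq1 => /eqP.
have glL : gr_lines L.
  split=> // l /lineL[s [t [st lE]]].
  have dS : \dim (span (S (v s t))) == p by have := Sfree _ _ st; rewrite /free size_tuple.
  exists (exist _ (span (S (v s t))) dS : Gr R p q) => //.
  apply: val_inj; rewrite lE; apply: plueckerE.
  by apply/andP; split; [exact: eqxx|exact: Sfree].
(* The point [wd C] at infinity is the only one whose space is not a graph. *)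
have at_infinity l : (on_proj_line L `\` (@pluecker R p q @` Om)) l -> val l = <[wd C]>%VS.
  move=> [/lineL[s [t [st lE]]] lOm].
  have [s0|s0] := eqVneq s 0.
    have t0 : t != 0 by move: st; rewrite s0 eqxx.
    by rewrite lE wdE s0 scale0r add0r vlineZ.
  exfalso; apply: lOm; pose tau := t / (s * b 0 j0).
  exists (gr (X + tau *: (a^T *m b))); first exact: hX.
  apply: val_inj; rewrite lE; apply: plueckerE.
  rewrite basisEfree; apply/and3P; split; first exact: Sfree; last first.
    by rewrite (eqP (graph_dim uw _)) size_tuple.
  apply/span_subvP => x /(nthP 0)[i]; rewrite size_tuple => ip <-.
  rewrite (SE _ (Ordinal ip)); have [_|_] := eqVneq (Ordinal ip) j0;
    rewrite (mem_graph uw); apply/eqP.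
    rewrite vP vQ mulmxDl -!scalemxAr -scalemxAl -mulmxA -[b *m _]colE.
    rewrite [col j0 b]mx11_scalar mxE mul_mx_scalar !scalerA.
    by congr (_ + _ *: _); rewrite /tau; field; rewrite ?s0 ?bj0.
  set i' := Ordinal ip; pose y : 'cV[R]_p := delta_mx i' 0 - k i' *: delta_mx j0 0.
  have yP : cP (g i' - k i' *: g j0) = y by rewrite linearB linearZ/= !gP.
  have yQ : cQ (g i' - k i' *: g j0) = X *m y.
    by rewrite linearB linearZ/= !gQ mulmxBr -scalemxAr.
  have by0 : b *m y = 0.
    rewrite mulmxBr -scalemxAr -!colE; apply/matrixP => c d.
    by rewrite !ord1 !mxE /k divfK// subrr.
  by rewrite yP yQ mulmxDl -scalemxAl -mulmxA by0 mulmx0 scaler0 addr0.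
have [l1 [l2 [l12 h1 h2]]] := hL L glL.
by apply: l12; apply: val_inj; rewrite (at_infinity _ h1) (at_infinity _ h2).
Qed.

(** By Cauchy-Binet the entries of X are quotients of linear forms in the
    Pluecker coordinates of its graph, with a common denominator that vanishes
    exactly outside the chart. *)
Lemma gr_of_nbhs X0 (e : R) : 0 < e ->
  nbhs (gr X0) [set x | exists2 X, x = gr X & `|X - X0| < e].
Proof.
move=> e0.
pose BP : 'M[R]_(p + q, p) := \matrix_(k, j) cP (delta_mx 0 k) j 0.
pose BQ i j : 'M[R]_(p + q, p) := \matrix_(k, l)
  if l == j then cQ (delta_mx 0 k) i 0 else cP (delta_mx 0 k) l 0.
have cPE v j : cP v j 0 = \sum_k v 0 k * cP (delta_mx 0 k) j 0.
  rewrite {1}[v]row_sum_delta linear_sum summxE; apply: eq_bigr => k _.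
  by rewrite linearZ !mxE.
have cQE v i : cQ v i 0 = \sum_k v 0 k * cQ (delta_mx 0 k) i 0.
  rewrite {1}[v]row_sum_delta linear_sum summxE; apply: eq_bigr => k _.
  by rewrite linearZ !mxE.
have [xi0 xi0E] := det_mulmx_linear BP.
have /choice[xi' xi'E] ij := det_mulmx_linear (BQ ij.1 ij.2).
pose f0 (om : 'rV[R]_(ext_dim p (p + q))) := (om *m xi0) 0 0.
pose f i j (om : 'rV[R]_(ext_dim p (p + q))) := (om *m (xi' (i, j) - X0 i j *: xi0)) 0 0.
have cf (x : 'cV[R]_(ext_dim p (p + q))) :
    continuous (fun om : 'rV[R]_(ext_dim p (p + q)) => (om *m x) 0 0 : R).
  have -> : (fun om : 'rV[R]_(ext_dim p (p + q)) => (om *m x) 0 0) =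
      fun om => \sum_k om 0 k * x k 0 by apply/funext => om; rewrite mxE.
  apply: (@continuous_sum _ R R^o) => k om.
  exact: cvgMr_tmp (@coord_continuous R 1 _ 0 k om).
(* On the wedge of the graph of X the quotient f i j om / f0 om is X i j - X0
   i j. The condition is invariant under scaling, hence one on the points of
   the projective space. *)
pose good om := 0 < `|f0 om| /\ forall i j, `|f i j om| < e / 2 * `|f0 om|.
have goodZ c om : c != 0 -> good (c *: om) -> good om.
  have f0Z : f0 (c *: om) = c * f0 om by rewrite /f0 -scalemxAl mxE.
  move=> c0 [h0 h]; have nc : 0 < `|c| by rewrite normr_gt0.
  split=> [|i j]; first by move: h0; rewrite f0Z normrM pmulr_rgt0.
  have := h i j; rewrite f0Z (_ : f i j (c *: om) = c * f i j om).
    by rewrite !normrM mulrCA ltr_pM2l.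
  by rewrite /f -scalemxAl mxE.
pose O' := [set l : proj_space R (ext_dim p (p + q)) |
  forall om, om \in val l -> om != 0 -> good om].
have gE X k : cP (graph_vec u w X k) = delta_mx k 0 /\ cQ (graph_vec u w X k) = col k X.
  by rewrite (graph_vecE u w); exact: (chart_vecK uw).
have f0_wedge X : f0 (chart_wedge u w X) = 1.
  rewrite /f0 -xi0E -(det1 R p); congr (\det _); apply/matrixP => i j.
  rewrite mxE; under eq_bigr => k _.
    rewrite [rows_of _ _ _ _]mxE graph_vec_nth [BP _ _]mxE; over.
  by rewrite /= -cPE (gE _ _).1 !mxE eqxx andbT eq_sym.
have f_wedge X i j : f i j (chart_wedge u w X) = X i j - X0 i j.
  rewrite /f mulmxBr -scalemxAr mxE [fun_of_matrix (- _) _ _]mxE [fun_of_matrix (_ *: _) _ _]mxE.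
  rewrite -/(f0 _) f0_wedge mulr1 -(xi'E (i, j)); congr (_ - _).
  rewrite -[RHS](det_replace_col (X i) j); congr (\det _); apply/matrixP => k l.
  rewrite mxE [RHS]mxE; under eq_bigr => m _.
    rewrite [rows_of _ _ _ _]mxE graph_vec_nth [BQ _ _ _ _]mxE; over.
  rewrite /=; case: eqP => [_|_]; first by rewrite -cQE (gE _ _).2 mxE.
  by rewrite -cPE (gE _ _).1 !mxE eqxx andbT eq_sym.
have oO' : open O'.
  rewrite /open/= /proj_space_open.
  have -> : proj_cone O' = good.
    apply/seteqP; split=> om /= => [[om0 [l Ol oml]]|gom]; first exact: Ol.
    have om0 : om != 0.
      case: gom => + _; apply: contraTneq => ->.
      by rewrite /f0 mul0mx mxE normr0 ltxx.
    split=> //; exists (exist _ <[om]>%VS (proj_dim_line om0)); last exact: memv_line.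
    move=> om' /= /vlineP[c ->]; rewrite scaler_eq0 negb_or => /andP[c0 _].
    apply: (goodZ c^-1); first by rewrite invr_eq0.
    by rewrite scalerA mulVf// scale1r.
  rewrite openE => om [h0 h].
  have n0 : \forall z \near om, 0 < `|f0 z|.
    exact: (cvgr_gt _ (cvg_norm (cf xi0 om)) _ h0).
  suff n1 : \forall z \near om, forall i j, `|f i j z| < e / 2 * `|f0 z|.
    by apply: filterS2 n0 n1 => z z0 z1; split.
  apply: (@filter_forall _ _ (fun i z => forall j, `|f i j z| < e / 2 * `|f0 z|)
    _ (nbhs_filter om)) => i.
  apply: (@filter_forall _ _ (fun j z => `|f i j z| < e / 2 * `|f0 z|) _ (nbhs_filter om)) => j.
  have cg : (e / 2 * `|f0 z| - `|f i j z|) @[z --> om] --> e / 2 * `|f0 om| - `|f i j om|.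
    exact: cvgB (cvgMl_tmp (cvg_norm (cf xi0 om))) (cvg_norm (cf _ om)).
  apply: filterS (cvgr_gt _ cg 0 _) => [z|]; last by rewrite subr_gt0.
  by rewrite subr_gt0.
have e20 : 0 < e / 2 by rewrite divr_gt0.
have O'X0 : O' (pluecker (gr X0)).
  move=> om; rewrite pluecker_gr => /vlineP[c ->]; rewrite scaler_eq0 negb_or => /andP[c0 _].
  apply: (goodZ c^-1); first by rewrite invr_eq0.
  rewrite scalerA mulVf// scale1r; split=> [|i j]; rewrite f0_wedge normr1//.
  by rewrite f_wedge subrr normr0 mulr1.
have sub : @pluecker R p q @^-1` O' `<=` [set x | exists2 X, x = gr X & `|X - X0| < e].
  move=> x /= Ox; pose s := vbasis (val x).
  have ssz : size s == p by rewrite size_tuple (eqP (valP x)).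
  have [f0s _] : good (wedge p s) by apply: Ox; [exact: memv_line|exact: wedge_vbasis_neq0].
  have xW : affine_chart W x.
    apply/eqP; rewrite -subv0; apply/subvP => v /memv_capP[vx].
    rewrite (chart_mem_W uw) memv0 => /eqP v0.
    pose k : 'rV[R]_p := \row_i coord (Tuple ssz) i v.
    have vE : v = \sum_(i < p) k 0 i *: s`_i.
      have -> : v = \sum_(i < p) coord (Tuple ssz) i v *: (Tuple ssz)`_i.
        by apply: coord_span; rewrite (span_basis (vbasisP (val x))).
      by apply: eq_bigr => i _; rewrite mxE.
    have uP : rows_of p s *m BP \in unitmx.
      by rewrite unitmxE unitfE xi0E -normr_gt0.
    have k0 : k *m (rows_of p s *m BP) = 0.
      apply/rowP => j; rewrite mxE [RHS]mxE.
      transitivity (cP v j 0); last by rewrite v0 mxE.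
      rewrite vE linear_sum summxE; apply: eq_bigr => i _; rewrite linearZ [RHS]mxE.
      congr (_ * _); rewrite mxE [RHS]cPE; apply: eq_bigr => l _.
      by rewrite [rows_of _ _ _ _]mxE [BP _ _]mxE.
    have {}k0 : k = 0 by rewrite -[k](mulmxK uP) k0 mul0mx.
    by rewrite vE big1// => i _; rewrite k0 mxE scale0r.
  have [X xX] := chart_surj uw xW; exists X => //.
  have [_ gX] : good (chart_wedge u w X).
    apply: Ox; last exact: (chart_wedge_neq0 uw).
    by rewrite xX pluecker_gr memv_line.
  apply: (@le_lt_trans _ _ (e / 2)); last by lra.
  apply: mx_norm_le => [|i j]; first exact: ltW.
  by have := gX i j; rewrite f_wedge f0_wedge normr1 mulr1 !mxE => /ltW.
apply: filterS sub _; apply: open_nbhs_nbhs; split=> //.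
by exists O'.
Qed.

End LinesAndNeighbourhoods.

(** * Maximal intervals and projective invariance *)

Section MaximalIntervals.
Variables (R : realType) (q p : nat).
Local Notation E := 'M[R]_(q, p).
Implicit Types (D : set E) (X Y Z : E).

(** m is the supremum of the inverses of the parameters at which the ray is
    outside D. *)
Lemma ray_exit D X (N : E) : open D -> is_convex D -> D X ->
  exists2 m : R, 0 <= m & forall t, 0 <= t -> D (X + t *: N) <-> m * t < 1.
Proof.
move=> oD cD DX; have [e e0 De] := open_ball_sub oD DX.
pose S := [set m : R | m = 0 \/ (0 < m /\ ~ D (X + m^-1 *: N))].
have S0 : S 0 by left.
have supS : has_sup S.
  split; first by exists 0.
  exists (`|N| / e) => m [->|[m0 Dm]]; first by rewrite divr_ge0// ltW.
  rewrite leNgt; apply/negP; rewrite ltr_pdivrMr// => Ne; apply: Dm; apply: De.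
  by rewrite addrC addKr normrZ normfV gtr0_norm// mulrC ltr_pdivrMr// mulrC.
have m0 : 0 <= sup S by apply: ub_le_sup => //; exact: supS.2.
exists (sup S) => // t; rewrite le_eqVlt => /predU1P[<-|t0].
  by rewrite scale0r addr0 mulr0 ltr01.
split=> [Dt|mt].
  have [e' e'0 De'] := open_ball_sub oD Dt.
  pose d := e' / (`|N| + 1); have N1 : 0 < `|N| + 1 by rewrite ltr_wpDl.
  have d0 : 0 < d by rewrite divr_gt0.
  have Dtd : D (X + (t + d) *: N).
    apply: De'; rewrite scalerDl addrA [_ + d *: N]addrC addrK normrZ gtr0_norm//.
    by rewrite /d mulrAC ltr_pdivrMr// ltr_pM2l// ltrDl.
  have td0 : 0 < t + d by rewrite addr_gt0.
  have : sup S <= (t + d)^-1.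
    apply: ge_sup; first by exists 0.
    move=> m [->|[m'0 Dm]]; first by rewrite invr_ge0 ltW.
    rewrite leNgt; apply/negP => tdm; apply: Dm.
    have := @convex_segment _ _ _ D X (X + (t + d) *: N) (m^-1 / (t + d)) cD DX Dtd.
    rewrite addrAC subrr add0r scalerA divfK ?gt_eqF//; apply.
    rewrite divr_ge0 ?invr_ge0 ?(ltW m'0) ?(ltW td0)//= ler_pdivrMr// mul1r.
    by rewrite invf_ple ?posrE// ltW.
  move=> h; apply: (@le_lt_trans _ _ ((t + d)^-1 * t)); first by rewrite ler_pM2r.
  by rewrite mulrC ltr_pdivrMr// mul1r ltrDl.
apply: contrapT => Dt; move: mt; rewrite ltNge => /negP; apply.
rewrite -ler_pdivrMr// mul1r; apply: ub_le_sup; first exact: supS.2.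
by right; rewrite invr_gt0 invrK.
Qed.

Lemma max_interval D X (N : E) : open D -> is_convex D -> D X ->
  ~ (forall t, D (X + t *: N)) ->
  exists l m : R, [/\ 0 <= l, 0 <= m, 0 < l + m &
    forall t, D (X + t *: N) <-> 0 < 1 + l * t /\ 0 < 1 - m * t].
Proof.
move=> oD cD DX nD; have [m m0 hm] := ray_exit N oD cD DX.
have [l l0 hl] := ray_exit (- N) oD cD DX.
have h t : D (X + t *: N) <-> 0 < 1 + l * t /\ 0 < 1 - m * t.
  have [t0|/ltW t0] := leP 0 t.
    rewrite (hm t t0) subr_gt0; split=> [->|[]//]; split=> //.
    by rewrite ltr_pwDl// mulr_ge0.
  have Nt : 0 <= - t by rewrite oppr_ge0.
  rewrite -[t]opprK scaleNr -scalerN (hl _ Nt) !mulrN opprK; split=> [h|[]]; last by lra.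
  by have := mulr_ge0 m0 Nt; rewrite mulrN => h2; split; lra.
exists l, m; split=> //; rewrite lt_neqAle addr_ge0// andbT eq_sym.
apply/eqP => lm; apply: nD => t; apply/h.
have -> : l = 0 by lra. have -> : m = 0 by lra.
by rewrite !mul0r addr0 subr0 ltr01.
Qed.

(** Two affine functions that are positive on D and vanish at the ends of the
    interval show, by chain_pos, that no chain is cheaper than the direct
    step. *)
Lemma seg_dist_max_interval D X Y (l m : R) : open D -> is_convex D -> D X -> D Y ->
  rank_le1 (Y - X) -> 0 <= l -> 0 <= m -> 0 < l + m ->
  (forall t, D (X + t *: (Y - X)) <-> 0 < 1 + l * t /\ 0 < 1 - m * t) ->
  chain_dist (seg_step D) X Y = ln (1 + l) - ln (1 - m).
Proof.
move=> oD cD DX DY rk l0 m0 lm h.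
have [_] : 0 < 1 + l * 1 /\ 0 < 1 - m * 1 by apply/h; rewrite scale1r subrKC.
rewrite mulr1 => m1; have l1 : 0 < 1 + l by rewrite ltr_wpDr.
have st : seg_step D X Y (ln (1 + l) - ln (1 - m)).
  by split=> // [|t t1 t2]; [rewrite -subr_gt0|apply/h].
apply/eqP; rewrite eq_le; apply/andP; split.
  by have := chain_dist_le (@seg_step_ge0 _ _ _ D) (chain_step st).
have [c [f [fD fE]]] : exists c f, pos_on D c f /\ c + f Y = (1 + l) * (c + f X).
  have [->|l00] := eqVneq l 0.
    by exists 1, \0; split; [exact: pos_on1|rewrite /= !addr0 mulr1].
  have [|c [f [fD f0]]] := @open_convex_functional _ _ _ D (X + (- l^-1) *: (Y - X)) oD cD.
    by move=> /h[]; rewrite mulrN divff// subrr ltxx.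
  exists c, f; split=> //; move: f0; rewrite linearD linearZ/= linearB => /eqP.
  rewrite mulNr addrA subr_eq0 => /eqP/(congr1 (fun x => l * x)).
  rewrite mulrA divff// mul1r => f0.
  by rewrite mulrDl mul1r f0 -addrA subrKC.
have [c' [g [gD gE]]] : exists c f, pos_on D c f /\ c + f Y = (1 - m) * (c + f X).
  have [->|m00] := eqVneq m 0.
    by exists 1, \0; split; [exact: pos_on1|rewrite /= !addr0 subr0 mulr1].
  have [|c' [g [gD g0]]] := @open_convex_functional _ _ _ D (X + m^-1 *: (Y - X)) oD cD.
    by move=> /h[_]; rewrite divff// subrr ltxx.
  exists c', g; split=> //; move: g0; rewrite linearD linearZ/= linearB => /eqP.
  rewrite addrA addr_eq0 => /eqP/(congr1 (fun x => m * x)).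
  rewrite mulrN mulrA divff// mul1r => g0.
  by rewrite mulrBl mul1r g0 opprK -addrA subrKC.
have fX := fD _ DX; have gX := gD _ DX.
apply: lb_le_inf; first by exists (ln (1 + l) - ln (1 - m)); exact: chain_step.
move=> L XY; have := chain_pos DX XY fD gD; rewrite fE gE => h2.
rewrite -(expRK L) -ln_div ?posrE// ler_ln ?posrE ?divr_gt0 ?expR_gt0//.
rewrite ler_pdivrMr// -(ler_pM2r (mulr_gt0 fX gX)).
by move: h2; congr (_ <= _); ring.
Qed.

End MaximalIntervals.

Section Equivariance.
Variables (R : realType) (p q : nat).
Local Notation V := 'rV[R]_(p + q).
Implicit Types (Om : set (Gr R p q)) (f : GL R (p + q)).

Lemma gr_step_act f Om x y d : gr_step Om x y d ->
  gr_step (GL_act f @` Om) (GL_act f x) (GL_act f y) d.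
Proof.
case=> A a b r r1 h xE yE.
apply: (GrStep (A := (val f @: A)%VS) (a := val f a) (b := val f b)) => //=.
- move=> s t s0 t0; have [z Oz zE] := h s t s0 t0; exists (GL_act f z); first by exists z.
  by rewrite /= zE limgD limg_line linearD !linearZ.
- by rewrite xE limgD limg_line linearD.
- by rewrite yE limgD limg_line linearD linearZ.
Qed.

Lemma GL_act_inverse f : exists g, cancel (GL_act f) (GL_act g).
Proof.
have kf : lker (val f) == 0%VS := valP f.
have kg : lker (val f)^-1%VF == 0%VS.
  apply/lker0P => x y /(congr1 (val f)).
  by rewrite -!comp_lfunE (lker0_compfV kf) !id_lfunE.
exists (exist (fun g : 'End(V) => lker g == 0%VS) _ kg) => U; apply: val_inj => /=.
by rewrite -limg_comp (lker0_compVf kf) lim1g.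
Qed.

Lemma gr_dist_act f Om x y :
  chain_dist (gr_step (GL_act f @` Om)) (GL_act f x) (GL_act f y) = chain_dist (gr_step Om) x y.
Proof.
have [g gf] := GL_act_inverse f.
congr inf; apply/seteqP; split=> L /=; last first.
  by apply: chain_map => a b d; exact: gr_step_act.
rewrite -{2}[x]gf -{2}[y]gf; apply: chain_map => a b d /(gr_step_act g).
by rewrite image_comp (_ : GL_act g \o GL_act f = id) ?image_id//; apply/funext => z; exact: gf.
Qed.

End Equivariance.

(** * The metric of a convex set *)

Section ConvexProperSets.
Variables (R : realType) (p q : nat).
Local Notation V := 'rV[R]_(p + q).
Implicit Types (Om : set (Gr R p q)) (x y : Gr R p q).

(** The Kobayashi distance, with projective intervals in the place of
    holomorphic discs. *)
Definition kob_dist Om x y : R := chain_dist (gr_step Om) x y.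

Lemma proper_chart Om W (U0 : Gr R p q) u w (uw : chart_bases W U0 u w) :
  R_proper Om -> convex_in_chart W Om ->
  [/\ open (chart_coord u w Om), is_convex (chart_coord u w Om) &
      no_rank1_line (chart_coord u w Om)].
Proof.
move=> Rp cO; split; last exact: (R_proper_no_rank1_line uw).
  by apply: (chart_coord_open uw); case: Rp.
exact: (convex_chart_coord uw).
Qed.

Lemma convex_proper_chart Om : convex_proper Om ->
  exists W (U0 : Gr R p q) u w (uw : chart_bases W U0 u w),
  [/\ Om `<=` affine_chart W, open (chart_coord u w Om),
    is_convex (chart_coord u w Om) & no_rank1_line (chart_coord u w Om)].
Proof.
case=> _ _ Rp [W [_ cO]]; have [OW [U0 [u [w [uw _]]]]] := cO.
exists W, U0, u, w, uw; have [] := proper_chart uw Rp cO.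
by split.
Qed.

Lemma kob_complete_length Om : convex_proper Om -> complete_length_metric_on Om (kob_dist Om).
Proof.
move=> /convex_proper_chart[W [U0 [u [w [uw [OW oD cD nD]]]]]].
set D := chart_coord u w Om in oD cD nD.
have DE X : D X = Om (gr_of uw X) by rewrite /D (chart_coordE uw).
have coord x : Om x -> exists2 X, x = gr_of uw X & D X.
  by move=> Ox; have [X xX] := chart_surj uw (OW _ Ox); exists X => //; rewrite DE -xX.
have kE X Y : kob_dist Om (gr_of uw X) (gr_of uw Y) = chain_dist (seg_step D) X Y.
  exact: gr_dist_chart.
have chainable x y : Om x -> Om y -> exists L, chain (gr_step Om) x y L.
  move=> /coord[X -> DX] /coord[Y -> DY].
  have [L XY] := seg_chainable oD cD DX DY; exists L.
  exact: chain_map (@gr_step_of_seg _ _ _ _ _ _ _ uw Om) _ _ _ XY.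
have ge0 := @gr_step_ge0 R p q Om.
split.
- split=> [x y _ _|x y|x y _ _|x y z Ox Oy Oz].
  + exact: chain_dist_ge0 ge0 _ _.
  + move=> /coord[X -> DX] /coord[Y -> DY]; rewrite kE; split=> [XY0|/gr_of_inj ->].
      by rewrite (seg_dist_eq0 oD cD nD DX DY XY0).
    exact: chain_distxx (@seg_step_ge0 _ _ _ D) _.
  + exact: chain_distC (@gr_step_sym R p q Om) _ _.
  + exact (chain_dist_triangle ge0 (chainable _ _ Ox Oy) (chainable _ _ Oy Oz)).
- move=> x Ox cx; have /choice[X hX] n : exists X, x n = gr_of uw X /\ D X.
    by have [X xX DX] := coord _ (Ox n); exists X.
  have [||Z DZ XZ] := @seg_dist_complete _ _ _ D X oD cD nD.
  + by move=> n; exact: (hX n).2.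
  + move=> e /cx[N hN]; exists N => m n Nm Nn.
    by rewrite -kE -(hX m).1 -(hX n).1; exact: hN.
  exists (gr_of uw Z); first by rewrite -DE.
  apply/cvgrPdist_lt => e /XZ[N hN]; exists N => // n /= Nn.
  rewrite sub0r normrN ger0_norm; last exact: chain_dist_ge0 ge0 _ _.
  by rewrite (hX n).1 kE; exact: hN.
- move=> x y Ox Oy.
  exact: (chain_dist_length ge0 (@gr_step_sym R p q Om) (@gr_step_geodesic R p q Om)
    chainable Ox Oy).
Qed.

Lemma kob_dist_act Om (F : PGL R (p + q)) x y :
  kob_dist (PGL_act F @` Om) (PGL_act F x) (PGL_act F y) = kob_dist Om x y.
Proof. exact: gr_dist_act. Qed.

(** By compactness it is enough to find, for each pair of points of Om, a
    neighbourhood on which the convergence is uniform. *)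
Lemma kob_dist_cvg W (U0 : Gr R p q) u w (uw : chart_bases W U0 u w)
    (Omn : nat -> set (Gr R p q)) Om :
  (forall n, R_proper (Omn n) /\ convex_in_chart W (Omn n)) ->
  R_proper Om /\ convex_in_chart W Om ->
  local_hausdorff_cvg (fun n => chart_coord u w (Omn n)) (chart_coord u w Om) ->
  cvg_unif_on_compacts kob_dist Omn Om.
Proof.
move=> hn [Rp cO] cvgO C /compact_near_coveringP covC COm e e0.
have [oD cD nD] := proper_chart uw Rp cO.
have DE Om' X : chart_coord u w Om' X = Om' (gr_of uw X) by rewrite (chart_coordE uw).
pose P n (z : Gr R p q * Gr R p q) := [/\ Omn n z.1, Omn n z.2 &
  `|kob_dist (Omn n) z.1 z.2 - kob_dist Om z.1 z.2| < e].
have : \forall n \near \oo, C `<=` P n.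
  apply: covC => -[x y] /COm[/= Ox Oy].
  have [X xX] := chart_surj uw (cO.1 _ Ox); have [Y yY] := chart_surj uw (cO.1 _ Oy).
  have DX : chart_coord u w Om X by rewrite DE -xX.
  have DY : chart_coord u w Om Y by rewrite DE -yY.
  have [||e' e'0 near_n] := @seg_dist_cvg _ _ _ (fun n => chart_coord u w (Omn n))
    _ X Y e _ _ oD cD nD cvgO DX DY e0.
  - by move=> n; have [] := proper_chart uw (hn n).1 (hn n).2.
  - by move=> n; have [] := proper_chart uw (hn n).1 (hn n).2.
  pose B Z := [set z | exists2 Z', z = gr_of uw Z' & `|Z' - Z| < e'].
  exists (B X `*` B Y, [set n | forall X' Y', `|X' - X| < e' -> `|Y' - Y| < e' ->
    [/\ chart_coord u w (Omn n) X', chart_coord u w (Omn n) Y' &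
     `|chain_dist (seg_step (chart_coord u w (Omn n))) X' Y' -
       chain_dist (seg_step (chart_coord u w Om)) X' Y'| < e]]).
    split=> //=; exists (B X, B Y) => //=; rewrite xX yY.
    by split; exact: gr_of_nbhs.
  move=> [[x' y'] n] [/= [[X' -> XX'] [Y' -> YY']] hXY].
  have [] := hXY _ _ XX' YY'; rewrite !DE => h1 h2 h3; split=> //=.
  by rewrite /kob_dist !gr_dist_chart//; [exact: cO.1|exact: (hn n).2.1].
apply: filterS => n CP; split=> [z /CP[]|z /CP[]//].
by split.
Qed.

End ConvexProperSets.

(** * The case p = 1 *)

Section Hilbert.
Variables (R : realType) (q : nat).
Local Notation V := 'rV[R]_(1 + q).
Implicit Types (Om : set (Gr R 1 q)) (x y : Gr R 1 q).

(** The vectors va and vb represent the ends of the maximal interval on the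
    line through X and Y. They are scaled so that the point of parameter t is
    (1 - m * t) *: va + (1 + l * t) *: vb. *)
Lemma kob_dist_hilbert Om x y : convex_proper Om -> Om x -> Om y ->
  hilbert_dist Om x y (kob_dist Om x y).
Proof.
move=> /convex_proper_chart[W [U0 [u [w [uw [OW oD cD nD]]]]]] Ox Oy.
set D := chart_coord u w Om in oD cD nD.
have DE Z : D Z = Om (gr_of uw Z) by rewrite /D (chart_coordE uw).
have [xy|xy] := pselect (x = y).
  by left; rewrite xy /kob_dist (chain_distxx (@gr_step_ge0 _ _ _ Om)).
right; split=> //.
have [X xX] := chart_surj uw (OW _ Ox); have [Y yY] := chart_surj uw (OW _ Oy).
have DX : D X by rewrite DE -xX.
have DY : D Y by rewrite DE -yY.
rewrite xX yY /kob_dist gr_dist_chart//.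
have N0 : Y - X != 0.
  by rewrite subr_eq0; apply/eqP => YX; apply: xy; rewrite xX yY YX.
have rk : rank_le1 (Y - X).
  by exists (Y - X)^T, 1%:M; rewrite trmxK mulmx1.
have nl : ~ (forall t, D (X + t *: (Y - X))).
  move: rk N0 => [a [b ->]] ab0; exact: nD.
have [l [m [l0 m0 lm h]]] := max_interval oD cD DX nl.
have [_] : 0 < 1 + l * 1 /\ 0 < 1 - m * 1 by apply/h; rewrite scale1r subrKC.
rewrite mulr1 => m1; have l1 : 0 < 1 + l by rewrite ltr_wpDr.
rewrite (seg_dist_max_interval oD cD DX DY rk l0 m0 lm h).
set N := Y - X in N0 rk nl h.
have vec Z : exists v, chart_fst u w v = 1%:M /\ chart_snd u w v = Z.
  by exists (chart_vec u w 1%:M Z); exact: (chart_vecK uw).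
have [e [eP eQ]] := vec X.
have [c [ccP ccQ]] : exists c, chart_fst u w c = 0 /\ chart_snd u w c = N.
  by exists (chart_vec u w 0 N); exact: (chart_vecK uw).
have graphE Z v : chart_fst u w v = 1%:M -> chart_snd u w v = Z ->
    graph_space u w Z = <[v]>%VS.
  move=> vP vQ; apply/eqP; rewrite eqEsubv; apply/andP; split; last first.
    by rewrite -memvE (mem_graph uw) vP vQ mulmx1.
  apply/subvP => z; rewrite (mem_graph uw) [chart_fst u w z]mx11_scalar => /eqP zZ.
  apply/vlineP; exists (chart_fst u w z 0 0); apply: (chart_inj uw).
    by rewrite linearZ/= vP scale_scalar_mx mulr1 -mx11_scalar.
  by rewrite linearZ/= vQ zZ mul_mx_scalar.
have lm0 : l + m != 0 by rewrite gt_eqF.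
pose va := (l + m)^-1 *: (l *: e - c); pose vb := (l + m)^-1 *: (m *: e + c).
have vE (s t : R) : s *: va + t *: vb = (l + m)^-1 *: ((s * l + t * m) *: e + (t - s) *: c).
  by apply/rowP => i; rewrite !mxE; ring.
have vP (s t : R) : chart_fst u w (s *: va + t *: vb) = ((l + m)^-1 * (s * l + t * m))%:M.
  by rewrite vE linearZ/= linearD !linearZ/= eP ccP scaler0 addr0 !scale_scalar_mx mulr1.
have vQ (s t : R) : chart_snd u w (s *: va + t *: vb) =
    (l + m)^-1 *: ((s * l + t * m) *: X + (t - s) *: N).
  by rewrite vE linearZ/= linearD !linearZ/= eQ ccQ.
have eE : e = 1 *: va + 1 *: vb.
  by apply/rowP => i; rewrite !mxE; field.
have ecE : e + c = (1 - m) *: va + (1 + l) *: vb.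
  by apply/rowP => i; rewrite !mxE; field.
have xE : val (gr_of uw X) = <[e]>%VS by rewrite /= (graphE _ _ eP eQ).
have yE : val (gr_of uw Y) = <[e + c]>%VS.
  by rewrite /= (graphE Y (e + c))// linearD/= ?eP ?ccP ?addr0// eQ ccQ subrKC.
have fr : free [:: va; vb].
  apply/(@freeP _ _ 2 [tuple va; vb]) => k; rewrite !big_ord_recl big_ord0 addr0/=.
  set s := k ord0; set t := k _ => st0.
  have h1 : s * l + t * m = 0.
    have := vP s t; rewrite st0 linear0 => /matrixP/(_ 0 0); rewrite !mxE eqxx mulr1n.
    by move/esym/eqP; rewrite mulf_eq0 invr_eq0 (negbTE lm0)/= => /eqP.
  have h2 : t = s.
    have := vQ s t; rewrite st0 linear0 h1 scale0r add0r => /esym/eqP.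
    rewrite !scaler_eq0 invr_eq0 (negbTE lm0) (negbTE N0) orbF/= subr_eq0.
    by move/eqP.
  have s0 : s = 0.
    by move/eqP: h1; rewrite h2 -mulrDr mulf_eq0 (negbTE lm0) orbF => /eqP.
  by move=> i; case: (unliftP ord0 i) => [j ->|->//]; rewrite (ord1 j) -/t h2.
have sum_xy : (val (gr_of uw X) + val (gr_of uw Y))%VS = span [:: va; vb].
  have add_mem (a b : V) (s t : R) : s *: a + t *: b \in (<[a]> + <[b]>)%VS.
    by rewrite memv_add ?memvZ ?memv_line.
  have m1E : e \in (<[va]> + <[vb]>)%VS by rewrite eE.
  have m2E : e + c \in (<[va]> + <[vb]>)%VS by rewrite ecE.
  have m3E : va \in (<[e]> + <[e + c]>)%VS.
    have -> : va = ((l + m)^-1 * (l + 1)) *: e + (- (l + m)^-1) *: (e + c).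
      by apply/rowP => i; rewrite !mxE; ring.
    exact: add_mem.
  have m4E : vb \in (<[e]> + <[e + c]>)%VS.
    have -> : vb = ((l + m)^-1 * (m - 1)) *: e + (l + m)^-1 *: (e + c).
      by apply/rowP => i; rewrite !mxE; ring.
    exact: add_mem.
  rewrite xE yE span_cons span_seq1; apply/eqP; rewrite eqEsubv !subv_add -!memvE.
  by rewrite m1E m2E m3E m4E.
have bs : basis_of (val (gr_of uw X) + val (gr_of uw Y))%VS [:: va; vb].
  by rewrite sum_xy /basis_of eqxx.
exists [tuple va; vb], va, vb, e, (e + c); split=> //.
- split=> //; apply/seteqP; split=> z /=.
    move=> [Oz zxy]; have [Z zZ] := chart_surj uw (OW _ Oz).
    have [v [vP1 vQ1]] := vec Z; have zv : val z = <[v]>%VS by rewrite zZ /= (graphE Z v).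
    have : v \in (val (gr_of uw X) + val (gr_of uw Y))%VS.
      by apply: (subvP zxy); rewrite zv memv_line.
    rewrite sum_xy span_cons span_seq1 => /memv_addP[_ /vlineP[s ->] [_ /vlineP[t ->] vst]].
    exists s, t; rewrite -vst; have h1 : s * l + t * m = l + m.
      have := vP s t; rewrite -vst vP1 => /matrixP/(_ 0 0); rewrite !mxE eqxx !mulr1n.
      by move/(congr1 (fun r => (l + m) * r)); rewrite mulr1 mulrA divff// mul1r => <-.
    have ZE : Z = X + ((t - s) / (l + m)) *: N.
      have := vQ s t; rewrite -vst vQ1 h1 => ->.
      by rewrite scalerDr !scalerA mulVf// scale1r [_^-1 * _]mulrC.
    have /h[] : D (X + ((t - s) / (l + m)) *: N) by rewrite -ZE DE -zZ.
    have -> : 1 + l * ((t - s) / (l + m)) = t.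
      have h2 : l + m + l * (t - s) = t * (l + m) by rewrite -{1}h1; ring.
      by apply: (mulIf lm0); rewrite -h2; field.
    have -> : 1 - m * ((t - s) / (l + m)) = s.
      have h2 : l + m - m * (t - s) = s * (l + m) by rewrite -{1}h1; ring.
      by apply: (mulIf lm0); rewrite -h2; field.
    by split.
  move=> [s [t [s0 t0 zst]]]; split; last first.
    have := sum_xy; rewrite /= span_cons span_seq1 => ->.
    by rewrite zst -memvE memv_add// memvZ// memv_line.
  have d0 : 0 < s * l + t * m.
    have sl := mulr_ge0 (ltW s0) l0; have tm := mulr_ge0 (ltW t0) m0.
    have [lp|lz] := ltP 0 l; first by rewrite ltr_wpDr// mulr_gt0.
    by rewrite ltr_wpDl// mulr_gt0//; lra.
  pose k := (t - s) / (s * l + t * m).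
  have kd : k * (s * l + t * m) = t - s by rewrite /k divfK// gt_eqF.
  rewrite (_ : z = gr_of uw (X + k *: N)).
    rewrite -DE; apply/h; split; rewrite -(pmulr_lgt0 _ d0).
      have -> : (1 + l * k) * (s * l + t * m) = t * (l + m) by rewrite mulrDl -mulrA kd; ring.
      exact: mulr_gt0.
    have -> : (1 - m * k) * (s * l + t * m) = s * (l + m) by rewrite mulrDl mulNr -mulrA kd; ring.
    exact: mulr_gt0.
  apply: val_inj; apply: (etrans zst); rewrite /= (graphE _ (e + k *: c)).
  - rewrite vE vlineZ ?invr_eq0// -[RHS](@vlineZ _ _ (s * l + t * m)) ?gt_eqF//.
    by rewrite scalerDr scalerA [_ * k]mulrC kd.
  - by rewrite linearD linearZ/= eP ccP scaler0 addr0.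
  - by rewrite linearD linearZ/= eQ ccQ.
- have fr2 : free [tuple va; vb] by [].
  have ca i (j : 'I_2) := @coord_free R _ 2 [tuple va; vb] i j fr2.
  have a0 : coord [tuple va; vb] ord0 va = 1 by rewrite (ca ord0 ord0).
  have a1 : coord [tuple va; vb] ord_max va = 0 by rewrite (ca ord0 ord_max).
  have b0 : coord [tuple va; vb] ord0 vb = 0 by rewrite (ca ord_max ord0).
  have b1 : coord [tuple va; vb] ord_max vb = 1 by rewrite (ca ord_max ord_max).
  have lin i (a b : V) (s t : R) : coord [tuple va; vb] i (s *: a + t *: b) =
      s * coord [tuple va; vb] i a + t * coord [tuple va; vb] i b.
    by rewrite linearD !linearZ.
  rewrite /cross_ratio /pl_bracket ecE eE !lin a0 a1 b0 b1.
  have m1' : 1 - m != 0 by rewrite gt_eqF.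
  rewrite (_ : _ / _ = (1 + l) / (1 - m)); last by field; rewrite m1'.
  rewrite [`|(1 + l) / (1 - m)|]gtr0_norm ?divr_gt0// ln_div ?posrE// ger0_norm//.
  by rewrite subr_ge0 (@le_trans _ _ 0)// ?ln_le0 ?ln_ge0 ?lerDl// gerBl.
Qed.

End Hilbert.

Theorem theorem1p8 (R : realType) (p q : nat) (hp : (1 <= p)%N) (hq : (1 <= q)%N) :
  exists K : set (Gr R p q) -> Gr R p q -> Gr R p q -> R,
    (forall Om, convex_proper Om -> complete_length_metric_on Om (K Om)) /\
    (forall Om, convex_proper Om -> forall F : PGL R (p + q), Aut_gr Om F ->
       forall x y, Om x -> Om y -> K Om (PGL_act F x) (PGL_act F y) = K Om x y) /\
    (forall Om, convex_proper Om -> forall F : PGL R (p + q),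
       forall x y, Om x -> Om y ->
         K Om x y = K (PGL_act F @` Om) (PGL_act F x) (PGL_act F y)) /\
    (* (U0, u, w) is the identification of the chart with R^(pq) *)
    (forall (W0 : {vspace 'rV[R]_(p + q)}) (U0 : Gr R p q)
            (u : p.-tuple 'rV[R]_(p + q)) (w : q.-tuple 'rV[R]_(p + q)),
       chart_bases W0 U0 u w ->
       forall (Omn : nat -> set (Gr R p q)) (Om : set (Gr R p q)),
         (forall n, R_proper (Omn n) /\ convex_in_chart W0 (Omn n)) ->
         R_proper Om /\ convex_in_chart W0 Om ->
         local_hausdorff_cvg (fun n => chart_coord u w (Omn n))
                             (chart_coord u w Om) ->
         cvg_unif_on_compacts K Omn Om) /\
    (p = 1%N -> forall Om, convex_proper Om ->
       forall x y, Om x -> Om y -> hilbert_dist Om x y (K Om x y)).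
Proof.
exists (@kob_dist R p q); split; first exact: kob_complete_length.
split.
  by move=> Om _ F FOm x y _ _; rewrite -[in RHS](kob_dist_act Om F) FOm.
split; first by move=> Om _ F x y _ _; rewrite kob_dist_act.
split; first by move=> W0 U0 u w uw Omn Om; exact: (kob_dist_cvg uw).
by move=> p1; subst p => Om cO x y; exact: kob_dist_hilbert.
Qed.
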